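(* Let $n\geq 1.8\times 10^{17}$ and $5\leq \ell\leq n$ be integers, and let $\mathcal{G}_{n,\ell}$ be the set of all $C_\ell$-free planar graphs of order $n$. Then, up to isomorphism, the following hold. (i) If $5\leq \ell<\frac{2n+5}{3}$, then $${\rm SPEX}(\mathcal{G}_{n,\ell})=\left\{K_2\vee\left(P_{\lceil\frac{\ell-3}{2}\rceil}\cup (a+1)P_{\lfloor\frac{\ell-3}{2}\rfloor}\cup P_b\right)\right\},$$ where $a,b$ are the integers with $n-\ell+1=a\lfloor\frac{\ell-3}{2}\rfloor+b$ and $0\leq b<\lfloor\frac{\ell-3}{2}\rfloor$. (ii) If $\frac{2n+5}{3}\leq \ell\leq n$, then $${\rm SPEX}(\mathcal{G}_{n,\ell})=\left\{K_2\vee\left(P_{2\ell-n-4}\cup 2P_{n-\ell+1}\right)\right\}.$$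
   Context: All graphs are finite, undirected and simple; the order of a graph is its number of vertices. $K_n$, $P_n$, $C_n$ are the complete graph, the path and the cycle on $n$ vertices; $P_0$ is the empty graph (no vertices). A graph is $C_\ell$-free if it contains no cycle of length $\ell$ as a (not necessarily induced) subgraph. A graph is planar if it can be drawn in the plane without crossing edges. $G\cup G'$ denotes disjoint union, $tG$ is the disjoint union of $t$ copies of $G$, and the join $G\vee G'$ is obtained from the disjoint union $G\cup G'$ by adding all edges between vertices of $G$ and vertices of $G'$. The spectral radius $\rho(G)$ is the largest eigenvalue of the adjacency matrix of $G$. For a finite family $\mathcal{G}$ of graphs, ${\rm SPEX}(\mathcal{G})$ is the set of all graphs in $\mathcal{G}$ having the maximum spectral radius among the graphs in $\mathcal{G}$. Graphs are considered up to isomorphism. *)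

(* Defs.v *)
From HB Require Import structures.
From mathcomp Require Import all_boot all_order all_algebra.
From mathcomp Require Import all_classical all_reals all_analysis.

Set Implicit Arguments.
Unset Strict Implicit.
Unset Printing Implicit Defensive.

Import Order.TTheory GRing.Theory Num.Theory.
Import numFieldNormedType.Exports.

Local Open Scope classical_set_scope.
Local Open Scope ring_scope.

Record sgraph := SGraph {
  vertex :> finType;
  adj : rel vertex;
  adj_sym : symmetric adj;
  adj_irrefl : irreflexive adj
}.

Definition isomorphic (G H : sgraph) : Prop :=
  exists2 f : G -> H, bijective f & forall x y, adj (f x) (f y) = adj x y.

Section Constructions.
Local Open Scope nat_scope.

Definition complete_rel (n : nat) : rel 'I_n := fun i j => i != j.

Fact complete_sym n : symmetric (@complete_rel n).
Proof. by move=> i j; rewrite /complete_rel eq_sym. Qed.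

Fact complete_irrefl n : irreflexive (@complete_rel n).
Proof. by move=> i; rewrite /complete_rel eqxx. Qed.

Definition complete_graph n := SGraph (@complete_sym n) (@complete_irrefl n).

(* With n = 0 this is the graph without vertices. *)
Definition path_rel (n : nat) : rel 'I_n :=
  fun i j => (i.+1 == j :> nat) || (j.+1 == i :> nat).

Fact path_sym n : symmetric (@path_rel n).
Proof. by move=> i j; rewrite /path_rel orbC. Qed.

Fact path_irrefl n : irreflexive (@path_rel n).
Proof. by move=> i; rewrite /path_rel orbb gtn_eqF. Qed.

Definition path_graph n := SGraph (@path_sym n) (@path_irrefl n).

Definition union_rel (G H : sgraph) : rel (G + H)%type := fun u v =>
  match u, v with
  | inl x, inl y => adj x y
  | inr x, inr y => adj x y
  | _, _ => false
  end.

Fact union_sym G H : symmetric (@union_rel G H).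
Proof. by move=> [x|x] [y|y] //=; rewrite adj_sym. Qed.

Fact union_irrefl G H : irreflexive (@union_rel G H).
Proof. by move=> [x|x] /=; rewrite adj_irrefl. Qed.

Definition disjoint_union G H := SGraph (@union_sym G H) (@union_irrefl G H).

Definition join_rel (G H : sgraph) : rel (G + H)%type := fun u v =>
  match u, v with
  | inl x, inl y => adj x y
  | inr x, inr y => adj x y
  | _, _ => true
  end.

Fact join_sym G H : symmetric (@join_rel G H).
Proof. by move=> [x|x] [y|y] //=; rewrite adj_sym. Qed.

Fact join_irrefl G H : irreflexive (@join_rel G H).
Proof. by move=> [x|x] /=; rewrite adj_irrefl. Qed.

Definition graph_join G H := SGraph (@join_sym G H) (@join_irrefl G H).

Definition copies_rel (t : nat) (G : sgraph) : rel ('I_t * G)%type :=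
  fun u v => (u.1 == v.1) && adj u.2 v.2.

Fact copies_sym t G : symmetric (@copies_rel t G).
Proof. by move=> u v; rewrite /copies_rel eq_sym adj_sym. Qed.

Fact copies_irrefl t G : irreflexive (@copies_rel t G).
Proof. by move=> u; rewrite /copies_rel adj_irrefl andbF. Qed.

Definition copies t G := SGraph (@copies_sym t G) (@copies_irrefl t G).

(* Meant for l >= 3: [ucycle] also accepts the degenerate closed walk
   [:: x; y] along an edge, and the empty sequence. *)
Definition cycle_free (l : nat) (G : sgraph) : Prop :=
  forall c : seq G, size c = l -> ~ ucycle (@adj G) c.

End Constructions.

Section Plane.
Variable R : realType.

Definition arc_between (p q : R * R) (A : set (R * R)) : Prop :=
  exists f : R -> R * R,
    [/\ {within `[0, 1], continuous f},
        {in `[0, 1] &, injective f},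
        f 0 = p, f 1 = q & f @` `[0, 1] = A].

(* [pos x] is the point drawn for the vertex x, and [curve x y] is the closed
   arc, endpoints included, drawn for the edge xy.  The last two clauses
   together say that the interior of an edge contains no vertex and no point
   of another edge. *)
Definition plane_drawing (G : sgraph) (pos : G -> R * R)
    (curve : G -> G -> set (R * R)) : Prop :=
  [/\ injective pos,
      forall x y, adj x y -> curve x y = curve y x,
      forall x y, adj x y -> arc_between (pos x) (pos y) (curve x y),
      forall x y z, adj x y -> curve x y (pos z) -> z = x \/ z = y
    & forall x y u v, adj x y -> adj u v ->
        (x, y) <> (u, v) -> (x, y) <> (v, u) ->
        curve x y `&` curve u v `<=` range pos].

Definition planar (G : sgraph) : Prop :=
  exists pos curve, @plane_drawing G pos curve.

Definition adjacency_matrix (G : sgraph) : 'M[R]_#|G| :=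
  \matrix_(i, j) (adj (enum_val i) (enum_val j))%:R.

(* The set of eigenvalues is finite, and nonempty when G has a vertex because
   the matrix is real symmetric: the supremum is the largest eigenvalue. *)
Definition spectral_radius (G : sgraph) : R :=
  sup [set a | eigenvalue (adjacency_matrix G) a].

(* Families of graphs are predicates: [sgraph] is too large a type for [set]. *)
Definition SPEX (F : sgraph -> Prop) (G : sgraph) : Prop :=
  F G /\ forall H, F H -> spectral_radius H <= spectral_radius G.

Definition planar_cycle_free (n l : nat) (G : sgraph) : Prop :=
  [/\ #|G| = n, planar G & cycle_free l G].

End Plane.

(* The members of F, taken up to isomorphism, are exactly X. *)
Definition unique_up_to_iso (F : sgraph -> Prop) (X : sgraph) : Prop :=
  forall G, F G <-> isomorphic G X.

(* Main.v *)
Require Import Defs.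
From HB Require Import structures.
From mathcomp Require Import all_boot all_order all_algebra.
From mathcomp Require Import all_classical all_reals all_analysis.
From mathcomp Require Import seq fintype finset zify ring lra.

(** Write [L = l - 3] and let [rho] be the spectral radius.  Call a graph a fan when two
    adjacent vertices [u], [v] are joined to everything else and the remaining vertices
    induce disjoint paths.  The proof shows that an extremal graph is a fan, and then finds
    the best path sizes.

    Planarity is only used through minors.  If a drawing of [K_5] or [K_{3,3}] existed in
    which independent edges are disjoint, adding up crossing parities over all pairs of
    independent edges would give an odd number equal to an even one
    ([no_almost_drawing]); replacing arcs by fine chains of points makes this purely
    algebraic.  Hence a planar graph has no [K_5] or [K_{3,3}] minor
    ([drawing_no_minor]).  By Mader's argument such graphs have fewer than [4 k] edges on any
    [k] vertices ([mader]), and a set of [s] independent vertices sends only [2 s + O(k)]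
    edges to [k] other vertices ([sparse_bipartite]).

    Let [x] be the Perron vector of an extremal graph, with maximum [x u = 1].  Few vertices
    have a large entry, and expanding [rho ^+ 2 * x w] over walks of length two, the
    bipartite bound gives [rho ^+ 2 * x w <= 2 * deg w + small].  Since fans show that
    [2 * n - 4 <= rho ^+ 2], there is a second vertex [v] with [99 / 100 <= x v]; all but
    [n / 50] vertices are adjacent to both, and all other entries are at most [1 / 36]
    ([skeleton]).  Excluding [K_{3,3}] and [K_5], the common neighbours of [u] and [v] induce
    disjoint paths, or a cycle through all of them.  If some vertex is not a common
    neighbour, detach one common neighbour [w0] of least weight, keep the paths covering the
    others, and join every exceptional vertex to [u] and [v] only.  The result is a fan
    whose spectral radius is strictly larger ([rewired_radius]).  If all other vertices are
    common neighbours, a cycle through them would contain a path too long for a [C_l]-free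
    graph, and adding the edge [u v] if it is missing gives a fan with a larger spectral
    radius.

    Two disjoint paths among the common neighbours close up through [u] and [v] to a cycle,
    and they can be shortened, so [C_l]-freeness says that any two path sizes add up to at
    most [L] ([paths_packed]); conversely a fan with such path sizes is planar and
    [C_l]-free.  So everything reduces to fans.  There the Perron vector is explicit: with
    [rho = t + t^-1] the entries along a path solve a linear recurrence, and comparing
    spectral radii amounts to comparing a sum over the paths of a concave function of their
    sizes ([fan_cost_le]).  Its increments shrink at least fivefold at each step, which is
    enough to determine the optimal sizes ([optimal_short], [optimal_long]).  A fan is
    determined by its path sizes up to isomorphism ([fan_iso]). *)

Set Implicit Arguments.
Unset Strict Implicit.
Unset Printing Implicit Defensive.

Import Order.TTheory GRing.Theory Num.Theory.
Import numFieldNormedType.Exports.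

Local Open Scope nat_scope.

(** * Crossing parity of polygonal chains *)

Section Crossings.
Local Open Scope ring_scope.
Variable R : realFieldType.
Implicit Types (p q z : R * R) (s : seq (R * R)).

(** Half-open, so that exactly one of [p] and [- p] is in it for [p != 0]. *)
Definition lower_half p : bool := (p.2 < 0) || ((p.2 == 0) && (p.1 < 0)).

(** The segment from [p] to [q] is recorded as crossing the negative half of the first
    axis; for short segments away from the origin the sign of [p.1] is that of [q.1]
    whenever the first axis is crossed. *)
Definition crosses p q : bool := (lower_half p (+) lower_half q) && (p.1 < 0).

Definition near_by (e : R) p q : bool :=
  (`|p.1 - q.1| < e) && (`|p.2 - q.2| < e).

Definition far_from (d : R) p q : bool :=
  (d <= `|p.1 - q.1|) || (d <= `|p.2 - q.2|).

Lemma near_sym e p q : near_by e p q = near_by e q p.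
Proof. by rewrite /near_by distrC (distrC p.2). Qed.

Lemma far_sym d p q : far_from d p q = far_from d q p.
Proof. by rewrite /far_from distrC (distrC p.2). Qed.

Lemma lower_halfN p : p != 0 -> lower_half (- p) = ~~ lower_half p.
Proof.
case: p => a b; rewrite /lower_half /= xpair_eqE /= !oppr_lt0 oppr_eq0.
by case: (ltrgtP b 0) => //= _; case: (ltrgtP a 0).
Qed.

Let large (d : R) p := (d <= `|p.1|) || (d <= `|p.2|).

Lemma largeP d p : large d p ->
  d <= p.1 \/ p.1 <= - d \/ d <= p.2 \/ p.2 <= - d.
Proof.
by case: p => a b; rewrite /large /= !ler_normr => /orP[] /orP[]; intuition lra.
Qed.

Lemma nearP e p q : near_by e p q ->
  [/\ - e < p.1 - q.1, p.1 - q.1 < e, - e < p.2 - q.2 & p.2 - q.2 < e].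
Proof. by rewrite /near_by !ltr_norml => /andP[/andP[-> ->] /andP[-> ->]]. Qed.

(** Points this close to the axis but far from the origin are far from the origin along
    the axis, so that a short step cannot change side. *)
Lemma crossing_side e p q : near_by (2 * e) p q ->
  large (4 * e) p -> large (4 * e) q -> - (2 * e) <= p.2 -> p.2 <= 2 * e ->
  (p.1 < 0) = (q.1 < 0).
Proof.
move=> /nearP[h1 h2 h3 h4] /largeP lp /largeP lq h5 h6.
have {}lp : p.1 <= - (4 * e) \/ 4 * e <= p.1 by case: lp => [|[|[|]]] ?; [right|left|exfalso; lra..].
have {lq h3 h4 h5 h6} lq : q.1 <= - (4 * e) \/ 4 * e <= q.1.
  by case: lq => [|[|[|]]] ?; [right|left|exfalso; lra..].
have ep : 0 < e by lra.
have neg x : x <= - (4 * e) -> (x < 0) = true by move=> xe; apply: le_lt_trans xe _; lra.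
have pos x : 4 * e <= x -> (x < 0) = false.
  by move=> xe; apply: le_gtF; apply: le_trans xe; lra.
case: lp => lp; case: lq => lq.
- by rewrite !neg.
- by exfalso; lra.
- by exfalso; lra.
- by rewrite !pos.
Qed.

Lemma lower_half_neq p q : lower_half p != lower_half q ->
  (p.2 <= 0 /\ 0 <= q.2) \/ (q.2 <= 0 /\ 0 <= p.2).
Proof.
by rewrite /lower_half; case: (ltrgtP p.2 0) => hp; case: (ltrgtP q.2 0) => hq //= _;
  intuition lra.
Qed.

Lemma near_axis d p q : near_by d p q -> lower_half q != lower_half p ->
  - d <= p.2 <= d.
Proof.
by move=> /nearP[_ _ h1 h2] /lower_half_neq[[h3 h4]|[h3 h4]]; apply/andP; split; lra.
Qed.

Lemma near_by_trans d e p q r : near_by d p q -> near_by e q r -> near_by (d + e) p r.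
Proof.
move=> /andP[h1 h2] /andP[h3 h4].
apply/andP; split; first exact: le_lt_trans (ler_distD q.1 _ _) (ltrD h1 h3).
exact: le_lt_trans (ler_distD q.2 _ _) (ltrD h2 h4).
Qed.

(** A small closed quadrilateral away from the origin does not wind around it, hence
    meets the negative half axis an even number of times. *)
Lemma crosses_square e p0 p1 p2 p3 :
  near_by e p0 p1 -> near_by e p1 p2 -> near_by e p2 p3 -> near_by e p3 p0 ->
  large (4 * e) p0 -> large (4 * e) p1 -> large (4 * e) p2 -> large (4 * e) p3 ->
  crosses p0 p1 (+) crosses p1 p2 = crosses p0 p3 (+) crosses p3 p2.
Proof.
move=> n01 n12 n23 n30 l0 l1 l2 l3.
case: (boolP [&& lower_half p1 == lower_half p0, lower_half p2 == lower_half p0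
  & lower_half p3 == lower_half p0]) => [/and3P[/eqP e1 /eqP e2 /eqP e3]|].
  by rewrite /crosses e1 e2 e3 addbb.
move=> ne.
have near2 p q r : near_by e p q -> near_by e q r -> near_by (2 * e) p r.
  by move=> pq qr; rewrite mulr_natl; apply: near_by_trans qr.
have near1 p q : near_by e p q -> near_by (2 * e) p q.
  by move=> n; apply: (near2 _ p) => //; move: n; rewrite /near_by !subrr normr0 => /andP[/(le_lt_trans (normr_ge0 _)) ->].
have /andP[b0l b0r] : - (2 * e) <= p0.2 <= 2 * e.
  move: ne; rewrite !negb_and => /or3P[] h.
  - by apply: near_axis h; apply: near1.
  - by apply: near_axis h; apply: near2 n12.
  - by apply: near_axis h; apply: near1; rewrite near_sym.
have s1 : (p0.1 < 0) = (p1.1 < 0) by apply: (@crossing_side e) => //; apply: near1.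
have s2 : (p0.1 < 0) = (p2.1 < 0) by apply: (@crossing_side e) => //; apply: near2 n12.
have s3 : (p0.1 < 0) = (p3.1 < 0).
  by apply: (@crossing_side e) => //; apply: near1; rewrite near_sym.
rewrite /crosses -s1 -s3; case: (p0.1 < 0); last by rewrite !andbF.
by rewrite !andbT; case: (lower_half p0); case: (lower_half p1); case: (lower_half p2);
  case: (lower_half p3).
Qed.

(** The central symmetry exchanges the two halves of the first axis, and a short step
    that changes half plane crosses exactly one of them. *)
Lemma crossesN e p q : near_by e p q -> large (4 * e) p -> large (4 * e) q ->
  crosses (- p) (- q) = crosses p q (+) (lower_half p (+) lower_half q).
Proof.
move=> npq lp lq; have [h1 h2 h3 h4] := nearP npq.
have {}lp := largeP lp; have {}lq := largeP lq.
have p0 : p != 0 by apply/eqP => p0; move: lp; rewrite p0 /= => -[|[|[|]]]; lra.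
have q0 : q != 0 by apply/eqP => q0; move: lq; rewrite q0 /= => -[|[|[|]]]; lra.
rewrite /crosses !lower_halfN // oppr_lt0 addbN addNb negbK.
case: (boolP (lower_half p (+) lower_half q)) => //= d.
have d' : lower_half p != lower_half q.
  by move: d; case: (lower_half p); case: (lower_half q).
have := near_axis npq; rewrite eq_sym => /(_ d')/andP[h5 h6].
case: (ltrgtP p.1 0) => // p10; by case: lp => [|[|[|]]] ?; lra.
Qed.

(** Parity of the crossings of the half axis issued from [z]; as [z] moves it changes
    only when the half axis sweeps over an end of the chain. *)
Fixpoint crossings z p s : bool :=
  if s is q :: s' then crosses (p - z) (q - z) (+) crossings z q s' else false.

(** The same parity for the chain [s] reflected through [z]; this is what arises when
    the roles of the base point and of the chain are exchanged. *)
Fixpoint crossings_op z p s : bool :=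
  if s is q :: s' then crosses (z - p) (z - q) (+) crossings_op z q s' else false.

Definition chains_far (d : R) (s s' : seq (R * R)) : bool :=
  all (fun p => all (far_from d p) s') s.

Lemma large_sub d p q : far_from d p q -> large d (p - q).
Proof. by []. Qed.

Lemma near_subr e p q z : near_by e p q -> near_by e (p - z) (q - z).
Proof. by rewrite /near_by /= !opprB !addrA !subrK. Qed.

Lemma near_subl e p q z : near_by e p q -> near_by e (z - p) (z - q).
Proof.
have sub (a b c : R) : `|a - b - (a - c)| = `|b - c|.
  by rewrite -normrN; congr `|_|; ring.
by rewrite /near_by /= !sub.
Qed.

Lemma crossings_opE e z p s :
  path (near_by e) p s -> all (far_from (4 * e) z) (p :: s) ->
  crossings_op z p s =
    crossings z p s (+) (lower_half (z - p) (+) lower_half (z - last p s)).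
Proof.
elim: s p => [|q s IH] p /=; first by rewrite addbb.
move=> /andP[npq nqs] /and3P[fp fq fs].
have e0 : 0 < e by move: npq => /andP[] /(le_lt_trans (normr_ge0 _)).
have neg x : far_from (4 * e) z x -> lower_half (z - x) = ~~ lower_half (x - z).
  move=> /orP h; rewrite -lower_halfN ?opprB //; apply/eqP => /eqP.
  by rewrite subr_eq0 => /eqP xz; move: h; rewrite xz !subrr normr0; case; lra.
have fl : far_from (4 * e) z (last q s).
  by have := mem_last q s; move: (last q s) => x; rewrite inE => /orP[/eqP->//|xs]; exact: (allP fs).
rewrite IH //= ?fq // -(opprB p) -(opprB q).
rewrite (@crossesN e) ?near_subr //; try by apply: large_sub; rewrite far_sym.
rewrite !opprB !neg //.
by case: (crosses _ _); case: (crossings _ _ _); case: (lower_half (p - z));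
 case: (lower_half (q - z)); case: (lower_half _).
Qed.

(** Moving the base point by a short step changes the crossing parity only through the
    two ends of the chain: the squares spanned by the steps of the chain and the step of
    the base point telescope. *)
Lemma crossings_strip e p s q q' :
  path (near_by e) p s -> near_by e q q' ->
  all (far_from (4 * e) q) (p :: s) -> all (far_from (4 * e) q') (p :: s) ->
  crossings q p s (+) crossings q' p s
    = crosses (p - q) (p - q') (+) crosses (last p s - q) (last p s - q').
Proof.
move=> + nq; elim: s p => [|p' s IH] p /=; first by rewrite !addbb.
move=> /andP[npp nps] /and3P[f1 f2 f3] /and3P[g1 g2 g3].
have {}IH := IH p' nps; rewrite /= f2 f3 g2 g3 in IH.
have sq : crosses (p - q) (p' - q) (+) crosses (p' - q) (p' - q')
    = crosses (p - q) (p - q') (+) crosses (p - q') (p' - q').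
  apply: (@crosses_square e); rewrite ?near_subr ?near_subl //; try by apply: large_sub; rewrite far_sym.
  - by rewrite near_sym.
  - by rewrite near_sym.
move: (IH isT isT) sq.
case: (crosses (p - q) (p' - q)); case: (crosses (p' - q) (p' - q'));
case: (crosses (p - q) (p - q')); case: (crosses (p - q') (p' - q'));
case: (crossings q p' s); case: (crossings q' p' s); case: (crosses _ _) => //.
Qed.

(** Sum of [crossings_strip] along the second chain: a rectangle of small null
    squares. *)
Lemma crossings_rectangle e p s q s' :
  path (near_by e) p s -> path (near_by e) q s' ->
  chains_far (4 * e) (q :: s') (p :: s) ->
  crossings q p s (+) crossings (last q s') p s
    = crossings_op p q s' (+) crossings_op (last p s) q s'.
Proof.
move=> ps; elim: s' q => [|q' s' IH] q /=; first by rewrite !addbb.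
move=> /andP[nq nqs] /and3P[f1 f2 f3].
have := IH q' nqs; rewrite /chains_far /= in f1 f2 f3 *; rewrite f2 f3 => /(_ isT).
have := @crossings_strip e p s q q' ps nq f1 f2.
case: (crossings q p s); case: (crossings q' p s); case: (crossings (last q' s') p s);
case: (crosses _ _); case: (crosses _ _); case: (crossings_op _ _ _); case: (crossings_op _ _ _) => //.
Qed.

Lemma chain_ends_far d p s q s' : chains_far d (q :: s') (p :: s) ->
  [/\ far_from d q p, far_from d q (last p s), far_from d (last q s') p
    & far_from d (last q s') (last p s)].
Proof.
move=> /allP h.
by split; apply: (allP (h _ _)); rewrite ?mem_head ?mem_last.
Qed.

Lemma chains_far_sym d s s' : chains_far d s s' = chains_far d s' s.
Proof.
apply/allP/allP => h x xs; apply/allP => y ys; rewrite far_sym.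
- exact: (allP (h y ys)).
- exact: (allP (h y ys)).
Qed.

(** For two disjoint chains, each chain has a crossing parity seen from either end of
    the other; the sum of these four depends on the positions of the four ends only.
    This is the local ingredient of the parity argument. *)
Lemma crossings_independent e p s q s' :
  path (near_by e) p s -> path (near_by e) q s' ->
  chains_far (4 * e) (q :: s') (p :: s) ->
  crossings q p s (+) crossings (last q s') p s
    (+) (crossings p q s' (+) crossings (last p s) q s')
  = lower_half (p - q) (+) lower_half (p - last q s')
    (+) (lower_half (last p s - q) (+) lower_half (last p s - last q s')).
Proof.
move=> ps qs far; have := crossings_rectangle ps qs far.
have fp : all (far_from (4 * e) p) (q :: s').
  by apply/allP => x xs; rewrite far_sym; have /andP[] := allP far _ xs.
have fl : all (far_from (4 * e) (last p s)) (q :: s').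
  by apply/allP => x xs; rewrite far_sym; apply: (allP (allP far _ xs)); rewrite mem_last.
rewrite !(@crossings_opE e) // => ->.
by case: (crossings p q s'); case: (crossings (last p s) q s');
  case: (lower_half _); case: (lower_half _); case: (lower_half _); case: (lower_half _).
Qed.

End Crossings.

Section VanKampen.
Local Open Scope ring_scope.
Variable R : realFieldType.

Definition independent_edges (e e' : nat * nat) : bool :=
  [&& e.1 != e'.1, e.1 != e'.2, e.2 != e'.1 & e.2 != e'.2].

(** Every unordered pair of independent edges occurs once: independent edges have
    distinct first ends. *)
Definition independent_pairs (E : seq (nat * nat)) :=
  [seq ee <- [seq (e, e') | e <- E, e' <- E]
     | independent_edges ee.1 ee.2 & (ee.1.1 < ee.2.1)%N].

Definition sweeps (ee : (nat * nat) * (nat * nat)) : seq ((nat * nat) * nat) :=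
  [:: (ee.1, ee.2.1); (ee.1, ee.2.2); (ee.2, ee.1.1); (ee.2, ee.1.2)].

Definition end_pairs (ee : (nat * nat) * (nat * nat)) : seq (nat * nat) :=
  [:: (ee.1.1, ee.2.1); (ee.1.1, ee.2.2); (ee.1.2, ee.2.1); (ee.1.2, ee.2.2)].

Definition sort_pair (p : nat * nat) := (minn p.1 p.2, maxn p.1 p.2).

Definition inverted (p : nat * nat) := (p.2 < p.1)%N.

Definition all_even (T : eqType) (s : seq T) := all (fun a => ~~ odd (count_mem a s)) s.

(** When [crossings_independent] is summed over all pairs of independent edges, the
    left-hand terms cancel if every pair of an edge and a vertex off it occurs an even
    number of times. On the right, a pair of vertices taken in the two possible orders
    gives opposite half planes; if every unordered pair occurs an even number of times,
    the sum is the parity of the number of inverted pairs. Oddness of that number is a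
    contradiction. *)
Definition van_kampen_odd (E : seq (nat * nat)) : bool :=
  [&& all_even (flatten (map sweeps (independent_pairs E))),
      all_even (map sort_pair (flatten (map end_pairs (independent_pairs E))))
    & odd (count inverted (flatten (map end_pairs (independent_pairs E))))].

Definition complete_edges k : seq (nat * nat) :=
  [seq p <- [seq (i, j) | i <- iota 0 k, j <- iota 0 k] | (p.1 < p.2)%N].

Definition K33_edges : seq (nat * nat) := [seq (i, j) | i <- iota 0 3, j <- iota 3 3].

Lemma van_kampen_K5 : van_kampen_odd (complete_edges 5). Proof. by vm_compute. Qed.

Lemma van_kampen_K33 : van_kampen_odd K33_edges. Proof. by vm_compute. Qed.

Lemma xor_all_even (T : eqType) (s : seq T) (f : T -> bool) : all_even s ->
  \big[addb/false]_(a <- s) f a = false.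
Proof.
move=> ev; rewrite -big_undup_iterop_count big_seq big1 // => a.
rewrite mem_undup => /(allP ev) /=.
case: (count_mem a s) => // n; rewrite Monoid.iteropE; move: (f a) => b; move: n.+1 => {}n.
suff -> : iter n (addb b) false = odd n && b by move=> /negbTE ->.
by elim: n => //= n ->; case: (odd n); case: b.
Qed.

Lemma xor_count (T : Type) (s : seq T) (P : pred T) :
  \big[addb/false]_(a <- s) P a = odd (count P s).
Proof. by elim: s => [|a s IH]; rewrite ?big_nil ?big_cons //= IH oddD oddb. Qed.

(** Only independent edges are required to be drawn far apart, so that an edge may be
    drawn along a walk and the vertices may be branch sets of a minor. *)
Theorem no_almost_drawing (E : seq (nat * nat)) (e : R) (pos : nat -> R * R)
    (chain : nat * nat -> seq (R * R)) :
  van_kampen_odd E -> 0 < e ->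
  (forall a, a \in E -> path (near_by e) (pos a.1) (chain a)) ->
  (forall a, a \in E -> last (pos a.1) (chain a) = pos a.2) ->
  (forall a b, a \in E -> b \in E -> independent_edges a b ->
     chains_far (4 * e) (pos a.1 :: chain a) (pos b.1 :: chain b)) -> False.
Proof.
move=> /and3P[ev1 ev2 od] e0 walk ends far.
pose K (t : (nat * nat) * nat) := crossings (pos t.2) (pos t.1.1) (chain t.1).
pose S (p : nat * nat) := lower_half (pos p.1 - pos p.2).
have eqn ee : ee \in independent_pairs E ->
  \big[addb/false]_(t <- sweeps ee) K t = \big[addb/false]_(p <- end_pairs ee) S p.
  case: ee => a b; rewrite mem_filter /= => /andP[/andP[ind _]].
  move=> /allpairsP[[a' b'] /= [aE bE [? ?]]]; subst a' b'.
  have h := crossings_independent (walk a aE) (walk b bE).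
  rewrite !ends // chains_far_sym in h.
  have {}h := h (far _ _ aE bE ind).
  by rewrite /sweeps /end_pairs !big_cons !big_nil /K /S /= !addbF; move: h; rewrite !addbA.
have ordered p : p \in flatten (map end_pairs (independent_pairs E)) ->
    S p = S (sort_pair p) (+) inverted p.
  case/flatten_mapP => -[a b]; rewrite mem_filter /= => /andP[/andP[ind _]].
  move=> /allpairsP[[a' b'] /= [aE bE [? ?]]]; subst a' b' => pin.
  have := far _ _ aE bE ind => /chain_ends_far; rewrite !ends // => -[f1 f2 f3 f4].
  have fp : far_from (4 * e) (pos p.1) (pos p.2).
    by move: pin; rewrite !inE => /or4P[] /eqP ->.
  have ne : pos p.1 - pos p.2 != 0.
    apply/eqP => /eqP; rewrite subr_eq0 => /eqP xz; move: fp; rewrite /far_from xz !subrr normr0.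
    by case/orP; lra.
  rewrite /S /sort_pair /inverted /=; case: (ltngtP p.1 p.2) => h /=; rewrite ?addbF //; last first.
    by move: ne; rewrite h subrr eqxx.
  by rewrite addbT -lower_halfN ?opprB // -opprB oppr_eq0.
have : \big[addb/false]_(ee <- independent_pairs E) \big[addb/false]_(t <- sweeps ee) K t
    = \big[addb/false]_(ee <- independent_pairs E) \big[addb/false]_(p <- end_pairs ee) S p.
  by apply: eq_big_seq.
have flat (T : Type) (F : T -> bool) f :
    \big[addb/false]_(ee <- independent_pairs E) \big[addb/false]_(t <- f ee) F t
    = \big[addb/false]_(t <- flatten (map f (independent_pairs E))) F t.
  by rewrite big_flatten big_map.
rewrite !flat (xor_all_even _ ev1).
rewrite (eq_big_seq (fun p => S (sort_pair p) (+) inverted p)); last by move=> p; apply: ordered.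
rewrite big_split /= (xor_count _ inverted) od addbT.
by rewrite -(big_map sort_pair predT S) (xor_all_even _ ev2).
Qed.

End VanKampen.

(** * Chains of points along arcs *)

Section ArcChains.
Local Open Scope classical_set_scope.
Local Open Scope ring_scope.
Variable R : realType.
Implicit Types (p q : R * R) (A B : set (R * R)).

Lemma near_by_ball (e : R) p q : ball p e q = near_by e p q :> Prop.
Proof. by rewrite /near_by propeqE; split=> [[/= -> ->]|/andP[]]. Qed.

(** Uniform continuity on the unit interval, in terms of the coordinatewise distance. *)
Lemma uniformly_near (f : R -> R * R) (e : R) :
  {within `[0, 1], continuous f} -> 0 < e ->
  exists2 d : R, 0 < d & forall t t', t \in `[0, 1] -> t' \in `[0, 1] ->
     `|t - t'| < d -> near_by e (f t) (f t').
Proof.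
move=> /subspace_continuousP fc e0.
have cpt : compact `[(0:R), 1] by exact: segment_compact.
move/compact_near_coveringP/near_covering_withinP : cpt.
move=> /(_ R 0^'+ (fun d t => forall t', t' \in `[0, 1] -> `|t - t'| < d -> near_by e (f t) (f t'))).
case.
  move=> x x01.
  have /(_ _ (nbhsx_ballx (f x) _ _)) := fc x x01.
  move=> /(_ (e / 2)); rewrite divr_gt0// => /(_ isT).
  rewrite /nbhs/= => /nbhs_ballP[r /= r0 hr].
  exists (ball x (r / 2), [set d | d < r / 2 ]).
    split; first by apply: nbhsx_ballx; rewrite divr_gt0.
    by apply: nbhs_right_lt; rewrite divr_gt0.
  move=> [t d] /= [xt dr] t01 t' t'01 tt'.
  have ft : near_by (e / 2) (f x) (f t).
    rewrite -near_by_ball; apply: hr => //.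
    by apply: le_ball xt; rewrite ler_pdivrMr// ler_peMr ?ler1n// ltW.
  have ft' : near_by (e / 2) (f x) (f t').
    rewrite -near_by_ball; apply: hr => //.
    rewrite (splitr r); apply: ball_triangle xt _.
    by rewrite /ball /= (lt_trans tt').
  by rewrite (splitr e); apply: near_by_trans ft'; rewrite near_sym.
move=> d /= d0 h.
exists (d / 2); first by rewrite divr_gt0.
move=> t t' t01 t'01 tt'; apply: (h (d / 2)) => //=.
  by rewrite /ball /= sub0r normrN gtr0_norm ?divr_gt0// ltr_pdivrMr// ltr_pMr// ltr1n.
by rewrite divr_gt0.
Qed.

Lemma arc_chain A p q (e : R) : arc_between p q A -> 0 < e ->
  exists s, [/\ path (near_by e) p s, last p s = q & {in p :: s, forall z, A z}].
Proof.
move=> [f [fc _ f0 f1 fA]] e0; have [d d0 hd] := uniformly_near fc e0.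
have [N hN] : exists N : nat, d^-1 < N%:R.
  by exists (Num.bound d^-1); rewrite archi_boundP // invr_ge0 ltW.
have N0 : 0 < N%:R :> R by rewrite (lt_trans _ hN) // invr_gt0.
pose g k : R := k%:R / N%:R.
have g01 k : (k <= N)%N -> g k \in `[0, 1].
  by move=> kN; rewrite in_itv /= divr_ge0 //= ler_pdivrMr // mul1r ler_nat.
have Ag k : (k <= N)%N -> A (f (g k)).
  by move=> kN; rewrite -fA; exists (g k) => //; exact: g01.
have g0 : g 0%N = 0 by rewrite /g mul0r.
have gN : g N = 1 by rewrite /g divff // gt_eqF.
exists [seq f (g k) | k <- iota 1 N].
have pth m k : (k + m <= N)%N -> path (near_by e) (f (g k)) [seq f (g k) | k <- iota k.+1 m].
  elim: m k => //= m IH k km; rewrite IH ?addSnnS // andbT.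
  apply: hd; try by apply: g01; lia.
  rewrite /g -mulrBl -natr1 opprD addNKr normrM normrN1 mul1r.
  rewrite gtr0_norm ?invr_gt0 // invf_plt ?posrE //.
split.
- by rewrite -f0 -g0; apply: pth.
- rewrite -f1 -gN -{1}f0 -g0 last_map; congr (f (g _)).
  by case: (N) => // n; rewrite -[X in iota _ X]addn1 iotaD last_cat /= add1n.
- move=> z; rewrite inE => /orP[/eqP ->|/mapP[k]].
    by rewrite -f0 -g0; apply: Ag.
  by rewrite mem_iota => kN ->; apply: Ag; lia.
Qed.

Lemma arc_compact A p q : arc_between p q A -> compact A.
Proof.
move=> [f [fc _ _ _ <-]]; apply: continuous_compact fc _.
exact: segment_compact.
Qed.

Lemma compact_far A B : compact A -> compact B -> A `&` B = classical_sets.set0 ->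
  exists2 d : R, 0 < d & forall a b, A a -> B b -> far_from d a b.
Proof.
move=> cA cB AB0.
have clB : closed B by apply: compact_closed => //; exact: norm_hausdorff.
move/compact_near_coveringP/near_covering_withinP : cA.
move=> /(_ R 0^'+ (fun d a => forall b, B b -> far_from d a b)).
case.
  move=> x Ax.
  have : nbhs x (~` B).
    apply: open_nbhs_nbhs; split; first exact: closed_openC.
    by move=> Bx; have : (A `&` B) x by []; rewrite AB0.
  move=> /nbhs_ballP[r /= r0 hr].
  exists (ball x (r / 2), [set d | d < r / 2]).
    split; first by apply: nbhsx_ballx; rewrite divr_gt0.
    by apply: nbhs_right_lt; rewrite divr_gt0.
  move=> [a d] /= [xa dr] _ b Bb.
  rewrite /far_from; apply/negP => /negP; rewrite negb_or -!ltNge => ab.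
  apply: (hr b) => //; rewrite (splitr r); apply: ball_triangle xa _.
  by apply: (@le_ball _ _ _ d); rewrite ?near_by_ball // ltW.
move=> d /= d0 h.
exists (d / 2); first by rewrite divr_gt0.
move=> a b Aa Bb; apply: (h (d / 2)) => //=.
  by rewrite /ball /= sub0r normrN gtr0_norm ?divr_gt0// ltr_pdivrMr// ltr_pMr// ltr1n.
by rewrite divr_gt0.
Qed.

End ArcChains.

(** * Planar graphs and minors *)

Section Minors.
Variable V : finType.
Implicit Types (e : rel V) (A B : {set V}).

Definition reach e B x y : Prop :=
  exists p, [/\ path e x p, last x p = y & {subset p <= B}].

Definition connected_in e B : Prop := forall x y, x \in B -> y \in B -> reach e B x y.

(** Minors are given by branch sets: [B i] is the connected set contracted to the vertex
    [i < k], and [E] lists the edges of the minor. *)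
Definition has_minor (k : nat) (E : seq (nat * nat)) e A : Prop :=
  exists B : nat -> {set V},
  [/\ forall i, i < k -> [/\ B i \subset A, B i != set0 & connected_in e (B i)],
      forall i j, i < j -> j < k -> [disjoint B i & B j]
    & forall a, a \in E -> exists x y, [/\ x \in B a.1, y \in B a.2 & e x y]].

End Minors.

Section PlanarMinors.
Local Open Scope classical_set_scope.
Local Open Scope ring_scope.
Variable R : realType.

Lemma finite_positive (T : finType) (P : T -> R -> Prop) :
  (forall t d d', d' <= d -> P t d -> P t d') ->
  (forall t, exists2 d, 0 < d & P t d) ->
  exists2 d, 0 < d & forall t, P t d.
Proof.
move=> anti /(_ _)/cid2-/all_sig2[f f0 Pf].
exists (\big[Order.min/1]_t f t).
  by elim/big_ind: _ => // x y x0 y0; rewrite lt_min x0.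
by move=> t; apply: anti (Pf t); apply: bigmin_le_cond.
Qed.

Variables (G : sgraph) (pos : G -> R * R) (curve : G -> G -> set (R * R)).
Hypothesis drawing : plane_drawing pos curve.

Lemma curves_disjoint x y z w : adj x y -> adj z w ->
  x != z -> x != w -> y != z -> y != w -> curve x y `&` curve z w = classical_sets.set0.
Proof.
case: drawing => _ _ _ ends cross xy zw xz xw yz yw.
apply/classical_sets.seteqP; split=> [|t []] //.
move=> t [xyt zwt].
have [|||s _ st] := cross x y z w xy zw _ _ t; last first.
- have sxy : s = x \/ s = y by apply: (ends x y) => //; rewrite st.
  have szw : s = z \/ s = w by apply: (ends z w) => //; rewrite st.
  by case: sxy szw xz xw yz yw => -> [] ->; rewrite ?eqxx.
- by [].
- by case=> _ ?; subst; rewrite eqxx in yz.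
- by case=> ?; subst; rewrite eqxx in xz.
Qed.

Lemma curves_far : exists2 d : R, 0 < d & forall x y z w, adj x y -> adj z w ->
  x != z -> x != w -> y != z -> y != w ->
  forall p q, curve x y p -> curve z w q -> far_from d p q.
Proof.
pose P (t : G * G * (G * G)) (d : R) :=
  let: (x, y, (z, w)) := t in adj x y -> adj z w ->
  x != z -> x != w -> y != z -> y != w ->
  forall p q, curve x y p -> curve z w q -> far_from d p q.
have [||d d0 dP] := @finite_positive _ P.
- move=> [[x y] [z w]] d d' dd' h xy zw xz xw yz yw p q px qz.
  by have /orP[] := h xy zw xz xw yz yw p q px qz => /(le_trans dd');
    rewrite /far_from => ->; rewrite ?orbT.
- move=> [[x y] [z w]]; rewrite /P.
  case xy: (adj x y); last by exists 1.
  case zw: (adj z w); last by exists 1.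
  case: (eqVneq x z) => [_|xz]; first by exists 1.
  case: (eqVneq x w) => [_|xw]; first by exists 1.
  case: (eqVneq y z) => [_|yz]; first by exists 1.
  case: (eqVneq y w) => [_|yw]; first by exists 1.
  have [_ _ arcs _ _] := drawing.
  have cut := curves_disjoint xy zw xz xw yz yw.
  have [d d0 dP] := compact_far (arc_compact (arcs _ _ xy)) (arc_compact (arcs _ _ zw)) cut.
  by exists d.
- by exists d => // x y z w; exact: (dP (x, y, (z, w))).
Qed.

Lemma walk_chain (e : R) x p : 0 < e -> path (@adj G) x p -> p != [::] ->
  exists s, [/\ path (near_by e) (pos x) s, last (pos x) s = pos (last x p)
    & forall z, z \in pos x :: s -> exists u w,
        [/\ u \in x :: p, w \in x :: p, adj u w & curve u w z]].
Proof.
move=> e0; elim: p x => // y p IH x /= /andP[xy yp] _.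
have [_ _ arcs _ _] := drawing.
have [s [s1 s2 s3]] := arc_chain (arcs _ _ xy) e0.
have [p0|p0] := eqVneq p [::].
  exists s; split=> //; first by rewrite p0.
  by move=> z /s3 zc; exists x, y; rewrite !inE !eqxx ?orbT.
have [s' [s1' s2' s3']] := IH y yp p0.
exists (s ++ s'); split; first by rewrite cat_path s1 s2.
  by rewrite last_cat s2.
move=> z; rewrite -cat_cons mem_cat => /orP[/s3 zc|zs].
  by exists x, y; rewrite !inE !eqxx ?orbT.
have [|u [w [uy wy uw zc]]] := s3' z; first by rewrite inE zs orbT.
by exists u, w; split=> //; rewrite inE ?uy ?wy orbT.
Qed.

(** Each edge of the minor is drawn along a walk between representatives of the two
    branch sets. Independent edges use disjoint branch sets, hence edges without common
    ends, whose curves are uniformly far apart. *)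
Theorem drawing_no_minor k (E : seq (nat * nat)) : van_kampen_odd E -> (0 < k)%N ->
  (forall a, a \in E -> (a.1 < k)%N /\ (a.2 < k)%N) ->
  ~ has_minor k E (@adj G) [set: G].
Proof.
move=> odd_E k0 Ek [B [Bk Bdis BE]].
have [v0 _] : exists x, x \in B 0%N by case: (Bk 0%N k0) => _ /set0Pn.
pose r i := odflt v0 [pick x in B i].
have rB i : (i < k)%N -> r i \in B i.
  move=> ik; rewrite /r; case: pickP => //= none.
  by case: (Bk i ik) => _ /set0Pn[x]; rewrite none.
have walk a : a \in E -> exists p, [/\ path (@adj G) (r a.1) p, last (r a.1) p = r a.2,
    p != [::] & {subset r a.1 :: p <= B a.1 :|: B a.2}].
  move=> aE; have [x [y [xB yB xy]]] := BE a aE; have [a1 a2] := Ek a aE.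
  have [_ _ /(_ _ _ (rB _ a1) xB)[p [p1 p2 p3]]] := Bk _ a1.
  have [_ _ /(_ _ _ yB (rB _ a2))[q [q1 q2 q3]]] := Bk _ a2.
  exists (p ++ y :: q); split.
  - by rewrite cat_path p1 p2 /= xy.
  - by rewrite last_cat /= q2.
  - by case: (p).
  - move=> z; rewrite inE mem_cat inE => /or4P[/eqP->|/p3 zB|/eqP->|/q3 zB];
    by rewrite inE ?rB ?zB ?yB ?orbT.
have [d d0 dP] := curves_far.
have e0 : 0 < d / 4 by rewrite divr_gt0.
have chainP a : exists s, a \in E -> [/\ path (near_by (d / 4)) (pos (r a.1)) s,
    last (pos (r a.1)) s = pos (r a.2)
    & forall z, z \in pos (r a.1) :: s -> exists u w,
     [/\ u \in B a.1 :|: B a.2, w \in B a.1 :|: B a.2, adj u w & curve u w z]].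
  case aE : (a \in E); last by exists [::].
  have [p [p1 p2 p3 p4]] := walk a aE.
  have [s [s1 s2 s3]] := walk_chain e0 p1 p3; exists s => _; split=> //; first by rewrite s2 p2.
  by move=> z /s3[u [w [/p4 up /p4 wp uw zc]]]; exists u, w.
have /all_sig[chain chainE] a := cid (chainP a).
apply: (@no_almost_drawing R E (d / 4) (fun i => pos (r i)) chain) => //.
- by move=> a /chainE[].
- by move=> a /chainE[].
move=> a b aE bE /and4P[ab1 ab2 ab3 ab4].
rewrite mulrC divfK ?pnatr_eq0 //.
have [_ _ ca] := chainE a aE; have [_ _ cb] := chainE b bE.
have dis i j x y : (i < k)%N -> (j < k)%N -> i != j -> x \in B i -> y \in B j -> x != y.
  move=> ik jk; rewrite neq_ltn => /orP[] ij xB yB; apply/eqP => xy; subst y.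
    by have /disjointFr/(_ xB) := Bdis _ _ ij jk; rewrite yB.
  by have /disjointFr/(_ yB) := Bdis _ _ ij ik; rewrite xB.
have [a1 a2] := Ek a aE; have [b1 b2] := Ek b bE.
have dis' x y : x \in B a.1 :|: B a.2 -> y \in B b.1 :|: B b.2 -> x != y.
  by rewrite !inE => /orP[] xB /orP[] yB; [apply: dis xB yB..].
apply/allP => p /ca[u [w [uB wB uw pc]]]; apply/allP => q /cb[u' [w' [uB' wB' uw' qc]]].
by apply: (dP u w u' w') => //; apply: dis'.
Qed.

End PlanarMinors.

(** * Dense graphs contain complete minors *)

Section MinorTheory.
Variable V : finType.
Implicit Types (e : rel V) (A B L S : {set V}).

Lemma reach_refl e B x : reach e B x x. Proof. by exists [::]. Qed.

Lemma reach_edge e B x y : e x y -> y \in B -> reach e B x y.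
Proof. by move=> xy yB; exists [:: y]; split=> //= [|z]; rewrite ?xy // inE => /eqP->. Qed.

Lemma reach_trans e B y x z : reach e B x y -> reach e B y z -> reach e B x z.
Proof.
move=> [p [p1 p2 p3]] [q [q1 q2 q3]]; exists (p ++ q); split.
- by rewrite cat_path p1 p2.
- by rewrite last_cat p2.
- by move=> w; rewrite mem_cat => /orP[/p3|/q3].
Qed.

Lemma reach_mono e e' B B' x y : reach e B x y ->
  (forall a b, a \in x |: B -> b \in B -> e a b -> reach e' B' a b) -> reach e' B' x y.
Proof.
move=> [p [+ <- pB]]; elim: p x pB => [|y' p IH] x pB /=.
  by move=> _ _; exact: reach_refl.
move=> /andP[xy yp] step.
have yB : y' \in B by apply: pB; rewrite mem_head.
apply: (@reach_trans _ _ y'); first by apply: step; rewrite // setU11.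
apply: IH yp _ => [z zp|a b]; first by apply: pB; rewrite inE zp orbT.
by move=> /setU1P[->|aB] bB ab; apply: step => //; rewrite inE ?aB ?yB orbT.
Qed.

Lemma has_minor_mono k E e e' A A' : subrel e e' -> A \subset A' ->
  has_minor k E e A -> has_minor k E e' A'.
Proof.
move=> ee' AA' [B [B1 B2 B3]]; exists B; split=> //.
- move=> i /B1[BA B0 Bc]; split=> //; first exact: subset_trans AA'.
  move=> x y xB yB; apply: (reach_mono (Bc x y xB yB)) => a b _ bB ab.
  by apply: reach_edge => //; apply: ee'.
- by move=> a /B3[x [y [xB yB xy]]]; exists x, y; split=> //; apply: ee'.
Qed.

(** The contraction of the edge [x y] into [x], on the same type: [y] becomes
    isolated. *)
Definition contract e (x y : V) : rel V := fun a b =>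
  [&& a != b, a != y, b != y & [|| e a b, (a == x) && e y b | (b == x) && e a y]].

Lemma contract_sym e x y : symmetric e -> symmetric (contract e x y).
Proof.
move=> es a b; rewrite /contract eq_sym (es a b) (es y b) (es a y).
by case: (b == a) => //=; case: (a == y); case: (b == y) => //=; case: (e b a) => //=; rewrite orbC.
Qed.

Lemma contract_irrefl e x y : irreflexive (contract e x y).
Proof. by move=> a; rewrite /contract eqxx. Qed.

Lemma disjoint_setU1 A B x : x \notin B -> [disjoint A & B] -> [disjoint x |: A & B].
Proof.
move=> xB /pred0P dis; apply/pred0P => z; rewrite /= !inE; case: eqP => [->|_] /=.
  exact: negbTE.
exact: dis.
Qed.

Lemma has_minor_contract k E e A x y : symmetric e -> e x y -> x \in A -> y \in A ->
  has_minor k E (contract e x y) (A :\ y) -> has_minor k E e A.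
Proof.
move=> es xy xA yA [B [B1 B2 B3]].
pose B' i := if x \in B i then y |: B i else B i.
have BB' i : B i \subset B' i by rewrite /B'; case: ifP => // _; exact: subsetUr.
have yB i : i < k -> y \notin B i.
  by move=> /B1[/subsetP h _ _]; apply/negP => /h; rewrite !inE eqxx.
have yB' i : x \in B i -> y \in B' i by rewrite /B' => ->; exact: setU11.
have lift i a b : a \in B i -> b \in B i -> contract e x y a b -> reach e (B' i) a b.
  move=> aB bB /and4P[_ _ _ /or3P[ab|/andP[/eqP ax yb]|/andP[/eqP bx ay]]].
  - by apply: reach_edge => //; apply: (subsetP (BB' i)).
  - subst a; apply: (reach_trans (reach_edge xy (yB' _ aB))).
    by apply: reach_edge => //; apply: (subsetP (BB' i)).
  - subst b; apply: (reach_trans (reach_edge ay (yB' _ bB))).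
    by apply: reach_edge; rewrite ?[e y x]es //; apply: (subsetP (BB' i)).
exists B'; split.
- move=> i ik; have [BA B0 Bc] := B1 i ik; split.
  + have BA' : B i \subset A by apply: subset_trans BA _; exact: subD1set.
    by rewrite /B'; case: ifP => // _; rewrite subUset sub1set yA.
  + by have /set0Pn[z zB] := B0; apply/set0Pn; exists z; apply: (subsetP (BB' i)).
  + have inner a b : a \in B i -> b \in B i -> reach e (B' i) a b.
      move=> aB bB; apply: (reach_mono (Bc a b aB bB)) => c d.
      by move=> /setU1P[->|cB] dB; apply: lift.
    rewrite /connected_in => a b.
    rewrite {1 2}/B'; case: ifP => xB; last exact: inner.
    have toy c : c \in B i -> reach e (B' i) c y.
      by move=> cB; apply: (reach_trans (inner c x cB xB)); apply: reach_edge => //; exact: yB'.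
    have fromy c : c \in B i -> reach e (B' i) y c.
      move=> cB; apply: reach_trans (inner x c xB cB); apply: reach_edge; first by rewrite es.
      exact: (subsetP (BB' i)).
    move=> /setU1P[->|aB] /setU1P[->|bB]; [exact: reach_refl|exact: fromy|exact: toy|exact: inner].
- move=> i j ij jk; have ik := ltn_trans ij jk.
  have dis := B2 i j ij jk.
  rewrite /B'; case: ifP => xi; case: ifP => xj //.
  + by have := disjointFr dis xi; rewrite xj.
  + by apply: disjoint_setU1 => //; exact: yB.
  + by rewrite disjoint_sym; apply: disjoint_setU1; rewrite ?yB // disjoint_sym.
- move=> a /B3[c [d [cB dB /and4P[_ _ _ /or3P[ab|/andP[/eqP ax yb]|/andP[/eqP bx ay]]]]]].
  + by exists c, d; split=> //; apply: (subsetP (BB' _)).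
  + subst c; exists y, d; split=> //; first exact: yB'.
    by apply: (subsetP (BB' _)).
  + subst d; exists c, y; split=> //; last exact: yB'.
    by apply: (subsetP (BB' _)).
Qed.

Notation complete_minor k := (has_minor k (complete_edges k)).

Lemma mem_complete_edges k i j : ((i, j) \in complete_edges k) = (i < j < k).
Proof.
rewrite mem_filter /=; case: (ltnP i j) => //= ij; apply/allpairsP/idP.
  by move=> [[a b] /= [_ + [_ ->]]]; rewrite mem_iota add0n.
by move=> jk; exists (i, j); rewrite !mem_iota !add0n jk (ltn_trans ij jk).
Qed.

Lemma connected_in1 e v : connected_in e [set v].
Proof. by move=> x y /set1P-> /set1P->; exact: reach_refl. Qed.

Definition nbrs e A (x : V) : {set V} := [set y in A | e x y].

Lemma complete_minor_cone k e A v : irreflexive e -> symmetric e -> v \in A ->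
  complete_minor k e (nbrs e A v) -> complete_minor k.+1 e A.
Proof.
move=> ei es vA [B [B1 B2 B3]].
have BN i x : i < k -> x \in B i -> x \in A /\ e v x.
  by move=> /B1[/subsetP h _ _] /h; rewrite inE => /andP.
exists (fun i => if i == k then [set v] else B i); split.
- move=> i; rewrite ltnS leq_eqVlt; case: eqP => /= [_ _|_ ik].
    split; [by rewrite sub1set | by apply/set0Pn; exists v; exact: set11 | exact: connected_in1].
  have [BA B0 Bc] := B1 i ik; split=> //.
  by apply/subsetP => x /(BN _ _ ik)[].
- move=> i j ij; rewrite ltnS leq_eqVlt; case: eqP => [jk _|_ /= jk].
    rewrite jk in ij; rewrite (ltn_eqF ij) disjoint_sym disjoints1.
    by apply/negP => /(BN _ _ ij)[_]; rewrite ei.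
  by rewrite (ltn_eqF (ltn_trans ij jk)); exact: B2.
- move=> [i j]; rewrite mem_complete_edges ltnS => /andP[ij] /=; rewrite leq_eqVlt.
  case: eqP => [jk _|_ /= jk].
    rewrite jk in ij; rewrite (ltn_eqF ij).
    have [_ /set0Pn[x xB] _] := B1 i ij; exists x, v; split; rewrite ?inE ?eqxx //.
    by have [_] := BN _ _ ij xB; rewrite es.
  rewrite (ltn_eqF (ltn_trans ij jk)).
  by have [|x [y []]] := B3 (i, j); [rewrite mem_complete_edges ij | exists x, y].
Qed.

Definition deg e A x := #|nbrs e A x|.

(** Twice the number of edges inside [A]. *)
Definition arcs e A := \sum_(x in A) deg e A x.

Lemma mem_nbrs e A x y : (y \in nbrs e A x) = (y \in A) && e x y.
Proof. by rewrite inE. Qed.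

Lemma deg_setD1 e A x y : x \in A -> deg e A y = e y x + deg e (A :\ x) y.
Proof.
move=> xA; rewrite /deg (cardsD1 x) mem_nbrs xA; congr (_ + #|pred_of_set _|).
by apply/setP => z; rewrite !inE andbA.
Qed.

Lemma arcs_setD1 e A x : symmetric e -> irreflexive e -> x \in A ->
  arcs e A = arcs e (A :\ x) + (deg e A x).*2.
Proof.
move=> es ei xA; rewrite /arcs (big_setD1 x) //=.
rewrite (eq_bigr (fun y => e y x + deg e (A :\ x) y)); last by move=> y _; rewrite -deg_setD1.
rewrite big_split /= addnCA addnA addnC -addnn; congr (_ + _); congr (_ + _).
rewrite -big_mkcondr /= sum1_card /deg; apply: eq_card => y; transitivity ((y \in A :\ x) && e y x) => //; rewrite !inE es.
by case: eqP => // ->; rewrite ei !andbF.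
Qed.

Lemma contract_deg e A x y a : symmetric e -> irreflexive e ->
  x \in A -> y \in A -> a != x -> a != y -> x != y ->
  deg e A a <= deg (contract e x y) (A :\ y) a + (e a x && e a y).
Proof.
move=> es ei xA yA ax ay xy.
have sub : nbrs e A a :\ y \subset nbrs (contract e x y) (A :\ y) a.
  apply/subsetP => z; rewrite !inE /contract => /and3P[-> zA az]; rewrite zA az ay /= andbT.
  by apply/eqP => zE; move: az; rewrite zE ei.
rewrite {1}/deg (cardsD1 y) mem_nbrs yA /=.
case ayE : (e a y); last by rewrite andbF addn0; exact: subset_leq_card.
rewrite andbT addnC; case axE: (e a x); first by rewrite leq_add2r; exact: subset_leq_card.
rewrite addn0 addn1; apply: (@leq_trans #|x |: (nbrs e A a :\ y)|).
  by rewrite cardsU1 !inE axE !andbF.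
apply: subset_leq_card; rewrite subUset sub1set sub andbT.
by rewrite !inE /contract xy xA ax ay eqxx ayE !orbT.
Qed.

Lemma contract_deg_merged e A x y : symmetric e -> irreflexive e ->
  x \in A -> y \in A -> x != y ->
  deg e A x + deg e A y <= deg (contract e x y) (A :\ y) x + 2
    + #|nbrs e A x :&: nbrs e A y|.
Proof.
move=> es ei xA yA xy; rewrite /deg -cardsUI leq_add2r.
rewrite (cardsD1 x) (cardsD1 y (_ :\ x)) addnA [_ + #|_ :\ x :\ y|]addnC; apply: leq_add.
  apply: subset_leq_card; apply/subsetP => z; rewrite !inE /contract.
  move=> /and3P[zy zx zE]; rewrite zy [x == z]eq_sym zx xy eqxx /=.
  by case/orP: zE => /andP[-> ->]; rewrite ?orbT.
by case: (_ \in _); case: (_ \in _).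
Qed.

(** Contracting an edge loses that edge and merges the two edges to every common
    neighbour. *)
Lemma arcs_contract e A x y : symmetric e -> irreflexive e ->
  x \in A -> y \in A -> x != y ->
  arcs e A <= arcs (contract e x y) (A :\ y) + 2 + (#|nbrs e A x :&: nbrs e A y|).*2.
Proof.
move=> es ei xA yA xy.
have xA' : x \in A :\ y by rewrite !inE xy.
rewrite {1}/arcs (big_setD1 y) //= (big_setD1 x) //= addnCA addnA.
rewrite [arcs (contract _ _ _) _](big_setD1 x) //=.
have h1 := contract_deg_merged es ei xA yA xy.
have h2 : \sum_(a in A :\ y :\ x) deg e A a <=
    \sum_(a in A :\ y :\ x) deg (contract e x y) (A :\ y) a + #|nbrs e A x :&: nbrs e A y|.
  apply: (@leq_trans (\sum_(a in A :\ y :\ x)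
      (deg (contract e x y) (A :\ y) a + (e a x && e a y)))).
    by apply: leq_sum => a; rewrite !inE => /and3P[ax ay aA]; exact: contract_deg.
  rewrite big_split leq_add2l /= -big_mkcondr /= sum1_card.
  apply: subset_leq_card; apply/subsetP => a; rewrite unfold_in !inE => /andP[/and3P[_ _ ->]].
  by rewrite es (es a).
lia.
Qed.

(** In the step from [k] to [k.+1], a vertex of degree at most [2 ^ k] can be deleted,
    and an edge with fewer than [2 ^ k] common neighbours can be contracted, keeping [2
    ^ k.+1] arcs per vertex. Otherwise the neighbourhood of any vertex has minimum
    degree at least [2 ^ k], hence contains the smaller complete minor, and the vertex
    is a cone over it. *)
Lemma mader k e A : symmetric e -> irreflexive e -> A != set0 ->
  2 ^ k * #|A| <= arcs e A -> complete_minor k.+2 e A.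
Proof.
elim: k e A => [|k IH] e A es ei A0.
  rewrite expn0 mul1n => h.
  have [x xA] : exists2 x, x \in A & 0 < deg e A x.
    apply/exists_inP; apply: contraTT h; rewrite negb_exists_in => /forall_inP h.
    by rewrite /arcs big1 ?leqn0 ?cards_eq0 // => x /h; rewrite lt0n negbK => /eqP.
  rewrite card_gt0 => /set0Pn[y]; rewrite mem_nbrs => /andP[yA xy].
  exists (fun i => if i == 0 then [set x] else [set y]); split.
  - move=> i _; case: ifP => _; split; rewrite ?sub1set //; try exact: connected_in1.
      by apply/set0Pn; exists x; exact: set11.
    by apply/set0Pn; exists y; exact: set11.
  - move=> i j ij; rewrite ltnS => j1; have [-> ->] : i = 0 /\ j = 1 by lia.
    by rewrite /= disjoints1 inE; apply/eqP => xyE; move: xy; rewrite xyE ei.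
  - move=> [i j]; rewrite mem_complete_edges => /andP[ij j2].
    have [-> ->] : i = 0 /\ j = 1 by lia.
    by exists x, y; rewrite !inE !eqxx.
have [m] := ubnP #|A|; elim: m e A es ei A0 => // m IHm e A es ei A0 /ltnSE mE.
rewrite expnS => big.
have c0 : 0 < 2 ^ k by rewrite expn_gt0.
case: (boolP [exists x in A, deg e A x <= 2 ^ k]) => [/exists_inP[x xA dx]|].
  have arcsE := arcs_setD1 es ei xA.
  have card := cardsD1 x A; rewrite xA in card.
  have [A1|A1] := eqVneq (A :\ x) set0.
    move: big; rewrite arcsE A1 /arcs big_set0 card A1 cards0 (deg_setD1 e x xA) ei A1 /deg.
    rewrite (_ : nbrs e set0 x = set0) ?cards0; last by apply/setP => z; rewrite !inE.
    by rewrite leqn0 !muln_eq0 /=; case: (2 ^ k) c0.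
  apply: (@has_minor_mono _ _ e e (A :\ x) A) => //; first exact: subD1set.
  apply: IHm => //; first by move: mE; rewrite card; lia.
  by move: big; rewrite arcsE expnS card; lia.
rewrite negb_exists_in => /forall_inP degs.
case: (boolP [exists x in A, [exists y in A, e x y && (#|nbrs e A x :&: nbrs e A y| < 2 ^ k)]]).
  move=> /exists_inP[x xA /exists_inP[y yA /andP[xy t]]].
  have nxy : x != y by apply/eqP => xyE; move: xy; rewrite xyE ei.
  have h := arcs_contract es ei xA yA nxy.
  have card := cardsD1 y A; rewrite yA in card.
  apply: (has_minor_contract es xy xA yA).
  apply: IHm.
  - exact: contract_sym.
  - exact: contract_irrefl.
  - by apply/set0Pn; exists x; rewrite !inE nxy.
  - by move: mE; rewrite card; lia.
  - by move: big h; rewrite expnS card; lia.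
rewrite negb_exists_in => /forall_inP common.
have /set0Pn[v vA] := A0.
apply: (complete_minor_cone ei es vA); apply: IH => //.
  by rewrite -card_gt0; apply: leq_ltn_trans (leq0n (2 ^ k)) _; rewrite ltnNge; exact: degs.
rewrite /arcs mulnC -sum_nat_const; apply: leq_sum => y; rewrite mem_nbrs => /andP[yA vy].
have /exists_inPn/(_ y yA) := common v vA; rewrite vy /= -leqNgt => /leq_trans; apply.
by apply: subset_leq_card; apply/subsetP => z; rewrite !inE => /andP[/andP[-> ->] /andP[_ ->]].
Qed.

(** All that is needed of planarity. *)
Definition sparse_class e A :=
  ~ complete_minor 5 e A /\ ~ has_minor 6 K33_edges e A.

Lemma sparse_arcs e A : symmetric e -> irreflexive e -> ~ complete_minor 5 e A ->
  A != set0 -> arcs e A < 8 * #|A|.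
Proof. by move=> es ei no5 A0; rewrite ltnNge; apply/negP => /(@mader 3 e A es ei A0). Qed.

End MinorTheory.
Notation complete_minor k := (has_minor k (complete_edges k)).

(** * Edges between an independent set and a small set *)

Section SparseBipartite.
Variable V : finType.
Implicit Types (e : rel V) (A L S : {set V}).

Lemma distinct_minor k E e A (xs : seq V) : size xs = k -> uniq xs -> {subset xs <= A} ->
  (forall a, a \in E -> exists x y, [/\ nth x xs a.1 = x, nth y xs a.2 = y,
     a.1 < k, a.2 < k & e x y]) -> has_minor k E e A.
Proof.
move=> sz ux xA hE.
have nthE x y i : i < k -> nth x xs i = nth y xs i by move=> ik; apply: set_nth_default; rewrite sz.
case: xs sz ux xA hE nthE => [|x0 xs] sz ux xA hE nthE.
  move: sz => /= k0; exists (fun=> set0); split; rewrite -?k0 // => a /hE[x [y [_ _]]].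
  by rewrite -k0.
exists (fun i => [set nth x0 (x0 :: xs) i]); split.
- move=> i ik; split; last exact: connected_in1.
    by rewrite sub1set; apply: xA; rewrite mem_nth // sz.
  by apply/set0Pn; exists (nth x0 (x0 :: xs) i); exact: set11.
- move=> i j ij jk; rewrite disjoints1 inE nth_uniq ?sz ?(ltn_trans ij) //.
  by rewrite neq_ltn ij.
- move=> a /hE[x [y [h1 h2 a1 a2 xy]]]; exists x, y.
  by rewrite !inE (nthE x0 x) // (nthE x0 y) // h1 h2 !eqxx.
Qed.

Lemma K33_common e A p q r : symmetric e -> irreflexive e -> ~ has_minor 6 K33_edges e A ->
  p \in A -> q \in A -> r \in A -> p != q -> p != r -> q != r ->
  #|nbrs e A p :&: nbrs e A q :&: nbrs e A r| <= 2.
Proof.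
move=> es ei noK pA qA rA pq pr qr; rewrite leqNgt; apply/negP => /card_gt2P.
move=> [x [y [z [[]]]]]; rewrite !inE.
move=> /and3P[/andP[/andP[xA px] /andP[_ qx]] _ rx] /and3P[/andP[/andP[yA py] /andP[_ qy]] _ ry].
move=> /and3P[/andP[/andP[zA pz] /andP[_ qz]] _ rz] [xy yz zx].
have ne a b : e a b -> a != b by apply: contraTN => /eqP->; rewrite ei.
apply: noK; apply: (@distinct_minor _ _ _ _ [:: p; q; r; x; y; z]) => //.
- by rewrite /= !inE !negb_or pq pr qr xy yz (eq_sym x z) zx !ne.
- by move=> a; rewrite !inE => /or4P[/eqP->|/eqP->|/eqP->|/or3P[]/eqP->].
- move=> a; rewrite /K33_edges /= !inE.
  move=> /or4P[/eqP->|/eqP->|/eqP->|/or4P[/eqP->|/eqP->|/eqP->|/or3P[]/eqP->]] /=.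
  + by exists p, x. + by exists p, y. + by exists p, z.
  + by exists q, x. + by exists q, y. + by exists q, z.
  + by exists r, x. + by exists r, y. + by exists r, z.
Qed.

Lemma clique_minor k e A : symmetric e -> irreflexive e -> k <= #|A| ->
  (forall a b, a \in A -> b \in A -> a != b -> e a b) -> complete_minor k e A.
Proof.
elim: k A => [|k IH] A es ei kA cl.
  by exists (fun=> set0); split=> // -[i j]; rewrite mem_complete_edges ltn0 andbF.
have /card_gt0P[v vA] : 0 < #|A| by apply: leq_trans kA.
apply: (complete_minor_cone ei es vA); apply: IH => // [|a b]; last first.
  by rewrite !inE => /andP[aA _] /andP[bA _]; exact: cl.
have -> : nbrs e A v = A :\ v.
  apply/setP => z; rewrite !inE andbC; case: (eqVneq z v) => [->|zv] /=; first by rewrite ei.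
  by case zA : (z \in A) => //=; rewrite ?andbF // cl // eq_sym.
by have := cardsD1 v A; rewrite vA; lia.
Qed.

Lemma nbrs_subset e A (B : {set V}) x : A \subset B -> nbrs e A x \subset nbrs e B x.
Proof. by move=> /subsetP AB; apply/subsetP => z; rewrite !inE => /andP[/AB-> ->]. Qed.

Lemma minor_of_nbrs k e A L s : symmetric e -> irreflexive e -> s \in A -> L \subset A ->
  complete_minor k e (nbrs e L s) -> complete_minor k.+1 e A.
Proof.
move=> es ei sA LA h; apply: (complete_minor_cone ei es sA).
by apply: has_minor_mono h => //; exact: nbrs_subset.
Qed.

Lemma low_degree e A d : A != set0 -> arcs e A < d.+1 * #|A| -> exists2 p, p \in A & deg e A p <= d.
Proof.
move=> A0 h; apply/exists_inP; apply: contraTT h; rewrite negb_exists_in => /forall_inP h.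
rewrite -leqNgt mulnC -sum_nat_const; apply: leq_sum => x /h.
by rewrite -ltnNge.
Qed.

(** A vertex of [L] of degree at most [7] is deleted. A vertex [s] whose degree thereby
    drops to two is a common neighbour of a triangle through the deleted vertex, and
    there are at most [7 * 7] such triangles, each with at most two common neighbours as
    [K_{3,3}] is excluded; hence the constant [98 = 7 * 7 * 2]. *)
Lemma common_triangles e L S : symmetric e -> irreflexive e -> sparse_class e (L :|: S) ->
  (forall s, s \in S -> forall a b, a \in nbrs e L s -> b \in nbrs e L s -> a != b -> e a b) ->
  #|[set s in S | 2 < deg e L s]| <= 98 * #|L|.
Proof.
move=> es ei sp cl; have [m] := ubnP #|L|; elim: m L sp cl => // m IH L sp cl /ltnSE mL.
have [->|L0] := eqVneq L set0.
  rewrite [X in X <= _](_ : _ = 0) //; apply/eqP; rewrite cards_eq0; apply/eqP/setP => s.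
  rewrite !inE /deg (_ : nbrs _ _ _ = set0) ?cards0 ?andbF //.
  by apply/setP => z; rewrite !inE.
have LLS : L \subset L :|: S by exact: subsetUl.
have [p pL dp] : exists2 p, p \in L & deg e L p <= 7.
  apply: low_degree => //; apply: sparse_arcs => // h; case: sp => + _; apply.
  by apply: has_minor_mono h.
pose W b c := [set s in S | [&& e p s, e b s & e c s]].
have cW b c : b \in nbrs e L p -> c \in nbrs e L p -> b != c -> #|W b c| <= 2.
  rewrite !inE => /andP[bL pb] /andP[cL pc] bc.
  have ne a d : e a d -> a != d by apply: contraTN => /eqP->; rewrite ei.
  have [_ noK] := sp.
  apply: leq_trans (K33_common es ei noK _ _ _ (ne _ _ pb) (ne _ _ pc) bc);
    rewrite ?inE ?pL ?bL ?cL //.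
  apply: subset_leq_card; apply/subsetP => s; rewrite !inE => /andP[-> /and3P[-> -> ->]].
  by rewrite orbT.
have sub : [set s in S | 2 < deg e L s] \subset [set s in S | 2 < deg e (L :\ p) s] :|:
    \bigcup_(b in nbrs e L p) \bigcup_(c in nbrs e L p | b != c) W b c.
  apply/subsetP => s; rewrite !inE => /andP[sS]; rewrite (deg_setD1 e s pL) sS /=.
  case sp' : (e s p); last by rewrite add0n => ->.
  rewrite add1n ltnS => /card_gt1P[b [c []]]; rewrite !inE.
  move=> /andP[/andP[bp bL] sb] /andP[/andP[cp cL] sc] bc.
  apply/orP; right; apply/bigcupP; exists b.
    by rewrite inE bL; apply: (cl s sS); rewrite ?inE ?pL ?bL // eq_sym.
  apply/bigcupP; exists c; last by rewrite inE sS es sp' es sb es sc.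
  by rewrite bc inE cL; rewrite andbT; apply: (cl s sS); rewrite ?inE ?pL ?cL // eq_sym.
have card := cardsD1 p L; rewrite pL in card.
have {}IH : #|[set s in S | 2 < deg e (L :\ p) s]| <= 98 * #|L :\ p|.
  have LpL : L :\ p \subset L by exact: subD1set.
  apply: IH; last by move: mL; rewrite card; lia.
    by case: sp => h1 h2; split=> h; [apply: h1|apply: h2]; apply: has_minor_mono h => //; apply: setSU.
  by move=> s sS a b aN bN; apply: (cl s sS); [apply: (subsetP (nbrs_subset _ _ LpL)) aN|
     apply: (subsetP (nbrs_subset _ _ LpL)) bN].
apply: leq_trans (subset_leq_card sub) _; apply: leq_trans (leq_card_setU _ _) _.
have bound (T : finType) (P : pred T) (F : T -> {set V}) n : (forall i, P i -> #|F i| <= n) ->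
    #|\bigcup_(i | P i) F i| <= #|P| * n.
  move=> Fn; rewrite -sum_nat_const.
  apply: leq_trans (_ : \sum_(i | P i) #|F i| <= _); last exact: leq_sum.
  elim/big_rec2: _ => [|i y X _ h]; first by rewrite cards0.
  by apply: leq_trans (leq_card_setU _ _) _; rewrite leq_add2l.
suff h : #|\bigcup_(b in nbrs e L p) \bigcup_(c in nbrs e L p | b != c) W b c| <= 7 * 14.
  by rewrite card mulnDr addnC muln1; apply: leq_add.
apply: (@leq_trans (#|nbrs e L p| * 14)); last by rewrite leq_mul2r dp orbT.
apply: (bound _ (mem (nbrs e L p))) => b bN.
apply: (@leq_trans (#|nbrs e L p| * 2)); last by rewrite (@leq_mul2r 2 _ 7) dp orbT.
apply: leq_trans (bound _ (fun c => (c \in nbrs e L p) && (b != c)) _ 2 _) _.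
  by move=> c /andP[cN bc]; apply: cW.
rewrite leq_mul2r /=; apply: subset_leq_card; apply/subsetP => c.
by rewrite unfold_in => /andP[].
Qed.

Let gain_twice a b c d k : a + k <= b -> c + k <= d -> a + c + 2 * k <= b + d.
Proof. lia. Qed.

Let contraction_step d s s' a a' k q n l : k + 1 + q = d -> q <= 3 -> q + 2 <= d ->
  a + 2 * k <= a' -> s <= s' -> 2 * s' + 5 * a' <= 4 * n + 236 * l ->
  2 * (d + s) + 5 * a <= 4 * (1 + n) + 236 * l.
Proof. lia. Qed.

Let clique_step s n t l a : s <= 2 * n + t -> t <= 98 * l -> a <= 8 * l ->
  2 * s + 5 * a <= 4 * n + 236 * l.
Proof. lia. Qed.

(** If the neighbours in [L] of some [s] in [S] do not form a clique, contract [s] into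
    a neighbour of least degree among them: this adds to [L] enough edges to pay for the
    lost ones, and a small degree exists because a dense neighbourhood would give a
    [K_5] minor. If all neighbourhoods are cliques, they have at most three elements,
    and those with exactly three are few. The constant is [236 = 2 * 98 + 5 * 8]. *)
Lemma sparse_bipartite e L S : symmetric e -> irreflexive e -> sparse_class e (L :|: S) ->
  [disjoint S & L] -> (forall s t, s \in S -> t \in S -> ~~ e s t) ->
  2 * (\sum_(s in S) deg e L s) + 5 * arcs e L <= 4 * #|S| + 236 * #|L|.
Proof.
have [m] := ubnP #|S|; elim: m S e => // m IH S e /ltnSE mS es ei sp dis ind.
have LLS : L \subset L :|: S by exact: subsetUl.
have notL s : s \in S -> s \notin L by move=> sS; rewrite (disjointFr dis sS).
case: (boolP [exists s in S, [exists a in nbrs e L s, [exists b in nbrs e L s, (a != b) && ~~ e a b]]]).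
  move=> /exists_inP[s sS /exists_inP[a aN /exists_inP[b bN /andP[ab nab]]]].
  have sA : s \in L :|: S by rewrite inE sS orbT.
  set N := nbrs e L s in aN bN *.
  pose p := [arg min_(p < a in N) deg e N p].
  have [pN pmin] : p \in N /\ forall q, q \in N -> deg e N p <= deg e N q.
    by rewrite /p; case: arg_minnP.
  have N0 : N != set0 by apply/set0Pn; exists a.
  have d3 : deg e N p <= 3.
    have [|q qN] := @low_degree e N 3 N0; last exact/leq_trans/pmin.
    rewrite ltnNge; apply/negP => big; case: sp => + _; apply.
    by apply: (minor_of_nbrs es ei sA LLS); apply: (@mader V 2).
  have d2 : deg e N p + 2 <= #|N|.
    apply: leq_trans (_ : deg e N a + 2 <= _); first by rewrite leq_add2r pmin.
    rewrite (cardsD1 a) aN (cardsD1 b) in_setD1 (eq_sym b) ab bN addnC addnA leq_add2l.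
    apply: subset_leq_card; apply/subsetP => z; rewrite !inE => /andP[/andP[zL sz] az].
    rewrite zL sz !andbT; apply/andP; split; apply: contraTN az => /eqP -> //.
    by rewrite ei.
  have [pL sp'] : p \in L /\ e s p by move: pN; rewrite inE => /andP[].
  have ps : e p s by rewrite es.
  (* The neighbours of [s] that become new neighbours of [p]. *)
  pose K := N :\: (p |: nbrs e N p).
  have cK : #|K| + 1 + deg e N p = #|N|.
    have := cardsID (p |: nbrs e N p) N; rewrite (setIidPr _); last first.
      by rewrite subUset sub1set pN; apply/subsetP => z; rewrite inE => /andP[].
    by rewrite cardsU1 inE ei andbF -/K -/(deg e N p) addn1 add1n => <-; rewrite !addSn addnC.
  pose e' := contract e p s.
  have es' : symmetric e' by exact: contract_sym.
  have ei' : irreflexive e' by exact: contract_irrefl.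
  have sub c : c != s -> nbrs e L c \subset nbrs e' L c.
    move=> cs; apply/subsetP => z; rewrite !inE => /andP[zL cz].
    rewrite zL /e' /contract cs cz /= andbT.
    apply/andP; split; first by apply: contraTneq cz => ->; rewrite ei.
    by apply: contraTneq zL => ->; exact: notL.
  have cS := cardsD1 s S; rewrite sS in cS.
  have arcsE : arcs e L + 2 * #|K| <= arcs e' L.
    have KL : K \subset L :\ p.
      by apply/subsetP => z; rewrite !inE negb_or => /andP[/andP[-> _] /andP[-> _]].
    rewrite /arcs (big_setD1 p) //= [X in _ <= X](big_setD1 p) //=.
    have h1 : deg e L p + #|K| <= deg e' L p.
      rewrite /deg -cardsUI (_ : _ :&: K = set0) ?cards0 ?addn0; last first.
        apply/setP => z; rewrite !inE; apply/negbTE; apply/negP.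
        by move=> /andP[/andP[zL pz] /andP[]]; rewrite negb_or pz andbT => /andP[_ + /andP[_ sz]]; rewrite zL sz.
      apply: subset_leq_card; rewrite subUset sub ?andTb; last first.
        by apply: contraTneq pL => ->; exact: notL.
      apply/subsetP => z; rewrite !inE negb_or => /andP[/andP[zp _] /andP[zL sz]].
      rewrite zL /e' /contract (eq_sym p z) zp eqxx sz /= orbT andbT.
      apply/andP; split; first by apply: contraTneq pL => ->; exact: notL.
      by apply: contraTneq zL => ->; exact: notL.
    have h2 : \sum_(i in L :\ p) deg e L i + #|K| <= \sum_(i in L :\ p) deg e' L i.
      have -> : #|K| = \sum_(i in L :\ p) (i \in K).
        rewrite -big_mkcondr /= sum1_card; apply: eq_card => z.
        by apply/idP/idP => [zK|/andP[]//]; apply/andP; split=> //; exact: (subsetP KL).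
      rewrite -big_split /=; apply: leq_sum => i; rewrite !inE => /andP[ip iL].
      have is_ : i != s by apply: contraTneq iL => ->; exact: notL.
      case: (boolP (_ && _)) => iK; last by rewrite addn0; apply: subset_leq_card; exact: sub.
      have {iK} [npi si] : ~~ e p i /\ e s i.
        by move: iK; rewrite negb_or iL => /andP[/andP[_ +] si]; rewrite si.
      rewrite addn1 -[X in X < _]add0n /deg; apply: (@leq_trans #|p |: nbrs e L i|).
        by rewrite cardsU1 inE es (negbTE npi) andbF.
      apply: subset_leq_card; rewrite subUset sub // sub1set andbT inE pL /e' /contract ip is_ eqxx.
      by rewrite (es i s) si !orbT !andbT /=; apply: contraTneq pL => ->; exact: notL.
    exact: gain_twice h1 h2.
  have {}IH : 2 * (\sum_(t in S :\ s) deg e' L t) + 5 * arcs e' L <= 4 * #|S :\ s| + 236 * #|L|.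
    apply: IH => //.
    - by move: mS; rewrite cS add1n.
    - have lift k E : has_minor k E e' (L :|: S :\ s) -> has_minor k E e (L :|: S).
        move=> h; apply: (has_minor_contract es ps) => //; first by rewrite inE pL.
        apply: has_minor_mono h => //; apply/subsetP => z; rewrite !inE.
        case/orP => [zL|/andP[-> ->]]; last by rewrite orbT.
        by rewrite zL andbT; apply: contraTneq zL => ->; exact: notL.
      by case: sp => h1 h2; split=> /lift.
    - by apply: disjointWl dis; exact: subD1set.
    - move=> t u; rewrite !inE => /andP[ts tS] /andP[us uS].
      have ne z : z \in S -> z != p by apply: contraTneq => ->; rewrite (disjointFl dis pL).
      rewrite /e' /contract (negbTE (ind t u tS uS)) (negbTE (ne t tS)) (negbTE (ne u uS)).
      by rewrite !andbF.
  rewrite (big_setD1 s) //= -/(deg e L s) -[deg e L s]/(#|N|).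
  have sums : \sum_(t in S :\ s) deg e L t <= \sum_(t in S :\ s) deg e' L t.
    by apply: leq_sum => t; rewrite !inE => /andP[ts _]; apply: subset_leq_card; exact: sub.
  by rewrite cS; exact: contraction_step cK d3 d2 arcsE sums IH.
rewrite negb_exists_in => /forall_inP noncl.
have cl s : s \in S -> forall a b, a \in nbrs e L s -> b \in nbrs e L s -> a != b -> e a b.
  move=> sS a b aN bN ab; have /exists_inPn/(_ a aN)/exists_inPn/(_ b bN) := noncl s sS.
  by rewrite ab /= negbK.
have d3 s : s \in S -> deg e L s <= 3.
  move=> sS; rewrite leqNgt; apply/negP => big; case: sp => + _; apply.
  have sA : s \in L :|: S by rewrite inE sS orbT.
  by apply: (minor_of_nbrs es ei sA LLS); apply: clique_minor => //; exact: cl.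
have T := common_triangles es ei sp cl.
have h1 : \sum_(s in S) deg e L s <= 2 * #|S| + #|[set s in S | 2 < deg e L s]|.
  rewrite mulnC -sum_nat_const -sum1_card big_mkcond /=.
  rewrite [X in _ <= X + _]big_mkcond [X in _ <= _ + X]big_mkcond -big_split /=.
  apply: leq_sum => s _; rewrite inE; case: ifP => //= sS.
  by have := d3 s sS; case: ltnP => /= h1 h2; rewrite ?muln1 ?addn0 ?addn1.
have h2 : arcs e L <= 8 * #|L|.
  have [->|L0] := eqVneq L set0; first by rewrite /arcs big_set0.
  apply: ltnW; apply: sparse_arcs => // h; case: sp => + _; apply.
  by apply: has_minor_mono h.
exact: clique_step h1 T h2.
Qed.

End SparseBipartite.

(** * Rayleigh quotients *)

Section RayleighMax.
Local Open Scope classical_set_scope.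
Local Open Scope ring_scope.
Variables (R : realType) (T : finType) (e : rel T).
Implicit Types x y : T -> R.
Hypothesis e_sym : symmetric e.
Hypothesis e_irr : irreflexive e.

Definition quad (f : rel T) x : R := \sum_v \sum_(w | f v w) x v * x w.

Definition sqnorm x : R := \sum_v x v ^+ 2.

Lemma continuous_bigsum (I : finType) (P : pred I) (V : topologicalType) (f : I -> V -> R) :
  (forall i, continuous (f i)) -> continuous (fun z => \sum_(i | P i) f i z).
Proof.
move=> fc; rewrite (_ : (fun z => _) = \sum_(i | P i) f i); last first.
  by apply/funext => z; rewrite fct_sumE.
elim/big_ind: _ => //; first by move=> z; exact: cvg_cst.
by move=> g h gc hc z; apply: cvgD; [exact: gc|exact: hc].
Qed.

Let n := #|T|.
Let vec (z : 'rV[R]_n) (v : T) : R := z ord0 (enum_rank v).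

Let vec_continuous v : continuous (fun z : 'rV[R]_n => vec z v).
Proof. exact: coord_continuous. Qed.

Let quad_continuous : continuous (fun z : 'rV[R]_n => quad e (vec z)).
Proof.
apply: continuous_bigsum => v; apply: continuous_bigsum => w z.
exact: (cvgM (@vec_continuous v z) (@vec_continuous w z)).
Qed.

Let sqnorm_continuous : continuous (fun z : 'rV[R]_n => sqnorm (vec z)).
Proof.
apply: continuous_bigsum => v z.
exact: (cvgM (@vec_continuous v z) (@vec_continuous v z)).
Qed.

Lemma sqnorm_ge0 x : 0 <= sqnorm x.
Proof. by apply: sumr_ge0 => v _; exact: sqr_ge0. Qed.

Lemma sqnorm_eq0 x : sqnorm x = 0 -> forall v, x v = 0.
Proof.
move=> /eqP; rewrite psumr_eq0 => [/allP h v|v _]; last exact: sqr_ge0.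
by have := h v (mem_index_enum _); rewrite sqrf_eq0 => /eqP.
Qed.

Lemma quad_scale c x : quad e (fun v => c * x v) = c ^+ 2 * quad e x.
Proof.
rewrite /quad mulr_sumr; apply: eq_bigr => v _; rewrite mulr_sumr.
by apply: eq_bigr => w _; ring.
Qed.

Lemma sqnorm_scale c x : sqnorm (fun v => c * x v) = c ^+ 2 * sqnorm x.
Proof. by rewrite /sqnorm mulr_sumr; apply: eq_bigr => v _; rewrite exprMn. Qed.

Lemma sum_delta i (P : pred T) (F : T -> R) :
  \sum_(v | P v) (v == i)%:R * F v = (P i)%:R * F i.
Proof.
rewrite big_mkcond (bigD1 i) //= eqxx big1 ?addr0; last first.
  by move=> v /negbTE->; rewrite mul0r if_same.
by case: (P i); rewrite ?mul0r.
Qed.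

Lemma quad_add_delta x i t :
  quad e (fun v => x v + t * (v == i)%:R) =
  quad e x + 2 * t * \sum_(w | e i w) x w.
Proof.
have -> : quad e (fun v => x v + t * (v == i)%:R) =
  quad e x + t * \sum_v \sum_(w | e v w) (x v * (w == i)%:R + (v == i)%:R * x w)
    + t ^+ 2 * \sum_v \sum_(w | e v w) (v == i)%:R * (w == i)%:R.
  rewrite /quad !mulr_sumr -!big_split /=; apply: eq_bigr => v _.
  rewrite !mulr_sumr -!big_split /=; apply: eq_bigr => w _; ring.
have -> : \sum_v \sum_(w | e v w) (v == i)%:R * (w == i)%:R = 0 :> R.
  under eq_bigr do rewrite -mulr_sumr.
  have := sum_delta i predT (fun v => \sum_(w | e v w) (w == i)%:R); rewrite mul1r => ->.
  by rewrite big1 // => w; case: eqP => // ->; rewrite e_irr.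
rewrite mulr0 addr0; congr (_ + _); rewrite -mulrA mulrCA; congr (_ * _).
have col v : \sum_(w | e v w) (w == i)%:R = (e v i)%:R :> R.
  rewrite -[RHS]mulr1 -(sum_delta i (e v) (fun=> 1)).
  by apply: eq_bigr => w _; rewrite mulr1.
under eq_bigr do rewrite big_split /= -!mulr_sumr col.
rewrite big_split /= mulr_natl mulr2n; congr (_ + _).
  rewrite [RHS]big_mkcond; apply: eq_bigr => v _; rewrite e_sym.
  by case: ifP => _; rewrite ?mulr1 ?mulr0.
by have := sum_delta i predT (fun v => \sum_(w | e v w) x w); rewrite mul1r.
Qed.

Lemma sqnorm_add_delta x i t :
  sqnorm (fun v => x v + t * (v == i)%:R) = sqnorm x + 2 * t * x i + t ^+ 2.
Proof.
have -> : sqnorm (fun v => x v + t * (v == i)%:R) =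
  sqnorm x + 2 * t * (\sum_v (v == i)%:R * x v) + t ^+ 2 * \sum_v (v == i)%:R * (v == i)%:R.
  by rewrite /sqnorm !mulr_sumr -!big_split /=; apply: eq_bigr => v _; ring.
have := sum_delta i predT x; have := sum_delta i predT (fun v => (v == i)%:R).
by rewrite eqxx !mul1r => -> ->; rewrite mulr1.
Qed.

(** First-order condition at a maximum. *)
Lemma quadratic_bound (a b : R) : (forall t, 2 * t * a <= b * t ^+ 2) -> a = 0.
Proof.
move=> h; apply/eqP/negP => /negP a0.
have c0 : 0 < `|b| + 1 by rewrite ltr_wpDl.
have bc : b < `|b| + 1 by rewrite (le_lt_trans (ler_norm b)) // ltrDl.
have := h (a / (`|b| + 1)); set c := `|b| + 1 in c0 bc *.
have -> : 2 * (a / c) * a = 2 * c * (a / c) ^+ 2 by field; rewrite gt_eqF.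
have p : 0 < (a / c) ^+ 2 by rewrite exprn_even_gt0 //= mulf_neq0 // invr_eq0 gt_eqF.
by rewrite ler_pM2r // leNgt => /negP; apply; lra.
Qed.

(** The quadratic form is maximised on the unit sphere. Absolute values of the maximiser
    give a nonnegative maximiser, and varying one coordinate shows that it is an
    eigenvector. *)
Lemma rayleigh_max : (0 < #|T|)%N -> exists (mu : R) (x : T -> R),
  [/\ forall y, quad e y <= mu * sqnorm y, forall v, 0 <= x v, exists v, x v != 0
    & forall v, mu * x v = \sum_(w | e v w) x w].
Proof.
move=> /card_gt0P[v0 _].
pose S := [set z : 'rV[R]_n | sqnorm (vec z) = 1].
have S0 : S !=set0.
  exists (\row_i (enum_val i == v0)%:R); rewrite /S /= /sqnorm (bigD1 v0) //= /vec mxE.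
  rewrite enum_rankK eqxx expr1n big1 ?addr0 // => v /negbTE vv.
  by rewrite mxE enum_rankK vv expr0n.
have cS : compact S.
  have box : compact [set v : 'rV[R]_n | forall i, v ord0 i \in `[(- 1 : R), 1]].
    by apply: (@rV_compact _ _ (fun=> `[(- 1 : R), 1]%classic)) => _; exact: segment_compact.
  apply: subclosed_compact box _.
    apply: (@preimage_closed _ _ (fun z => sqnorm (vec z)) [set 1]).
      by move=> z _; exact: sqnorm_continuous.
    exact: closed_eq.
  move=> z /= z1 i; rewrite in_itv /= -ler_norml.
  rewrite -(ler_sqr _ _) ?nnegrE // expr1n -z1 real_normK ?num_real //.
  rewrite /sqnorm (bigD1 (enum_val i)) //= /vec enum_valK lerDl.
  by apply: sumr_ge0 => v _; exact: sqr_ge0.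
have [z0 z0S zmax] := EVT_max_rV S0 cS (continuous_subspaceT quad_continuous).
have {}z0S : sqnorm (vec z0) = 1 := set_mem z0S.
set mu := quad e (vec z0) in zmax.
have ray y : quad e y <= mu * sqnorm y.
  have [y0|y0] := eqVneq (sqnorm y) 0.
    rewrite y0 mulr0 /quad big1 // => v _; rewrite big1 // => w _.
    by rewrite (sqnorm_eq0 y0) mul0r.
  have yp : 0 < sqnorm y by rewrite lt_neqAle eq_sym y0 sqnorm_ge0.
  pose c := (Num.sqrt (sqnorm y))^-1.
  have c2 : c ^+ 2 = (sqnorm y)^-1 by rewrite /c exprVn sqr_sqrtr // ltW.
  pose z : 'rV[R]_n := \row_i (c * y (enum_val i)).
  have zE : vec z = (fun v => c * y v).
    by apply/funext => v; rewrite /vec mxE enum_rankK.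
  have zS : S z by rewrite /S /= zE sqnorm_scale c2 mulVf.
  have := zmax z (mem_set zS); rewrite /= zE.
  by rewrite quad_scale c2 mulrC ler_pdivrMr.
pose x v := `|vec z0 v|.
have x1 : sqnorm x = 1.
  by rewrite -z0S; apply: eq_bigr => v _; rewrite /x real_normK ?num_real.
have xmu : quad e x = mu.
  apply/eqP; rewrite eq_le; have := ray x; rewrite x1 mulr1 => -> /=.
  apply: ler_sum => v _; apply: ler_sum => w _; rewrite /x -normrM; exact: ler_norm.
exists mu, x; split=> //.
- by move=> v; rewrite /x.
- apply: contrapT => /forallNP h; have := x1; rewrite /sqnorm big1 => [/eqP|v _].
    by rewrite eq_sym oner_eq0.
  by have /negP := h v; rewrite negbK => /eqP ->; rewrite expr0n.
move=> i; apply/eqP; rewrite eq_sym -subr_eq0; apply/eqP.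
apply: (@quadratic_bound _ mu) => t.
have := ray (fun v => x v + t * (v == i)%:R).
rewrite quad_add_delta sqnorm_add_delta xmu x1; lra.
Qed.

End RayleighMax.

Section SpectralRadius.
Local Open Scope classical_set_scope.
Local Open Scope ring_scope.
Variables (R : realType) (G : sgraph).
Hypothesis G0 : (0 < #|G|)%N.
Let r := spectral_radius R G.
Implicit Types x y : G -> R.

Lemma quad_eigen (mu : R) x : (forall v, mu * x v = \sum_(w | adj v w) x w) ->
  quad (@adj G) x = mu * sqnorm x.
Proof.
move=> h; rewrite /quad /sqnorm mulr_sumr; apply: eq_bigr => v _.
by rewrite -mulr_sumr -h; ring.
Qed.

Lemma spectral_radiusE (mu : R) x : (forall y, quad (@adj G) y <= mu * sqnorm y) ->
  (exists v, x v != 0) -> (forall v, mu * x v = \sum_(w | adj v w) x w) -> r = mu.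
Proof.
move=> ray [v xv] eig.
have colsum (z : 'rV[R]_#|G|) j : (z *m adjacency_matrix R G) ord0 j =
    \sum_(w | adj (enum_val j) w) z ord0 (enum_rank w).
  rewrite mxE (reindex (@enum_rank G)) /=; last first.
    by exists enum_val => i _; rewrite ?enum_rankK ?enum_valK.
  rewrite [RHS]big_mkcond; apply: eq_bigr => w _; rewrite mxE enum_rankK adj_sym.
  by case: ifP => _; rewrite ?mulr1 ?mulr0.
have mem : [set a | eigenvalue (adjacency_matrix R G) a] mu.
  apply/eigenvalueP; exists (\row_i x (enum_val i)).
    apply/rowP => j; rewrite colsum !mxE eig; apply: eq_bigr => w _.
    by rewrite mxE enum_rankK.
  by apply/eqP => /rowP/(_ (enum_rank v)); rewrite !mxE enum_rankK; apply/eqP.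
have ub : ubound [set a | eigenvalue (adjacency_matrix R G) a] mu.
  move=> a /eigenvalueP[z /rowP za z0].
  pose y w := z ord0 (enum_rank w).
  have : quad (@adj G) y = a * sqnorm y.
    apply: quad_eigen => w; have := za (enum_rank w).
    by rewrite colsum mxE enum_rankK.
  have yp : 0 < sqnorm y.
    rewrite lt_neqAle sqnorm_ge0 andbT eq_sym; apply: contraNneq z0 => /sqnorm_eq0 h.
    apply/eqP/rowP => j; rewrite mxE.
    by have := h (enum_val j); rewrite /y enum_valK.
  by move=> qy; have := ray y; rewrite qy ler_pM2r.
apply/eqP; rewrite eq_le; apply/andP; split.
  by apply: ge_sup => //; exists mu.
by apply: ub_le_sup => //; exists mu.
Qed.

Lemma rayleigh y : quad (@adj G) y <= r * sqnorm y.
Proof.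
have [mu [x [ray _ x0 eig]]] := rayleigh_max R (@adj_sym G) (@adj_irrefl G) G0.
by rewrite (spectral_radiusE ray x0 eig).
Qed.

Lemma perron_vector : exists x, [/\ forall v, 0 <= x v, forall v, x v <= 1,
  exists v, x v = 1 & forall v, r * x v = \sum_(w | adj v w) x w].
Proof.
have [mu [x [ray xge0 x0 eig]]] := rayleigh_max R (@adj_sym G) (@adj_irrefl G) G0.
rewrite (spectral_radiusE ray x0 eig); have [v0 xv0] := x0.
have [v1 _ vmax] := @arg_maxP _ _ G v0 predT x isT.
have xv1 : 0 < x v1.
  by apply: lt_le_trans (vmax v0 isT); rewrite lt_neqAle eq_sym xv0 xge0.
exists (fun v => x v / x v1); split.
- by move=> v; rewrite divr_ge0.
- by move=> v; rewrite ler_pdivrMr // mul1r; exact: vmax.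
- by exists v1; rewrite divff // gt_eqF.
- by move=> v; rewrite mulrA eig mulr_suml.
Qed.

End SpectralRadius.

(** * Costs of sequences of part sizes *)

Section ConcaveCost.
Local Open Scope ring_scope.
Variables (R : realFieldType) (d : nat -> R).
Hypothesis d_gt0 : forall j, 0 < d j.
Hypothesis d_decay : forall j, 5 * d j.+1 <= d j.

(** The cost of a part of size [m] is a concave function of [m] with increments [d],
    each at most a fifth of the preceding one. *)
Definition part_cost (m : nat) : R := \sum_(j < m) d j.

Definition cost (s : seq nat) : R := \sum_(m <- s) part_cost m.

Lemma part_costS m : part_cost m.+1 = part_cost m + d m.
Proof. exact: big_ord_recr. Qed.

Lemma d_decr j : d j.+1 < d j.
Proof. have := d_decay j; have := d_gt0 j.+1; have := d_gt0 j; lra. Qed.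

Lemma d_anti i j : (i <= j)%N -> d j <= d i.
Proof.
move=> /subnKC <-; elim: (j - i)%N => [|k IH]; first by rewrite addn0.
by rewrite addnS; apply: le_trans IH; exact/ltW/d_decr.
Qed.

(** Geometric decay of the increments: everything added beyond size [k] costs at most [5
    / 4] of the first increment. *)
Lemma part_cost_tail k m : (k <= m)%N -> part_cost k <= part_cost m /\
  4 * (part_cost m - part_cost k) <= 5 * d k - 5 * d m.
Proof.
move=> /subnKC <-; elim: (m - k)%N => [|i [IH1 IH2]]; first by rewrite addn0; split; lra.
rewrite addnS part_costS; have := d_decay (k + i); have := d_gt0 (k + i); split; lra.
Qed.

Lemma part_cost_le k m : (k <= m)%N -> part_cost k <= part_cost m.
Proof. by move=> /part_cost_tail[]. Qed.

Lemma part_cost_tail_le k m : (k <= m)%N -> 4 * (part_cost m - part_cost k) <= 5 * d k.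
Proof. by move=> /part_cost_tail[_]; have := d_gt0 m; lra. Qed.

Lemma d_lt i j : (i < j)%N -> d j < d i.
Proof. by move=> ij; apply: le_lt_trans (d_anti ij) (d_decr i). Qed.

(** Concavity: it is cheaper to enlarge the larger part. *)
Lemma part_cost_exchange p r i : (r <= p)%N ->
  part_cost (p + i) + part_cost r <= part_cost p + part_cost (r + i).
Proof.
move=> rp; elim: i => [|i IH]; first by rewrite !addn0.
rewrite !addnS !part_costS; have : d (p + i) <= d (r + i) by apply: d_anti; rewrite leq_add2r.
lra.
Qed.

Lemma part_cost_exchange_lt p r i : (r < p)%N -> (0 < i)%N ->
  part_cost (p + i) + part_cost r < part_cost p + part_cost (r + i).
Proof.
case: i => // i rp _; have := part_cost_exchange i (ltnW rp).
rewrite !addnS !part_costS; have : d (p + i) < d (r + i) by apply: d_lt; rewrite ltn_add2r.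
lra.
Qed.

(** The number of parts of size more than [j], that is, the [j]-th entry of the
    conjugate partition; costs are linear in it. *)
Definition above (j : nat) (s : seq nat) : nat := count (fun m => j < m)%N s.

Lemma part_cost_layers M m : (m <= M)%N -> part_cost m = \sum_(j < M) d j * (j < m)%N%:R.
Proof.
move=> mM; rewrite /part_cost (big_ord_widen M d mM) big_mkcond.
by apply: eq_bigr => j _; case: ifP; rewrite ?mulr1 ?mulr0.
Qed.

Lemma cost_layers M s : all (leq^~ M) s -> cost s = \sum_(j < M) d j * (above j s)%:R.
Proof.
rewrite /cost; elim: s => [|m s IH] /=.
  by rewrite big_nil big1 // => j _; rewrite mulr0.
move=> /andP[mM sM]; rewrite big_cons IH // (part_cost_layers mM) -big_split /=.
by apply: eq_bigr => j _; rewrite natrD mulrDr.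
Qed.

Lemma sumn_layers M s : all (leq^~ M) s -> sumn s = (\sum_(j < M) above j s)%N.
Proof.
elim: s => [|m s IH] /=; first by rewrite big1.
move=> /andP[mM sM]; rewrite IH // big_split /=; congr (_ + _)%N.
rewrite -big_mkcond -(big_ord_widen M (fun=> 1%N) mM) sum1_card card_ord //.
Qed.

Lemma above_anti i j s : (i <= j)%N -> (above j s <= above i s)%N.
Proof. by move=> ij; apply: sub_count => m /= /(leq_ltn_trans ij). Qed.

(** Summation by parts against decreasing weights. *)
Lemma abel_lower (z : nat -> R) k : (forall m, (m <= k.+1)%N -> 0 <= \sum_(j < m) z j) ->
  d k * \sum_(j < k.+1) z j <= \sum_(j < k.+1) d j * z j.
Proof.
elim: k => [|k IH] Z; first by rewrite !big_ord_recr !big_ord0 /= !add0r.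
rewrite big_ord_recr [leRHS]big_ord_recr /= mulrDr lerD2r.
apply: le_trans (IH _); last by move=> m mk; apply: Z; exact: leqW.
by apply: ler_wpM2r; [apply: Z; exact: leqW|apply/ltW/d_decr].
Qed.

(** The equality case of summation by parts. *)
Lemma abel_eq0 (z : nat -> R) k : (forall m, (m <= k)%N -> 0 <= \sum_(j < m) z j) ->
  \sum_(j < k) d j * z j <= 0 -> forall j, (j < k)%N -> z j = 0.
Proof.
elim: k => // k IH Z; rewrite big_ord_recr /= => le0.
have Zk := Z k (leqnSn k); have := Z k.+1 (leqnn _); rewrite big_ord_recr /= => Zk1.
have zk : z k = 0.
  case: k {IH} Z le0 Zk Zk1 => [|k] Z.
    rewrite !big_ord0 !add0r => h _ h'; apply/eqP; rewrite eq_le h' andbT.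
    by move: h; rewrite pmulr_rle0.
  move=> le0 Zk Zk1; have low : d k * \sum_(j < k.+1) z j <= \sum_(j < k.+1) d j * z j.
    by apply: abel_lower => m mk; apply: Z; exact: leqW.
  have dk := d_decr k; have dk0 := d_gt0 k.+1.
  set Y := \sum_(j < k.+1) z j in Zk Zk1 low *.
  have Y0 : Y = 0.
    apply/eqP; rewrite eq_le Zk andbT leNgt; apply/negP => Y0.
    have h1 : 0 <= d k.+1 * (Y + z k.+1) by apply: mulr_ge0 => //; exact: ltW.
    have h2 : 0 < (d k - d k.+1) * Y by apply: mulr_gt0 => //; rewrite subr_gt0.
    move: le0 low h1 h2; rewrite mulrDr mulrBl; lra.
  move: low le0 Zk1; rewrite Y0 mulr0 add0r => low le0 z0; apply/eqP; rewrite eq_le z0 andbT.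
  by rewrite -(pmulr_rle0 _ dk0); lra.
move=> j; rewrite ltnS leq_eqVlt => /orP[/eqP->//|]; apply: IH.
- by move=> m mk; apply: Z; exact: leqW.
- by move: le0; rewrite zk mulr0 addr0.
Qed.

(** Compared with [a] parts of size [k] and one of size [b], a nonincreasing profile
    with at least the same total is more concentrated on the low layers. *)
Lemma partial_sums (y : nat -> nat) k a b : (forall i j, (i <= j)%N -> (y j <= y i)%N) ->
  (a * k + b <= \sum_(j < k) y j)%N ->
  forall m, (m <= k)%N -> (a * m + minn m b <= \sum_(j < m) y j)%N.
Proof.
move=> anti big [|m] mk; first by rewrite muln0 min0n.
case: (ltnP a (y m)) => ym.
  apply: (@leq_trans (\sum_(j < m.+1) a.+1)).
    by rewrite sum_nat_const card_ord [X in (_ <= X)%N]mulnS addnC mulnC leq_add ?geq_minl.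
  by apply: leq_sum => j _; apply: leq_trans ym _; apply: anti; rewrite -ltnS.
have : (\sum_(j < k) y j <= \sum_(j < m.+1) y j + a * (k - m.+1))%N.
  rewrite -(big_mkord predT) (big_cat_nat _ mk) //= big_mkord leq_add2l.
  rewrite mulnC -sum_nat_const_nat; rewrite !big_nat; apply: leq_sum => j /andP[mj _].
  by apply: leq_trans ym; apply: anti; exact: ltnW.
have := geq_minr m.+1 b; move: big; rewrite mulnBr; have : (a * m.+1 <= a * k)%N by rewrite leq_mul2l mk orbT.
lia.
Qed.

Lemma perm_of_above s s' : all (ltn 0) s -> all (ltn 0) s' ->
  (forall j, above j s = above j s') -> perm_eq s s'.
Proof.
move=> s0 s0' h; apply/allP => m _ /=; apply/eqP.
have count0 t : all (ltn 0) t -> count_mem 0%N t = 0%N.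
  by move=> /allP t0; apply/count_memPn/negP => /t0.
case: m => [|m]; first by rewrite !count0.
have countS t : (count_mem m.+1 t + above m.+1 t = above m t)%N.
  rewrite /above -count_predUI [X in (_ + X)%N](@eq_count _ _ pred0); last first.
    by move=> x /=; apply/negP => /andP[/eqP->]; rewrite ltnn.
  by rewrite count_pred0 addn0; apply: eq_count => x /=; rewrite [RHS]leq_eqVlt eq_sym.
by have := countS s; have := countS s'; rewrite !h => <- /addIn.
Qed.

Lemma cost_cons m s : cost (m :: s) = part_cost m + cost s.
Proof. exact: big_cons. Qed.

Lemma cost_perm s s' : perm_eq s s' -> cost s = cost s'.
Proof. exact: perm_big. Qed.

Lemma cost_nseq q m : cost (nseq q m) = q%:R * part_cost m.
Proof. by elim: q => [|q IH]; rewrite /cost ?big_nil ?mul0r // big_cons -/(cost _) IH -natr1; ring. Qed.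

Lemma above_nseq j q m : above j (nseq q m) = ((j < m) * q)%N.
Proof. by rewrite /above count_nseq. Qed.

Lemma sum_layers k b : (b <= k)%N -> \sum_(j < k) d j * (j < b)%N%:R = part_cost b.
Proof. by move=> bk; rewrite (part_cost_layers bk). Qed.

Lemma sum_below m b : (\sum_(j < m) (j < b) = minn m b)%N.
Proof.
elim: m => [|m IH]; first by rewrite big_ord0 min0n.
by rewrite big_ord_recr /= IH; case: ltnP; lia.
Qed.

Lemma layer_excess (y : nat -> nat) a b m :
  \sum_(j < m) ((y j)%:R - a%:R - (j < b)%N%:R) =
    (\sum_(j < m) y j)%:R - (a * m + minn m b)%:R :> R.
Proof.
rewrite 2!big_split /= !sumrN sumr_const card_ord -!natr_sum sum_below natrD natrM mulr_natr.
by rewrite opprD addrA.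
Qed.

(** An excess [D] over the total of [a] full parts and a part of size [b] is cheapest in
    the highest layer [k - 1], where a unit costs at least [5 * d k]. *)
Lemma layered_cost (y : nat -> nat) k a b D : (0 < k)%N ->
  (forall i j, (i <= j)%N -> (y j <= y i)%N) -> \sum_(j < k) y j = (a * k + b + D)%N ->
  a%:R * part_cost k + part_cost b + D%:R * (5 * d k) <= \sum_(j < k) d j * (y j)%:R.
Proof.
case: k => // k _ anti sumy.
have part := @partial_sums y k.+1 a b anti.
rewrite sumy in part; have {}part := part (leq_addr _ _).
pose z j : R := (y j)%:R - a%:R - (j < b)%N%:R.
have Zsum m : \sum_(j < m) z j = (\sum_(j < m) y j)%:R - (a * m + minn m b)%:R.
  exact: layer_excess.
have Z m : (m <= k.+1)%N -> 0 <= \sum_(j < m) z j.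
  by move=> mk; rewrite Zsum subr_ge0 ler_nat; apply: part.
have := abel_lower Z.
have -> : \sum_(j < k.+1) d j * z j = \sum_(j < k.+1) d j * (y j)%:R - a%:R * part_cost k.+1
    - \sum_(j < k.+1) d j * (j < b)%N%:R.
  rewrite /part_cost mulr_sumr -!sumrN -!big_split /=.
  by apply: eq_bigr => j _; rewrite /z; ring.
rewrite Zsum sumy; have dk := d_decay k; have dk0 := d_gt0 k.+1.
case: (leqP b k.+1) => bk.
  rewrite sum_layers // (_ : _ - _ = D%:R); last by rewrite natrD addrC addKr.
  move=> h; have : D%:R * (5 * d k.+1) <= d k * D%:R by rewrite mulrC ler_wpM2r.
  lra.
have -> : \sum_(j < k.+1) d j * (j < b)%N%:R = part_cost k.+1.
  by apply: eq_bigr => j _; rewrite (ltn_trans (ltn_ord j) bk) mulr1.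
have bE : (b = k.+1 + (b - k.+1))%N by rewrite subnKC // ltnW.
have tail := part_cost_tail_le (ltnW bk).
have b1 : 1 <= (b - k.+1)%:R :> R by rewrite -[1]/(1%:R) ler_nat subn_gt0.
have -> : (a * k.+1 + b + D)%:R - (a * k.+1 + k.+1)%:R = (b - k.+1)%:R + D%:R :> R.
  by rewrite {1}bE !natrD; ring.
have : D%:R * (5 * d k.+1) <= d k * D%:R by rewrite mulrC ler_wpM2r.
have : 5 * d k.+1 <= d k * (b - k.+1)%:R.
  by apply: le_trans dk _; rewrite ler_peMr //; apply/ltW.
rewrite mulrDr; lra.
Qed.

Lemma layered_cost_eq (y : nat -> nat) k a b : (b <= k)%N ->
  (forall i j, (i <= j)%N -> (y j <= y i)%N) -> \sum_(j < k) y j = (a * k + b)%N ->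
  \sum_(j < k) d j * (y j)%:R <= a%:R * part_cost k + part_cost b ->
  forall j, (j < k)%N -> y j = (a + (j < b))%N.
Proof.
move=> bk anti sumy le0.
have part := @partial_sums y k a b anti.
rewrite sumy in part; have {}part := part (leqnn _).
pose z j : R := (y j)%:R - a%:R - (j < b)%N%:R.
have Z m : (m <= k)%N -> 0 <= \sum_(j < m) z j.
  by move=> mk; rewrite layer_excess subr_ge0 ler_nat; apply: part.
have z0 := abel_eq0 Z.
move=> j jk; have : z j = 0.
  apply: z0 => //; move: le0; rewrite -(sum_layers bk) /part_cost mulr_sumr -big_split /=.
  rewrite -subr_le0 -sumrN -big_split /=; apply: le_trans; rewrite le_eqVlt; apply/orP; left.
  by apply/eqP; apply: eq_bigr => i _; rewrite /z; ring.
move=> /eqP; rewrite /z -addrA -opprD subr_eq0 -natrD eqr_nat => /eqP ->.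
by [].
Qed.

Lemma above_ge j s m : all (leq^~ m) s -> (m <= j)%N -> above j s = 0%N.
Proof.
move=> /allP sm mj; apply/eqP; rewrite -leqn0 leqNgt -has_count; apply/hasPn => x /sm xm.
by rewrite -leqNgt (leq_trans xm).
Qed.

(** The parts other than the two largest have size at most [n2]. With [n2 < K], filling
    [a * K + b] needs at least [a] units of excess over [a] parts of size [n2], and each
    of them costs [5 * d n2], more than what the larger parts save beyond size [n2].
    With [n2 = K] the first part is either as large as allowed or one smaller, and the
    latter leaves one unit of excess. *)
Lemma compare_many n1 n2 rest L K a b :
  (n2 <= n1)%N -> (0 < n2)%N -> all (leq^~ n2) rest -> (n1 + n2 <= L)%N ->
  K = L./2 -> (0 < a)%N -> (b < K)%N -> (n1 + n2 + sumn rest = L + a * K + b)%N ->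
  let s := [:: n1, n2 & rest] in let t := [:: L - K, b & nseq a.+1 K]%N in
  cost t <= cost s /\ (cost s <= cost t -> forall j, above j s = above j t).
Proof.
move=> n21 n20 restn n12L KE a0 bK sumE s t.
have [KL LK] : (K <= L - K)%N /\ (L - K <= K.+1)%N by rewrite KE; lia.
have nK : (n2 <= K)%N by rewrite KE; lia.
(* The excess of [rest] over [a] parts of size [n2] and one of size [b]. *)
pose D := (a * (K - n2) + (L - n1 - n2))%N.
have anti i j : (i <= j)%N -> (above j rest <= above i rest)%N by exact: above_anti.
have sumy : (\sum_(j < n2) above j rest = a * n2 + b + D)%N.
  rewrite -(sumn_layers restn) /D mulnBr; have : (a * n2 <= a * K)%N by rewrite leq_mul2l nK orbT.
  by move: sumE; clear -n12L; lia.
have low := layered_cost n20 anti sumy.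
have sE : cost s = part_cost n1 + part_cost n2 + \sum_(j < n2) d j * (above j rest)%:R.
  by rewrite /s !cost_cons (cost_layers restn) addrA.
have tE : cost t = part_cost (L - K) + part_cost b + (a%:R + 1) * part_cost K.
  by rewrite /t !cost_cons cost_nseq; ring.
have dn := d_gt0 n2.
have [nK'|Kn] := ltnP n2 K.
  suff lt : cost t < cost s by split; [exact: ltW|rewrite leNgt lt].
  have t1 := part_cost_tail_le nK.
  have t2 := part_cost_tail_le (leq_trans nK KL).
  have t3 := part_cost_le n21.
  have a1 : 1 <= a%:R :> R by rewrite -[1]/(1%:R) ler_nat.
  have aD : a%:R <= D%:R :> R.
    rewrite ler_nat /D; apply: leq_trans (leq_addr _ _).
    by rewrite leq_pmulr // subn_gt0.
  have m1 : a%:R * (4 * (part_cost K - part_cost n2)) <= a%:R * (5 * d n2) by rewrite ler_wpM2l.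
  have m2 : a%:R * d n2 <= D%:R * d n2 by rewrite ler_pM2r.
  have m3 : d n2 <= a%:R * d n2 by rewrite ler_peMl // ltW.
  rewrite sE tE; lra.
have {Kn nK} nK : n2 = K by apply/eqP; rewrite eqn_leq nK Kn.
subst n2; have [n1E|n1E] := eqVneq n1 (L - K)%N.
  have D0 : D = 0%N by rewrite /D n1E; lia.
  rewrite D0 mul0r addr0 in low; rewrite D0 addn0 in sumy.
  have tsE : cost s - cost t = \sum_(j < K) d j * (above j rest)%:R - (a%:R * part_cost K + part_cost b).
    by rewrite sE tE n1E; ring.
  split; first by rewrite -subr_ge0 tsE subr_ge0.
  rewrite -subr_le0 tsE subr_le0 => eq j.
  have y := layered_cost_eq (ltnW bK) anti sumy eq.
  rewrite /s /t /= n1E above_nseq.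
  case: (ltnP j K) => jK; first by rewrite y // mul1n; lia.
  by rewrite (above_ge restn jK) mul0n (leq_gtF (ltnW (leq_trans bK jK))) .
have n1K : n1 = K /\ (L - K = K.+1)%N by lia.
have D1 : D = 1%N by rewrite /D; lia.
case: n1K => n1K LK1.
suff lt : cost t < cost s by split; [exact: ltW|rewrite leNgt lt].
rewrite sE tE n1K LK1 part_costS; move: low; rewrite D1 mul1r; lra.
Qed.

(** With three parts, two exchanges move units from the two smaller parts to the largest
    one. With at least four parts, four parts cost at least [4 * d 0], whereas three
    parts cost at most [15 / 4 * d 0]. *)
Lemma compare_few n1 n2 rest L K :
  (n2 <= n1)%N -> (0 < n2)%N -> all (ltn 0) rest -> all (leq^~ n2) rest -> (n1 + n2 <= L)%N ->
  (0 < K)%N -> (n1 + n2 + sumn rest = L + K)%N ->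
  let s := [:: n1, n2 & rest] in let t := [:: L - K; K; K]%N in
  cost t <= cost s /\ (cost s <= cost t -> forall j, above j s = above j t).
Proof.
move=> n21 n20 rest0 restn n12L K0 sumE s t.
have tE : cost t = part_cost (L - K) + (part_cost K + part_cost K).
  by rewrite /t !cost_cons /cost big_nil addr0.
case: rest rest0 restn sumE @s => [|n3 [|n4 rest]] rest0 restn sumE s.
- by move: sumE => /=; lia.
- have n32 : (n3 <= n2)%N by case/andP: restn.
  have {}sumE : (n1 + n2 + n3 = L + K)%N by move: sumE => /=; rewrite addn0.
  have sE : cost s = part_cost n1 + (part_cost n2 + part_cost n3).
    by rewrite /s !cost_cons /cost big_nil addr0.
  have [K3 LE] : (K <= n3)%N /\ (L - K = n1 + (n2 - K) + (n3 - K))%N by lia.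
  have h1 : part_cost (n1 + (n2 - K)) + part_cost K <= part_cost n1 + part_cost n2.
    by rewrite -{2}(@subnKC K n2); [apply: part_cost_exchange; lia|lia].
  have h2 : part_cost (L - K) + part_cost K <= part_cost (n1 + (n2 - K)) + part_cost n3.
    by rewrite LE -{2}(@subnKC K n3) //; apply: part_cost_exchange; lia.
  split; first by rewrite sE tE; lra.
  rewrite sE tE => le0.
  have n3E : n3 = K.
    apply/eqP/negP => /negP n3K.
    have : part_cost (L - K) + part_cost K < part_cost (n1 + (n2 - K)) + part_cost n3.
      by rewrite LE -{2}(@subnKC K n3) //; apply: part_cost_exchange_lt; lia.
    lra.
  have n2E : n2 = K.
    apply/eqP/negP => /negP n2K.
    have : part_cost (n1 + (n2 - K)) + part_cost K < part_cost n1 + part_cost n2.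
      by rewrite -{2}(@subnKC K n2); [apply: part_cost_exchange_lt; lia|lia].
    lra.
  by move=> j; rewrite /s /t n3E n2E (_ : (L - K)%N = n1) //; lia.
have /and3P[n30 n40 _] := rest0.
suff lt : cost t < cost s by split; [exact: ltW|rewrite leNgt lt].
have d0 := d_gt0 0.
have pos m : (0 < m)%N -> d 0%N <= part_cost m.
  by move=> m0; have := part_cost_le m0; rewrite part_costS /part_cost big_ord0 add0r.
have up m : 4 * part_cost m <= 5 * d 0%N.
  by have := part_cost_tail_le (leq0n m); rewrite [part_cost 0]big_ord0 subr0.
have rge : 0 <= cost rest.
  by apply: sumr_ge0 => m _; apply: sumr_ge0 => i _; apply/ltW.
rewrite tE /s !cost_cons; have := up K; have := up (L - K)%N.
have := pos n1 (leq_trans n20 n21); have := pos n2 n20; have := pos n3 n30; have := pos n4 n40; lra.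
Qed.

End ConcaveCost.

(** * Fans over disjoint paths *)

Section PathLists.
Variable V : eqType.
Implicit Types (p : seq V) (ps : seq (seq V)) (x y : V).

Definition consecutive p x y : bool :=
  [&& x \in p, y \in p & index y p == (index x p).+1].

Definition linked ps x y : bool :=
  has (fun p => consecutive p x y || consecutive p y x) ps.

Arguments consecutive : simpl never.
Arguments linked : simpl never.

Lemma linked_sym ps : symmetric (linked ps).
Proof. by move=> x y; apply: eq_has => p; rewrite orbC. Qed.

Lemma linked_mem ps x y : linked ps x y -> (x \in flatten ps) && (y \in flatten ps).
Proof.
move=> /hasP[p pps /orP[]/and3P[xp yp _]]; apply/andP.
  by split; apply/flattenP; exists p.
by split; apply/flattenP; exists p.
Qed.

Lemma linked_perm ps ps' : perm_eq ps ps' -> linked ps =2 linked ps'.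
Proof. by move=> /perm_mem h x y; apply: eq_has_r. Qed.

Lemma linked_cons p ps x y :
  linked (p :: ps) x y = [|| consecutive p x y, consecutive p y x | linked ps x y].
Proof. by rewrite /linked /= orbA. Qed.

Lemma linked_nonempty ps : linked [seq p <- ps | p != [::]] =2 linked ps.
Proof.
by move=> x y; elim: ps => //= -[|a p] ps IH; rewrite !linked_cons IH.
Qed.

Lemma flatten_nonempty ps : flatten [seq p <- ps | p != [::]] = flatten ps.
Proof. by elim: ps => //= -[|x p] ps //= ->. Qed.

Lemma linked_index ps x y : uniq (flatten ps) -> linked ps x y ->
  index y (flatten ps) = (index x (flatten ps)).+1 \/
  index x (flatten ps) = (index y (flatten ps)).+1.
Proof.
elim: ps => // p ps IH; rewrite /= cat_uniq => /and3P[up dis ups]; rewrite linked_cons.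
move=> /or3P[/and3P[xp yp /eqP h]|/and3P[yp xp /eqP h]|xy].
- by left; rewrite !index_cat xp yp.
- by right; rewrite !index_cat xp yp.
have /andP[xF yF] := linked_mem xy.
have /negbTE xp : x \notin p by move/hasPn: dis => /(_ x xF).
have /negbTE yp : y \notin p by move/hasPn: dis => /(_ y yF).
by rewrite !index_cat xp yp; case: (IH ups xy) => ->; [left|right]; rewrite addnS.
Qed.

End PathLists.

Arguments consecutive : simpl never.
Arguments linked : simpl never.

Section Transfer.
Variables (V W : eqType) (d : W).

Lemma linked_transfer (ps : seq (seq V)) (qs : seq (seq W)) :
  uniq (flatten ps) -> uniq (flatten qs) -> map size ps = map size qs ->
  {in flatten ps &, forall x y,
    linked qs (nth d (flatten qs) (index x (flatten ps))) (nth d (flatten qs) (index y (flatten ps)))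
    = linked ps x y}.
Proof.
elim: ps qs => [|p ps IH] [|q qs] //= ; rewrite !cat_uniq.
move=> /and3P[up disp ups] /and3P[uq disq uqs] [szp szs] x y.
have szF : size (flatten ps) = size (flatten qs) by rewrite !size_flatten /shape szs.
have nthE z : z \in p ++ flatten ps -> nth d (q ++ flatten qs) (index z (p ++ flatten ps)) =
    if z \in p then nth d q (index z p) else nth d (flatten qs) (index z (flatten ps)).
  rewrite mem_cat index_cat nth_cat -szp; case zp: (z \in p) => /=; first by rewrite index_mem zp.
  by rewrite ltnNge leq_addr /= addKn.
move=> xin yin; rewrite !nthE // !linked_cons.
have out z : z \in p -> z \notin flatten ps.
  by move=> zp; apply/negP => zF; move/hasPn: disp => /(_ z zF); rewrite zp.
have out' z : z \in q -> z \notin flatten qs.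
  by move=> zp; apply/negP => zF; move/hasPn: disq => /(_ z zF); rewrite zp.
have nl z w : z \in p -> linked ps z w = false.
  by move=> zp; apply/negP => /linked_mem/andP[zF _]; move: (out z zp); rewrite zF.
have nl' z w : z \in q -> linked qs z w = false.
  by move=> zp; apply/negP => /linked_mem/andP[zF _]; move: (out' z zp); rewrite zF.
have inq z : z \in p -> nth d q (index z p) \in q.
  by move=> zp; rewrite mem_nth // -szp index_mem.
have inqs z : z \in p ++ flatten ps -> z \notin p ->
    nth d (flatten qs) (index z (flatten ps)) \in flatten qs.
  by rewrite mem_cat => /orP[->//|zF] _; rewrite mem_nth // -szF index_mem.
have notq z : z \in p ++ flatten ps -> z \notin p ->
    nth d (flatten qs) (index z (flatten ps)) \notin q.
  by move=> zin zp; apply/negP => /out'; rewrite inqs.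
case xp: (x \in p); case yp: (y \in p).
- rewrite nl // nl' ?inq // !orbF /consecutive !inq // xp yp.
  by rewrite !index_uniq // -?szp ?index_mem.
- rewrite nl // nl' ?inq // !orbF /consecutive (negbTE (notq y yin _)) ?yp // !andbF //.
- rewrite linked_sym nl' ?inq // linked_sym nl // !orbF /consecutive (negbTE (notq x xin _)) ?xp // !andbF //.
- have xF : x \in flatten ps by move: xin; rewrite mem_cat xp.
  have yF : y \in flatten ps by move: yin; rewrite mem_cat yp.
  rewrite /consecutive (negbTE (notq x xin _)) ?xp // yp !andbF /=.
  exact: IH.
Qed.

Lemma perm_map_lift (T : Type) (U : eqType) (f : T -> U) (s : seq T) (t : seq U) :
  perm_eq t (map f s) -> exists Is, perm_eq Is (iota 0 (size s)) /\
    forall z, t = map f (map (nth z s) Is).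
Proof.
case: s => [|x s] h; first by exists [::]; split=> // z; apply: perm_nilP.
have [Is IsE ->] := perm_iotaP (f x) h; rewrite size_map in IsE.
exists Is; split=> // z; rewrite -map_comp; apply/eq_in_map => i.
by rewrite (perm_mem IsE) mem_iota add0n => /andP[_ ilt]; rewrite [RHS]/comp (nth_map z).
Qed.

End Transfer.

Section Fans.

Definition fan_rel (V : eqType) (u v : V) (ps : seq (seq V)) : rel V := fun x y =>
  (x != y) && [|| x \in [:: u; v], y \in [:: u; v] | linked ps x y].

(** [ps] lists the paths, as sequences of consecutive vertices; empty paths are allowed,
    so that degenerate sizes need no special treatment. *)
Definition fan (V : finType) (e : rel V) (u v : V) (ps : seq (seq V)) : Prop :=
  [/\ uniq [:: u, v & flatten ps], forall x, x \in [:: u, v & flatten ps]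
    & e =2 fan_rel u v ps].

Lemma fan_perm (V : finType) (e : rel V) u v ps ps' : perm_eq ps ps' ->
  fan e u v ps -> fan e u v ps'.
Proof.
move=> pp [h1 h2 h3].
have pF : perm_eq [:: u, v & flatten ps] [:: u, v & flatten ps'].
  by rewrite !perm_cons; apply: perm_flatten.
split; first by rewrite -(perm_uniq pF).
  by move=> x; rewrite -(perm_mem pF).
by move=> x y; rewrite h3 /fan_rel (linked_perm pp).
Qed.

Lemma fan_nonempty (V : finType) (e : rel V) u v ps : fan e u v ps ->
  fan e u v [seq p <- ps | p != [::]].
Proof.
move=> [h1 h2 h3]; split; rewrite ?flatten_nonempty //.
by move=> x y; rewrite h3 /fan_rel linked_nonempty.
Qed.

(** After permuting the paths of one fan, the positions in the concatenation of all
    paths match. *)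
Lemma fan_iso (G H : sgraph) u v ps u' v' qs :
  fan (@adj G) u v ps -> fan (@adj H) u' v' qs ->
  perm_eq (map size ps) (map size qs) -> isomorphic G H.
Proof.
move=> fG fH szs.
have [Is [IsE /(_ [::]) szE]] := perm_map_lift szs.
have {}fH : fan (@adj H) u' v' (map (nth [::] qs) Is).
  apply: fan_perm fH; rewrite -{1}(mkseq_nth [::] qs); by apply: perm_map; rewrite perm_sym.
move: (map _ Is) fH szE => {szs IsE}qs' [uH cH eH] szE; have [uG cG eG] := fG.
set LG := [:: u, v & flatten ps] in uG cG; set LH := [:: u', v' & flatten qs'] in uH cH.
have szL : size LG = size LH by rewrite /= !size_flatten /shape szE.
pose f x := nth u' LH (index x LG); pose g y := nth u LG (index y LH).
have fK : cancel f g.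
  by move=> x; rewrite /g /f index_uniq ?nth_index // -szL index_mem cG.
have gK : cancel g f.
  by move=> x; rewrite /g /f index_uniq ?nth_index // szL index_mem cH.
exists f; first by exists g.
move=> x y; rewrite eH eG /fan_rel (can_eq fK); congr (_ && _).
have f_end z : (f z \in [:: u'; v']) = (z \in [:: u; v]).
  have fu : f u = u' by rewrite /f /= eqxx.
  have fv : f v = v'.
    by rewrite /f /= eqxx; move: uG; rewrite /= inE negb_or => /andP[/andP[/negbTE ->]].
  by rewrite !inE -{1}fu -fv !(can_eq fK).
rewrite !f_end; case xe: (x \in _) => //=; case ye: (y \in _) => //=.
have fE z : (z \in [:: u; v]) = false -> f z = nth u' (flatten qs') (index z (flatten ps)).
  by rewrite !inE => /norP[/negbTE zu /negbTE zv]; rewrite /f /= (eq_sym u) zu (eq_sym v) zv.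
have inF z : (z \in [:: u; v]) = false -> z \in flatten ps.
  by have := cG z; rewrite /LG !inE orbA => + zF; rewrite zF.
rewrite !fE // linked_transfer ?inF //.
- by move: uG; rewrite /= => /and3P[].
- by move: uH; rewrite /= => /and3P[].
Qed.

End Fans.

(** * The Perron vector of a fan along its paths *)

Section PathProfile.
Local Open Scope ring_scope.
Variables (R : realFieldType) (t : R).
Hypotheses (t_gt0 : 0 < t) (t_small : 6 * t <= 1).

(** With [r = t + t^-1], the entries of the Perron vector on a path of [m] vertices sum
    to a multiple of [m] minus a multiple of this deficit, with factors that do not
    depend on [m]. *)
Definition fan_cost (m : nat) : R := t * (1 - t ^+ m) / (1 + t ^+ m.+1).

Definition fan_step (j : nat) : R := fan_cost j.+1 - fan_cost j.

Let t_lt1 : t < 1. Proof. by have := t_gt0; have := t_small; lra. Qed.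

Let tX m : 0 < t ^+ m <= 1.
Proof. by rewrite exprn_gt0 // exprn_ile1 // ltW. Qed.

Lemma fan_stepE j : fan_step j =
  (1 - t ^+ 2) * t ^+ j.+1 / ((1 + t ^+ j.+1) * (1 + t ^+ j.+2)).
Proof.
have /andP[h1 _] := tX j; rewrite /fan_step /fan_cost !exprS.
by field; apply/andP; split; rewrite gt_eqF // addr_gt0 // !mulr_gt0.
Qed.

Lemma fan_step_gt0 j : 0 < fan_step j.
Proof.
have /andP[h1 h2] := tX j.+1; have /andP[h3 _] := tX j.+2.
have t2 : 0 < 1 - t ^+ 2 by rewrite subr_gt0 expr_lt1 // ltW.
by rewrite fan_stepE divr_gt0 // mulr_gt0 // addr_gt0.
Qed.

(** This is where [6 * t <= 1] is used: consecutive increments have ratio about [t]. *)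
Lemma fan_step_decay j : 5 * fan_step j.+1 <= fan_step j.
Proof.
rewrite !fan_stepE; have /andP[h1 h2] := tX j.+1.
have t2 : 0 < 1 - t ^+ 2 by rewrite subr_gt0 expr_lt1 // ltW.
have st : t ^+ j.+1 <= t by have /andP[_ h] := tX j; rewrite exprS ler_piMr // ltW.
rewrite !(exprS _ j.+1) !(exprS _ j.+2) (exprS _ j.+1); set s := t ^+ j.+1 in h1 h2 st *.
have p1 : 0 < 1 + s by lra.
have p2 : 0 < 1 + t * s by rewrite addr_gt0 // mulr_gt0.
have p3 : 0 < 1 + t * (t * s) by rewrite addr_gt0 // !mulr_gt0.
rewrite -subr_ge0.
have -> : (1 - t ^+ 2) * s / ((1 + s) * (1 + t * s)) -
    5 * ((1 - t ^+ 2) * (t * s) / ((1 + t * s) * (1 + t * (t * s)))) =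
    (1 - t ^+ 2) * s * (1 + t * (t * s) - 5 * t * (1 + s)) /
      ((1 + s) * (1 + t * s) * (1 + t * (t * s))).
  by field; rewrite !gt_eqF.
apply: divr_ge0; last by rewrite !mulr_ge0 // ltW.
apply: mulr_ge0; first by rewrite mulr_ge0 // ltW.
have ts : t * s <= t * t by rewrite ler_pM2l.
have : 0 < t * (t * s) by rewrite !mulr_gt0.
have : t * (6 * t) <= t * 1 by rewrite ler_pM2l.
have := t_gt0; have := t_small.
lra.
Qed.

Lemma part_cost_fan m : part_cost fan_step m = fan_cost m.
Proof.
elim: m => [|m IH]; first by rewrite /part_cost big_ord0 /fan_cost expr0 subrr mulr0 mul0r.
by rewrite part_costS IH /fan_step addrC subrK.
Qed.

(** The solution of [r * h = 2 + (sum of the two neighbours)] on a path, at distances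
    [a] and [b] from the two missing vertices just beyond its ends, where it
    vanishes. *)
Definition height (a b : nat) : R :=
  2 * (t / (1 - t) ^+ 2) * (1 - (t ^+ a + t ^+ b) / (1 + t ^+ (a + b))).

Definition profile (m i : nat) : R := height i.+1 (m - i).

Lemma height0r a : height a 0 = 0.
Proof.
have /andP[h _] := tX a.
by rewrite /height addn0 expr0 [t ^+ a + 1]addrC divff ?subrr ?mulr0 // gt_eqF // addr_gt0.
Qed.

Lemma height0l b : height 0 b = 0.
Proof.
have /andP[h _] := tX b.
by rewrite /height add0n expr0 divff ?subrr ?mulr0 // gt_eqF // addr_gt0.
Qed.

Lemma height_step a b :
  (t + t^-1) * height a.+1 b.+1 = 2 + height a b.+2 + height a.+2 b.
Proof.
have /andP[h1 _] := tX (a + b).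
rewrite /height !addnS !addSn !exprS exprD.
have /andP[ha _] := tX a; have /andP[hb _] := tX b.
field; rewrite !gt_eqF ?subr_gt0 //= addr_gt0 // !mulr_gt0 //.
Qed.

Lemma sum_geometric m : \sum_(i < m) t ^+ i.+1 = t * (1 - t ^+ m) / (1 - t).
Proof.
elim: m => [|m IH]; first by rewrite big_ord0 expr0 subrr mulr0 mul0r.
rewrite big_ord_recr /= IH exprS; field; rewrite gt_eqF // subr_gt0 //.
Qed.

Lemma sum_profile m : \sum_(i < m) profile m i =
  2 * (t / (1 - t) ^+ 2) * (m%:R - 2 / (1 - t) * fan_cost m).
Proof.
have /andP[hm _] := tX m.
rewrite -mulr_sumr sumrB sumr_const card_ord; congr (_ * (_ - _)).
have -> : \sum_(i < m) (t ^+ i.+1 + t ^+ (m - i)) / (1 + t ^+ (i.+1 + (m - i))) =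
   (\sum_(i < m) t ^+ i.+1 + \sum_(i < m) t ^+ (m - i)) / (1 + t ^+ m.+1).
  rewrite -big_split /= mulr_suml; apply: eq_bigr => i _.
  by rewrite addSn subnKC // ltnW.
have -> : \sum_(i < m) t ^+ (m - i) = \sum_(i < m) t ^+ i.+1.
  rewrite (reindex_inj rev_ord_inj) /=; apply: eq_bigr => i _.
  by rewrite subKn.
have p1 : 1 + t * t ^+ m != 0 by rewrite gt_eqF // addr_gt0 // mulr_gt0.
have p2 : 1 - t != 0 by rewrite gt_eqF // subr_gt0.
by rewrite sum_geometric /fan_cost exprS; field; rewrite p1 p2.
Qed.

Variable V : eqType.
Implicit Types (p : seq V) (ps : seq (seq V)).

(** On each path, the entries forced by the eigenvector equation when both ends of the
    fan carry [1]. *)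
Fixpoint path_vector ps (x : V) : R :=
  if ps is p :: ps' then
    if x \in p then profile (size p) (index x p) else path_vector ps' x
  else 0.

Lemma sum_consecutive p w : uniq p -> w \in p ->
  \sum_(z <- p | consecutive p w z || consecutive p z w) profile (size p) (index z p)
  = (t + t^-1) * profile (size p) (index w p) - 2.
Proof.
move=> up wp; set m := size p; set i := index w p.
have im : (i < m)%N by rewrite index_mem.
rewrite (big_nth w) big_mkord.
have -> : \sum_(j < m | consecutive p w (nth w p j) || consecutive p (nth w p j) w)
      profile m (index (nth w p j) p)
    = \sum_(j < m | (j == i.+1 :> nat) || (i == j.+1 :> nat)) profile m j.
  apply: eq_big => j; last by rewrite index_uniq.
  by rewrite /consecutive wp mem_nth //= index_uniq.
have -> : \sum_(j < m | (j == i.+1 :> nat) || (i == j.+1 :> nat)) profile m j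
    = \sum_(j < m | j == i.+1 :> nat) profile m j + \sum_(j < m | i == j.+1 :> nat) profile m j.
  rewrite (bigID (fun j : 'I_m => j == i.+1 :> nat)) /=; congr (_ + _); apply: eq_bigl => j.
    by case: (_ == _); rewrite ?andbF.
  by case: (eqVneq (j : nat) i.+1) => [->|_] /=; rewrite ?andbT ?andbF // ltn_eqF.
have step : (t + t^-1) * profile m i = 2 + height i (m - i).+1 + height i.+2 (m - i).-1.
  by rewrite /profile -{1}[(m - i)%N]prednK ?subn_gt0 // height_step prednK // subn_gt0.
rewrite step; have -> : \sum_(j < m | j == i.+1 :> nat) profile m j = height i.+2 (m - i).-1.
  case: (ltnP i.+1 m) => i1.
    rewrite (big_pred1 (Ordinal i1)) => [|j]; first by rewrite /profile /= subnS.
    by rewrite /= -val_eqE.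
  have -> : (m - i).-1 = 0%N by lia.
  rewrite height0r big_pred0 // => j; apply/negP => /eqP jE.
  by have := ltn_ord j; rewrite jE ltnNge i1.
have -> : \sum_(j < m | i == j.+1 :> nat) profile m j = height i (m - i).+1.
  clear step; clearbody i; case: i im => [|i] im.
    by rewrite height0l big_pred0.
  rewrite (big_pred1 (Ordinal (ltnW im))) => [|j]; last by rewrite /= -val_eqE eqSS eq_sym.
  by rewrite /profile /= -subSn // ltnW.
ring.
Qed.

Lemma sum_linked ps w : uniq (flatten ps) -> w \in flatten ps ->
  \sum_(z <- flatten ps | linked ps w z) path_vector ps z = (t + t^-1) * path_vector ps w - 2.
Proof.
elim: ps => // p ps IH; rewrite /= cat_uniq mem_cat => /and3P[up /hasPn dis ups] win.
have notp z : z \in flatten ps -> (z \in p) = false by move=> /dis/negbTE.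
rewrite big_cat /=; case: (boolP (w \in p)) win => [wp _|/negbTE wp wF] /=.
  rewrite [X in _ + X]big1_seq ?addr0; last first.
    move=> z /andP[+ zF]; rewrite linked_cons => /or3P[/and3P[_]|/and3P[]|/linked_mem/andP[wF _]].
    - by rewrite notp.
    - by rewrite notp.
    - by rewrite notp in wp.
  rewrite -(sum_consecutive up wp) big_seq_cond [RHS]big_seq_cond.
  apply: eq_big => z; last by move=> /andP[-> _].
  case zp: (z \in p) => //=; rewrite linked_cons; case: (boolP (linked ps w z)); last by rewrite orbF.
  by move=> /linked_mem/andP[wF _]; rewrite notp in wp.
rewrite [X in X + _]big1_seq ?add0r; last first.
  move=> z /andP[+ zp]; rewrite linked_cons => /or3P[/and3P[]|/and3P[_]|/linked_mem/andP[_ zF]].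
  - by rewrite wp.
  - by rewrite wp.
  - by rewrite notp in zp.
rewrite -IH // big_seq_cond [RHS]big_seq_cond; apply: eq_big => z; last first.
  by move=> /andP[zF _]; rewrite notp.
by case zF: (z \in flatten ps) => //=; rewrite linked_cons /consecutive wp !andbF.
Qed.

Lemma sum_path_vector ps : uniq (flatten ps) ->
  \sum_(z <- flatten ps) path_vector ps z =
  2 * (t / (1 - t) ^+ 2) * ((size (flatten ps))%:R - 2 / (1 - t) * cost fan_step (map size ps)).
Proof.
elim: ps => [|p ps IH]; first by rewrite /cost !big_nil mulr0 subrr mulr0.
rewrite /= cat_uniq => /and3P[up /hasPn dis ups]; rewrite big_cat size_cat /=.
rewrite cost_cons part_cost_fan natrD.
have -> : \sum_(z <- flatten ps) (if z \in p then profile (size p) (index z p) else path_vector ps z)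
    = \sum_(z <- flatten ps) path_vector ps z.
  by rewrite !big_seq; apply: eq_bigr => z /dis/negbTE->.
have -> : \sum_(z <- p) (if z \in p then profile (size p) (index z p) else path_vector ps z)
    = \sum_(i < size p) profile (size p) i.
  rewrite big_seq; under eq_bigr => z -> do [].
  case: p up {dis} => [|x p] up; first by rewrite big_nil big_ord0.
  rewrite -big_seq (big_nth x) big_mkord; apply: eq_bigr => i _; by rewrite index_uniq.
by rewrite IH // sum_profile; ring.
Qed.

End PathProfile.

(** * The spectral radius of a fan *)

Section FanSpectrum.
Local Open Scope ring_scope.
Variable R : realType.

(** The sum of [fan_vector] over the neighbours of [u] or of [v]. As the eigenvector
    equation holds at all other vertices, [t + t^-1] is the spectral radius exactly when
    this sum equals it. *)
Definition fan_value (t : R) (N : nat) (s : seq nat) : R :=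
  1 + 2 * (t / (1 - t) ^+ 2) * (N%:R - 2 / (1 - t) * cost (fan_step t) s).

Lemma fan_big (V : finType) (e : rel V) u v ps (P : pred V) (F : V -> R) : fan e u v ps ->
  \sum_(z | P z) F z = (P u)%:R * F u + (P v)%:R * F v + \sum_(z <- flatten ps | P z) F z.
Proof.
move=> [uniq_all all_in _].
have -> : \sum_(z | P z) F z = \sum_(z <- [:: u, v & flatten ps] | P z) F z.
  apply: perm_big; apply: uniq_perm => //; first exact: index_enum_uniq.
  by move=> z; rewrite mem_index_enum all_in.
rewrite !big_cons -addrA.
by case: (P u); case: (P v); rewrite /= ?mul1r ?mul0r ?add0r ?addr0 ?addrA.
Qed.

Variables (G : sgraph) (u v : G) (ps : seq (seq G)) (t : R).
Hypotheses (fanG : fan (@adj G) u v ps) (t_gt0 : 0 < t) (t_small : 6 * t <= 1).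
Let r := t + t^-1.
Let phi := fan_value t (size (flatten ps)) (map size ps).

Definition fan_vector (x : G) : R := if x \in [:: u; v] then 1 else path_vector t ps x.

Let uv : u != v.
Proof. by case: fanG => /=; rewrite inE negb_or => /andP[/andP[]]. Qed.

Let ends_out z : z \in flatten ps -> (z \in [:: u; v]) = false.
Proof.
case: fanG => /= /and3P[+ vF _] _ _ zF; rewrite !inE negb_or => /andP[_ uF].
by apply/negP => /orP[] /eqP zE; move: uF vF; rewrite -zE zF.
Qed.

Let uniqF : uniq (flatten ps).
Proof. by case: fanG => /= /and3P[]. Qed.

Let sum_inner : \sum_(z <- flatten ps) fan_vector z = phi - 1.
Proof.
have -> : \sum_(z <- flatten ps) fan_vector z = \sum_(z <- flatten ps) path_vector t ps z.
  by rewrite !big_seq; apply: eq_bigr => z zF; rewrite /fan_vector ends_out.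
by rewrite (sum_path_vector t_gt0 t_small uniqF) /phi /fan_value; ring.
Qed.

Lemma fan_vector_end w : w \in [:: u; v] -> \sum_(z | adj w z) fan_vector z = phi.
Proof.
move=> we; have [_ _ eG] := fanG.
rewrite (fan_big _ _ fanG) !eG /fan_rel !inE !eqxx /= !orbT /fan_vector !inE !eqxx !orbT !mulr1.
have -> : \sum_(z <- flatten ps | adj w z) fan_vector z = phi - 1.
  rewrite -sum_inner [LHS]big_seq_cond [RHS]big_seq; apply: eq_bigl => z.
  case zF: (z \in flatten ps) => //=; rewrite eG /fan_rel we andbT.
  by apply: contraTneq we => ->; rewrite ends_out.
move: we; rewrite !inE => /orP[] /eqP->; rewrite eqxx /= ?[v == u]eq_sym (negbTE uv) /=; ring.
Qed.

Lemma fan_vector_inner w : w \notin [:: u; v] -> \sum_(z | adj w z) fan_vector z = r * fan_vector w.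
Proof.
move=> we; have [_ all_in eG] := fanG.
have wF : w \in flatten ps.
  by move: (all_in w) we; rewrite !inE orbA => /orP[->|].
have /norP[wu wv] : ~~ ((w == u) || (w == v)) by move: we; rewrite !inE.
rewrite (fan_big _ _ fanG) !eG /fan_rel wu wv !inE !eqxx /= !orbT /fan_vector !inE !eqxx !orbT !mulr1.
rewrite (negbTE wu) (negbTE wv) /=.
have -> : \sum_(z <- flatten ps | adj w z) fan_vector z =
    \sum_(z <- flatten ps | linked ps w z) path_vector t ps z.
  rewrite big_seq_cond [RHS]big_seq_cond; apply: eq_big => z.
    case zF: (z \in flatten ps) => //=; rewrite eG /fan_rel (negbTE we) ends_out //=.
    case: eqP => // <-; apply/esym/negP => /(linked_index uniqF).
    by case=> /eqP; rewrite -[X in X == _]addn0 -addn1 eqn_add2l.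
  by move=> /andP[zF _]; rewrite /fan_vector ends_out.
rewrite (sum_linked t_gt0 t_small uniqF wF) /r; ring.
Qed.

(** [fan_vector] is an eigenvector up to a defect concentrated at [u] and [v]. *)
Lemma fan_pairing (x : G -> R) : \sum_w x w * \sum_(z | adj w z) fan_vector z =
  r * (\sum_w x w * fan_vector w) + (phi - r) * (x u + x v).
Proof.
have -> : \sum_w x w * \sum_(z | adj w z) fan_vector z =
    \sum_w (r * (x w * fan_vector w) + (w \in [:: u; v])%:R * ((phi - r) * x w)).
  apply: eq_bigr => w _; case: (boolP (w \in [:: u; v])) => we.
    by rewrite fan_vector_end // /fan_vector we mul1r; ring.
  by rewrite fan_vector_inner // mul0r; ring.
rewrite big_split /= -mulr_sumr; congr (_ + _).
rewrite (fan_big _ _ fanG) !inE !eqxx orbT /= big_seq big1 => [|z /ends_out]; first by ring.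
by rewrite !inE => ->; rewrite mul0r.
Qed.

Let end_u : fan_vector u = 1.
Proof. by rewrite /fan_vector !inE eqxx. Qed.

Let end_v : fan_vector v = 1.
Proof. by rewrite /fan_vector !inE eqxx orbT. Qed.

(** Rayleigh bound for [fan_vector]. *)
Lemma fan_value_le : spectral_radius R G <= r -> phi <= r.
Proof.
move=> rG; have G0 : (0 < #|G|)%N by apply/card_gt0P; exists u.
have := rayleigh G0 fan_vector.
have -> : quad (@adj G) fan_vector = \sum_w fan_vector w * \sum_(z | adj w z) fan_vector z.
  by apply: eq_bigr => w _; rewrite mulr_sumr.
rewrite fan_pairing /sqnorm; under [X in r * X]eq_bigr do rewrite -expr2.
rewrite end_u end_v => le1.
have : spectral_radius R G * \sum_i fan_vector i ^+ 2 <= r * \sum_i fan_vector i ^+ 2.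
  by apply: ler_wpM2r => //; apply: sumr_ge0 => w _; exact: sqr_ge0.
lra.
Qed.

Lemma fan_value_ge : phi = r -> r <= spectral_radius R G.
Proof.
move=> phir; have G0 : (0 < #|G|)%N by apply/card_gt0P; exists u.
have := rayleigh G0 fan_vector.
have -> : quad (@adj G) fan_vector = \sum_w fan_vector w * \sum_(z | adj w z) fan_vector z.
  by apply: eq_bigr => w _; rewrite mulr_sumr.
rewrite fan_pairing /sqnorm; under [X in r * X]eq_bigr do rewrite -expr2.
rewrite phir subrr mul0r addr0 ler_pM2r //.
rewrite (bigD1 u) //= end_u expr1n ltr_pwDl //.
by apply: sumr_ge0 => w _; exact: sqr_ge0.
Qed.

(** Pair [fan_vector] with the Perron vector: the defect vanishes since the Perron
    vector is not zero at both [u] and [v]. *)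
Lemma fan_value_eq : spectral_radius R G = r -> phi = r.
Proof.
move=> rG; have G0 : (0 < #|G|)%N by apply/card_gt0P; exists u.
have [x [xge0 xle1 [x1 x1E] xE]] := @perron_vector R G G0.
have := fan_pairing x.
have -> : \sum_w x w * \sum_(z | adj w z) fan_vector z =
    \sum_w fan_vector w * \sum_(z | adj w z) x z.
  under eq_bigr do rewrite mulr_sumr.
  under [RHS]eq_bigr do rewrite mulr_sumr.
  rewrite (exchange_big_dep predT) //=; apply: eq_bigr => w _.
  by apply: eq_big => z; rewrite ?[adj z w]adj_sym // mulrC.
under eq_bigr do rewrite -xE rG mulrCA.
rewrite -mulr_sumr; under eq_bigr do rewrite mulrC.
move=> /eqP; rewrite -subr_eq0 opprD addNKr oppr_eq0 mulf_eq0 subr_eq0 => /orP[/eqP //|].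
rewrite paddr_eq0 // => /andP[/eqP xu /eqP xv].
have [_ all_in eG] := fanG.
have x0 w : w != u -> x w = 0.
  move=> wu; have := xE u; rewrite xu mulr0 => /esym/eqP; rewrite psumr_eq0 // => /allP/(_ w).
  rewrite mem_index_enum eG /fan_rel eq_sym wu !inE eqxx /=.
  by move=> /(_ isT)/eqP.
move: x1E; case: (eqVneq x1 u) => [->|/x0 ->]; rewrite ?xu => /eqP;
  by rewrite eq_sym oner_eq0.
Qed.

End FanSpectrum.

Section FanComparison.
Local Open Scope ring_scope.
Variable R : realType.

Lemma radius_parameter (r : R) : 12 <= r -> exists t, [/\ 0 < t, 6 * t <= 1 & r = t + t^-1].
Proof.
move=> r12; pose s := Num.sqrt (r ^+ 2 - 4).
have r2 : 0 <= r ^+ 2 - 4.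
  have : 12 * r <= r * r by rewrite ler_wpM2r //; lra.
  by rewrite expr2; lra.
have s2 : s ^+ 2 = r ^+ 2 - 4 by rewrite sqr_sqrtr.
have s0 : 0 <= s by exact: sqrtr_ge0.
have rs : 0 < r + s by lra.
exists (2 / (r + s)); split.
- by rewrite divr_gt0.
- by rewrite mulrA ler_pdivrMr // mul1r; lra.
- have e : (r + s) ^+ 2 + 4 = 2 * r * (r + s) by rewrite sqrrD s2; ring.
  apply/eqP; rewrite -subr_eq0; apply/eqP.
  have -> : r - (2 / (r + s) + (2 / (r + s))^-1) = (2 * r * (r + s) - ((r + s) ^+ 2 + 4)) / (2 * (r + s)).
    by field; rewrite gt_eqF.
  by rewrite e subrr mul0r.
Qed.

(** With [t] adapted to the spectral radius of [G], the value of [G] is [t + t^-1] and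
    that of [H] is at most that; values decrease with the cost. *)
Lemma fan_cost_le (G H : sgraph) u v ps u' v' qs :
  fan (@adj G) u v ps -> fan (@adj H) u' v' qs -> #|G| = #|H| ->
  12 <= spectral_radius R G -> spectral_radius R H <= spectral_radius R G ->
  exists t : R, [/\ 0 < t, 6 * t <= 1 &
    cost (fan_step t) (map size ps) <= cost (fan_step t) (map size qs)].
Proof.
move=> fG fH GH r12 HG; have [t [t0 t6 rE]] := radius_parameter r12; exists t; split=> //.
have h1 := fan_value_eq fG t0 t6 rE.
have h2 : fan_value t (size (flatten qs)) (map size qs) <= t + t^-1.
  by apply: fan_value_le fH t0 t6 _; rewrite -rE.
have sz (K : sgraph) a b (ts : seq (seq K)) : fan (@adj K) a b ts -> #|K| = (size (flatten ts)).+2.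
  move=> [/card_uniqP u1 u2 _]; rewrite -[RHS]u1; apply: eq_card => x; rewrite u2.
  by rewrite inE.
have szE : size (flatten qs) = size (flatten ps).
  by have := sz _ _ _ _ fG; rewrite GH (sz _ _ _ _ fH) => -[].
move: h2; rewrite -h1 /fan_value szE lerD2l ler_pM2l; last first.
  by rewrite mulr_gt0 // divr_gt0 // exprn_gt0 //; lra.
rewrite lerD2l lerN2 ler_pM2l // divr_gt0 //; lra.
Qed.

Lemma fan_radius_eq (G H : sgraph) u v ps u' v' qs :
  fan (@adj G) u v ps -> fan (@adj H) u' v' qs -> perm_eq (map size ps) (map size qs) ->
  12 <= spectral_radius R G -> spectral_radius R G <= spectral_radius R H.
Proof.
move=> fG fH pq r12; have [t [t0 t6 rE]] := radius_parameter r12.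
have h1 := fan_value_eq fG t0 t6 rE.
have szE : size (flatten qs) = size (flatten ps).
  by rewrite !size_flatten /shape !sumnE (perm_big _ pq).
rewrite rE; apply: (fan_value_ge fH t0 t6).
by rewrite -h1 /fan_value szE (cost_perm _ pq).
Qed.

End FanComparison.

(** * Optimal part sizes *)

Section OptimalSizes.
Variable R : realFieldType.

Lemma pairwise_perm (T : eqType) (r : rel T) (s t : seq T) : symmetric r ->
  perm_eq s t -> pairwise r s -> pairwise r t.
Proof.
move=> rs; move: s t; apply: (@catCA_perm_ind _ (fun s => is_true (pairwise r s))) => s1 s2 s3.
rewrite !pairwise_cat !allrel_catr (@allrelC _ _ r s1 s2).
have -> : allrel (fun x y => r y x) s2 s1 = allrel r s2 s1 by apply: eq_allrel => x y; exact: rs.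
by move=> /and4P[/andP[-> ->] -> -> ->] /=; rewrite ?andbT.
Qed.

(** The constraint that [C_l]-freeness puts on path sizes. The second conjunct is the
    constraint on a single path. *)
Definition packed (L : nat) (s : seq nat) : bool :=
  pairwise (fun a b => a + b <= L) s && all (leq^~ L) s.

Lemma packed_perm L s t : perm_eq s t -> packed L s -> packed L t.
Proof.
move=> st /andP[h1 h2]; rewrite /packed -(perm_all _ st) h2 andbT.
by apply: (@pairwise_perm _ _ s t) => // a b; rewrite addnC.
Qed.

Lemma above_filter j s : above j [seq m <- s | 0 < m] = above j s.
Proof.
by rewrite /above count_filter; apply: eq_count => m /=; case: m => // m; rewrite ltnS andbT.
Qed.

(** Optimality for all rapidly decreasing increments at once: the parameter [t], hence
    the actual increments, depends on the graph. Zero entries of [t] stand for empty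
    paths and are dropped in the uniqueness part. *)
Definition optimal_sizes (L N : nat) (t : seq nat) : Prop :=
  forall (d : nat -> R), (forall j, (0 < d j)%R) -> (forall j, (5 * d j.+1 <= d j)%R) ->
  forall s, all (ltn 0) s -> packed L s -> sumn s = N ->
  (cost d t <= cost d s)%R /\
  ((cost d s <= cost d t)%R -> perm_eq s [seq m <- t | 0 < m]).

(** As the total exceeds [L], there are at least two parts. *)
Lemma sorted_top s L N : all (ltn 0) s -> packed L s -> sumn s = N -> L < N ->
  exists n1 n2 rest, [/\ perm_eq s [:: n1, n2 & rest], n2 <= n1, 0 < n2,
    all (leq^~ n2) rest & n1 + n2 <= L].
Proof.
move=> s0 pk sN LN.
have st : perm_eq s (sort geq s) by rewrite perm_sym perm_sort.
have srt : sorted geq (sort geq s) by apply: sort_sorted => a b; exact: leq_total.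
have s0' : all (ltn 0) (sort geq s) by rewrite all_sort.
have pk' := packed_perm st pk.
have sN' : sumn (sort geq s) = N by rewrite -sN; apply: perm_sumn; rewrite perm_sort.
move: (sort geq s) st srt s0' pk' sN' => [|n1 [|n2 rest]] st srt s0' /andP[/= pk1 pk2] sN'.
- by move: LN; rewrite -sN'.
- by move: LN pk2 => /=; rewrite -sN' /= addn0 andbT ltnNge => /negbTE->.
exists n1, n2, rest; split=> //.
- by case/andP: srt.
- by case/and3P: s0'.
- move: srt => /= /andP[_]; rewrite path_sortedE => [/andP[]|x y z]; first by [].
  by rewrite /geq /= => yx zy; exact: leq_trans zy yx.
- by case/andP: pk1 => /andP[].
Qed.

Lemma optimal_of_compare L N t : L < N ->
  (forall (d : nat -> R), (forall j, (0 < d j)%R) -> (forall j, (5 * d j.+1 <= d j)%R) ->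
   forall n1 n2 rest, n2 <= n1 -> 0 < n2 -> all (ltn 0) rest -> all (leq^~ n2) rest ->
   n1 + n2 <= L -> n1 + n2 + sumn rest = N ->
   (cost d t <= cost d [:: n1, n2 & rest])%R /\
   ((cost d [:: n1, n2 & rest] <= cost d t)%R ->
      forall j, above j [:: n1, n2 & rest] = above j t)) ->
  optimal_sizes L N t.
Proof.
move=> LN h d d0 d5 s s0 pk sN.
have [n1 [n2 [rest [st n21 n20 restn n12]]]] := sorted_top s0 pk sN LN.
have := s0; rewrite (perm_all _ st) /= => /and3P[_ _ rest0].
have sN' : n1 + n2 + sumn rest = N.
  by rewrite -sN (perm_sumn st) /= addnA.
have [c1 c2] := h d d0 d5 n1 n2 rest n21 n20 rest0 restn n12 sN'.
rewrite (cost_perm d st); split=> // /c2 ab; apply: (perm_trans st).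
apply: perm_of_above; first by rewrite -(perm_all _ st).
  exact: filter_all.
by move=> j; rewrite above_filter.
Qed.

Lemma optimal_short (n l a b : nat) : 5 <= l -> l <= n -> 3 * l < 2 * n + 5 ->
  n - l + 1 = a * (l - 3)./2 + b -> b < (l - 3)./2 ->
  optimal_sizes (l - 3) (n - 2) [:: uphalf (l - 3), b & nseq a.+1 (l - 3)./2].
Proof.
move=> l5 ln lt ab bK; have LN : l - 3 < n - 2 by lia.
have a0 : 0 < a by case: a ab => // ab; lia.
have -> : uphalf (l - 3) = l - 3 - (l - 3)./2 by rewrite uphalfE; lia.
apply: optimal_of_compare => // d d0 d5 n1 n2 rest n21 n20 _ restn n12 sN.
by apply: compare_many => //; lia.
Qed.

Lemma optimal_long (n l : nat) : 5 <= l -> l <= n -> 2 * n + 5 <= 3 * l ->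
  optimal_sizes (l - 3) (n - 2) [:: 2 * l - n - 4; n - l + 1; n - l + 1].
Proof.
move=> l5 ln lt; have LN : l - 3 < n - 2 by lia.
have -> : 2 * l - n - 4 = l - 3 - (n - l + 1) by lia.
apply: optimal_of_compare => // d d0 d5 n1 n2 rest n21 n20 rest0 restn n12 sN.
by apply: compare_few => //; lia.
Qed.

End OptimalSizes.

(** * Cycles in fans *)

Section FanCycles.
Variable (G : sgraph).
Implicit Types (u v x y : G) (ps : seq (seq G)) (s c : seq G).

Lemma fan_swap u v ps : fan (@adj G) u v ps -> fan (@adj G) v u ps.
Proof.
move=> [h1 h2 h3]; split.
- by move: h1; rewrite /= !inE !negb_or eq_sym => /and3P[/andP[-> ->] -> ->].
- by move=> x; have := h2 x; rewrite !inE orbCA.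
- move=> x y; rewrite h3 /fan_rel; congr (_ && _).
  by rewrite !inE (orbC (x == v)) (orbC (y == v)).
Qed.

Definition block ps x := find (fun p => x \in p) ps.

Lemma block_linked ps x y : uniq (flatten ps) -> linked ps x y -> block ps x = block ps y.
Proof.
rewrite /block; elim: ps => //= p ps IH; rewrite cat_uniq linked_cons => /and3P[_ /hasPn dis ups].
have notp z : z \in flatten ps -> (z \in p) = false by move=> /dis/negbTE.
case/or3P => [/and3P[-> -> _]|/and3P[-> -> _]|xy] //.
by have /andP[/notp -> /notp ->] := linked_mem xy; rewrite (IH ups xy).
Qed.

Lemma mem_block ps x : x \in flatten ps -> x \in nth [::] ps (block ps x) /\ block ps x < size ps.
Proof.
move=> /flattenP xP; have hx : has (fun p => x \in p) ps by apply/hasP; case: xP => p; exists p.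
by split; [exact: (nth_find [::] hx) | rewrite -has_find].
Qed.

Lemma same_block_size ps s i : uniq s -> {subset s <= flatten ps} ->
  all (fun x => block ps x == i) s -> size s <= nth 0 (map size ps) i.
Proof.
case: s => // x s us sF /allP si.
have ilt : i < size ps.
  by have /eqP <- := si x (mem_head _ _); have [] := mem_block (sF x (mem_head _ _)).
rewrite (nth_map [::]) //; apply: uniq_leq_size us _ => y ys.
by have /eqP <- := si y ys; have [] := mem_block (sF y ys).
Qed.

Lemma segment_block u v ps x s : fan (@adj G) u v ps -> path (@adj G) x s ->
  u \notin x :: s -> v \notin x :: s ->
  all (fun y => block ps y == block ps x) (x :: s) /\ {subset x :: s <= flatten ps}.
Proof.
move=> [/= /and3P[_ _ uF] all_in eG]; elim: s x => [|y s IH] x /=.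
  move=> _; rewrite eqxx !inE => ux vx; split=> // z; rewrite inE => /eqP->.
  by have := all_in x; rewrite !inE ![x == _]eq_sym (negbTE ux) (negbTE vx).
move=> /andP[xy ys]; rewrite !(in_cons x).
move=> /norP[ux uys] /norP[vx vys]; have [b1 b2] := IH y ys uys vys.
have xF : x \in flatten ps.
  by have := all_in x; rewrite !inE ![x == _]eq_sym (negbTE ux) (negbTE vx).
split; last by move=> z; rewrite in_cons => /orP[/eqP->|/b2].
have /and3P[_ _] : [&& x != y, true & linked ps x y].
  move: xy; rewrite eG /fan_rel !inE ![x == _]eq_sym (negbTE ux) (negbTE vx) /=.
  move: uys vys; rewrite !inE !negb_or ![_ == y]eq_sym => /andP[/negbTE-> _] /andP[/negbTE-> _] /=.
  by rewrite [y == x]eq_sym.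
by move=> /(block_linked uF) ->; apply/andP; split; [exact: eqxx|exact: b1].
Qed.

(** Paths of the fan avoiding both ends stay inside one block; two of them lie in one
    block or in two blocks, and either way the packing condition applies. *)
Lemma two_segments L ps s1 s2 i1 i2 : packed L (map size ps) -> uniq (s1 ++ s2) ->
  {subset s1 ++ s2 <= flatten ps} ->
  all (fun x => block ps x == i1) s1 -> all (fun x => block ps x == i2) s2 ->
  size s1 + size s2 <= L.
Proof.
move=> /andP[/(pairwiseP 0) pw /allP le] us sF b1 b2.
have leL i : nth 0 (map size ps) i <= L.
  case: (ltnP i (size (map size ps))) => ilt; first by apply: le; rewrite mem_nth.
  by rewrite nth_default.
case: (eqVneq i1 i2) => [ii|ii].
  rewrite -size_cat; apply: leq_trans (leL i1); apply: (same_block_size us sF).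
  by rewrite all_cat b1 ii b2.
have := us; rewrite cat_uniq => /and3P[u1 _ u2].
have h1 : size s1 <= nth 0 (map size ps) i1.
  by apply: same_block_size => // x xs; apply: sF; rewrite mem_cat xs.
have h2 : size s2 <= nth 0 (map size ps) i2.
  by apply: same_block_size => // x xs; apply: sF; rewrite mem_cat xs orbT.
apply: leq_trans (leq_add h1 h2) _.
case: (ltnP i1 (size (map size ps))) => l1; last by rewrite (nth_default _ l1) add0n.
case: (ltnP i2 (size (map size ps))) => l2; last by rewrite (nth_default _ l2) addn0.
by move: ii; rewrite neq_ltn => /orP[] h; [|rewrite addnC]; apply: pw.
Qed.

Lemma fan_segment L u v ps s : fan (@adj G) u v ps -> packed L (map size ps) -> uniq s ->
  sorted (@adj G) s -> u \notin s -> v \notin s -> size s <= L.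
Proof.
case: s => // x s fG pk us srt uxs vxs; have [b1 b2] := segment_block fG srt uxs vxs.
have := @two_segments L ps (x :: s) [::] (block ps x) 0 pk.
by rewrite cats0 addn0; apply.
Qed.

Lemma fan_cycle_through L u v ps c : fan (@adj G) u v ps -> packed L (map size ps) ->
  ucycle (@adj G) c -> u \in c -> size c <= L + 2.
Proof.
move=> fG pk cyc uc; have [i s rotE] := rot_to uc.
have {cyc} : ucycle (@adj G) (u :: s) by rewrite -rotE rot_ucycle.
rewrite -(size_rot i c) rotE => /andP[cyc /= /andP[us un]].
have srt : sorted (@adj G) s.
  by move: cyc; rewrite /= rcons_path => /andP[/path_sorted].
case: (boolP (v \in s)) => vs; last first.
  by rewrite addn2 ltnS ltnW // ltnS; apply: (fan_segment fG).
case/splitPr: vs us un srt => s1 s2; rewrite mem_cat inE !negb_or => /and3P[us1 uv us2].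
rewrite cat_uniq /= => /and3P[un1 /norP[vs1 dis] /andP[vs2 un2]] srt.
have srt1 : sorted (@adj G) s1 by move: srt => /cat_sorted2[].
have srt2 : sorted (@adj G) s2 by move: srt => /cat_sorted2[_ /path_sorted].
have un12 : uniq (s1 ++ s2) by rewrite cat_uniq un1 un2 dis.
rewrite size_cat /= !addnS addn0 !ltnS.
case: s1 us1 un1 vs1 dis srt1 un12 {srt} => [|x s1] us1 un1 vs1 dis srt1 un12.
  by rewrite add0n; apply: (fan_segment fG).
case: s2 us2 un2 vs2 dis srt2 un12 => [|y s2] us2 un2 vs2 dis srt2 un12.
  by rewrite addn0; apply: (fan_segment fG).
have [b1 f1] := segment_block fG srt1 us1 vs1; have [b2 f2] := segment_block fG srt2 us2 vs2.
apply: (two_segments pk un12 _ b1 b2) => z; rewrite mem_cat => /orP[/f1|/f2]; by [].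
Qed.

(** A cycle minus the vertices [u] and [v] consists of at most two segments, of total
    size at most [L]. *)
Theorem fan_cycle_free L l u v ps : fan (@adj G) u v ps -> packed L (map size ps) ->
  L + 2 < l -> cycle_free l G.
Proof.
move=> fG pk Ll c cl cyc; move: Ll; rewrite -cl; apply/negP; rewrite -leqNgt.
case: (boolP (u \in c)) => uc; first exact: (fan_cycle_through fG).
case: (boolP (v \in c)) => vc; first exact: (fan_cycle_through (fan_swap fG)).
apply: leq_trans (leq_addr _ _); move: cyc => /andP[cyc un]; apply: (fan_segment fG) => //.
by case: (c) cyc => //= x s; rewrite rcons_path => /andP[].
Qed.

End FanCycles.

Section LinearForests.

Definition linear_forest (G : sgraph) (ps : seq (seq G)) : Prop :=
  [/\ uniq (flatten ps), forall x, x \in flatten ps & @adj G =2 linked ps].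

Lemma linked_cat (V : eqType) (ps qs : seq (seq V)) x y :
  linked (ps ++ qs) x y = linked ps x y || linked qs x y.
Proof. exact: has_cat. Qed.

Lemma linked_map (V W : eqType) (f : V -> W) (ps : seq (seq V)) x y : injective f ->
  linked (map (map f) ps) (f x) (f y) = linked ps x y.
Proof.
move=> fi; rewrite /linked has_map; apply: eq_has => p /=.
by rewrite /consecutive !mem_map // !index_map.
Qed.

Lemma linked_map_out (V W : eqType) (f : V -> W) (ps : seq (seq V)) a b :
  (forall x, f x != a) -> linked (map (map f) ps) a b = false.
Proof.
move=> out; apply/negP => /linked_mem/andP[/flattenP[p /mapP[q _ ->] /mapP[x _ aE]] _].
by have := out x; rewrite aE eqxx.
Qed.

Lemma path_linear n : linear_forest (G := path_graph n) [:: enum 'I_n].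
Proof.
split; rewrite /= ?cats0; first exact: enum_uniq.
  by move=> x; rewrite mem_enum.
move=> x y; rewrite linked_cons orbF /consecutive !mem_enum !index_enum_ord /=.
by rewrite /path_rel eq_sym orbC eq_sym orbC.
Qed.

Lemma union_linear G H ps qs : linear_forest (G := G) ps -> linear_forest (G := H) qs ->
  linear_forest (G := disjoint_union G H) (map (map inl) ps ++ map (map inr) qs).
Proof.
move=> [u1 a1 e1] [u2 a2 e2]; rewrite /linear_forest flatten_cat -!map_flatten; split.
- rewrite cat_uniq !map_inj_uniq ?u1 ?u2 ?andbT /=; try by move=> a b [].
  by apply/hasPn => z /mapP[x _ ->]; apply/mapP => -[].
- by move=> [x|x]; rewrite mem_cat; [rewrite map_f|rewrite (map_f inr) ?orbT].
move=> [x|x] [y|y] /=; rewrite linked_cat.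
- by rewrite linked_map ?e1 1?[X in _ || X]linked_map_out ?orbF // => a b [].
- by rewrite 1?[X in _ || X]linked_map_out // orbF linked_sym linked_map_out.
- by rewrite linked_map_out //= linked_sym linked_map_out.
- by rewrite linked_map_out //= linked_map ?e2 // => a b [].
Qed.

Lemma copies_linear t G ps : linear_forest (G := G) ps ->
  linear_forest (G := copies t G) [seq map (pair i) p | i <- enum 'I_t, p <- ps].
Proof.
move=> [u a e].
have fE (I : seq 'I_t) : flatten [seq map (pair i) p | i <- I, p <- ps]
    = [seq (i, x) | i <- I, x <- flatten ps].
  elim: I => //= i I IH; rewrite flatten_cat IH; congr (_ ++ _).
  by rewrite -(map_flatten (pair i)).
split; rewrite ?fE.
- apply: allpairs_uniq => //; first exact: enum_uniq.
  by move=> [? ?] [? ?] _ _.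
- by move=> [i x]; apply/allpairsP; exists (i, x); rewrite mem_enum.
have lE (I : seq 'I_t) i x j y :
    linked [seq map (pair i) p | i <- I, p <- ps] (i, x) (j, y)
    = [&& i \in I, i == j & linked ps x y].
  elim: I => [|k I IH] //=; rewrite linked_cat IH inE.
  rewrite -[X in linked X]/(map (map (pair k)) ps).
  case: (eqVneq i k) => [->|ik] /=; last first.
    by rewrite linked_map_out // => z; apply: contra ik => /eqP[->].
  case: (eqVneq k j) => [->|kj] /=; last first.
    by rewrite andbF orbF linked_sym linked_map_out // => z; apply: contra kj => /eqP[->].
  by rewrite linked_map => [|? ? []//]; case: (linked ps x y); rewrite ?andbF.
by move=> [i x] [j y]; rewrite lE mem_enum /= /copies_rel e.
Qed.

Lemma join_fan H ps : linear_forest (G := H) ps ->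
  fan (@adj (graph_join (complete_graph 2) H)) (inl ord0) (inl ord_max) (map (map inr) ps).
Proof.
move=> [u a e]; have inr_inj : injective (@inr 'I_2 H) by move=> ? ? [].
split; rewrite /= -?map_flatten.
- rewrite map_inj_uniq // u andbT; apply/andP; split.
    by rewrite inE; apply/negP => /orP[//|/mapP[]].
  by apply/negP => /mapP[].
- move=> [x|x]; rewrite !inE; last by rewrite map_f ?orbT.
  by case: x => [[|[|//]]] h.
- case: (pickP (fun _ : 'I_2 => true)) => [k _|/(_ ord0)] // [x|x] [y|y]; rewrite /fan_rel /=.
  + rewrite /complete_rel; case: (eqVneq x y) => [->|xy]; first by rewrite eqxx.
    rewrite (_ : inl x != inl y); last by apply: contra xy => /eqP[->].
    by rewrite !inE; case: x {xy} => [[|[|//]]].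
  + by rewrite !inE; case: x => [[|[|//]]].
  + by rewrite !inE; case: y => [[|[|//]]]; rewrite ?orbT.
  + rewrite e linked_map //; case: (eqVneq x y) => [<-|xy]; rewrite ?eqxx /=.
      by rewrite -e adj_irrefl.
    by rewrite (_ : inr x != inr y) //; apply: contra xy => /eqP[->].
Qed.

End LinearForests.

(** * Straight-line drawings of fans *)

Section FanDrawing.
Local Open Scope classical_set_scope.
Local Open Scope ring_scope.
Variable R : realType.

Definition line (p q : R * R) (s : R) : R * R :=
  ((1 - s) * p.1 + s * q.1, (1 - s) * p.2 + s * q.2).

Definition segment (p q : R * R) : set (R * R) := line p q @` `[0, 1].

Lemma segment_arc p q : p != q -> arc_between p q (segment p q).
Proof.
move=> pq; exists (line p q); split=> //.
- apply: continuous_subspaceT => s.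
  have lin (a b : R) : (fun s : R => (1 - s) * a + s * b) @ s --> (1 - s) * a + s * b.
    apply: cvgD; apply: cvgM; try exact: cvg_cst; try exact: cvg_id.
    by apply: cvgB; [exact: cvg_cst|exact: cvg_id].
  exact: (cvg_pair (lin p.1 q.1) (lin p.2 q.2)).
- move=> s s' _ _ [/eqP h1 /eqP h2]; apply/eqP; rewrite -subr_eq0; apply/negP => /negP ss.
  move/negP: pq; apply; apply/eqP.
  have k (a b : R) : (1 - s) * a + s * b == (1 - s') * a + s' * b -> a = b.
    move=> /eqP h; apply/eqP; rewrite eq_sym -subr_eq0; apply/eqP.
    by apply: (mulfI ss); rewrite mulr0; lra.
  by case: p q h1 h2 => [a b] [a' b'] /= /k -> /k ->.
- by rewrite /line; case: p {pq} => a b; congr (_, _) => /=; ring.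
- by rewrite /line; case: q {pq} => a b; congr (_, _) => /=; ring.
Qed.

Lemma segment_sym p q : segment p q = segment q p.
Proof.
rewrite /segment; apply/seteqP; split => P [s /= s01 <-]; exists (1 - s);
  rewrite /= ?in_itv /=; move: s01; rewrite ?in_itv /= => /andP[h1 h2];
  try (apply/andP; split; lra); by rewrite /line; congr (_, _); ring.
Qed.

Variables (G : sgraph) (u v : G) (ps : seq (seq G)).
Hypothesis fanG : fan (@adj G) u v ps.

Let F := flatten ps.
Let h (w : G) : R := (index w F).+1%:R.

(** The path vertices are put on the positive half of the first axis in the order of the
    concatenated paths, and the ends at height [1] and [-1] above and below the origin;
    all edges are straight. *)
Definition fan_position (x : G) : R * R :=
  if x == u then (0, 1) else if x == v then (0, -1) else (h x, 0).

Let uv : (v == u) = false.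
Proof. by case: fanG => /=; rewrite inE negb_or eq_sym => /andP[/andP[/negbTE]]. Qed.

Let inner w : w \in F -> (w == u) = false /\ (w == v) = false.
Proof.
case: fanG => /= /and3P[+ vF _] _ _ wF; rewrite !inE negb_or => /andP[_ uF].
by split; apply/negP => /eqP wE; move: uF vF; rewrite -wE wF.
Qed.

Let posu : fan_position u = (0, 1). Proof. by rewrite /fan_position eqxx. Qed.
Let posv : fan_position v = (0, -1). Proof. by rewrite /fan_position uv eqxx. Qed.
Let posw w : w \in F -> fan_position w = (h w, 0).
Proof. by move=> /inner[wu wv]; rewrite /fan_position wu wv. Qed.

Let vertexP x : [\/ x = u, x = v | x \in F].
Proof.
case: fanG => _ /(_ x) + _; rewrite !inE => /or3P[/eqP->|/eqP->|xF];
  [exact: Or31|exact: Or32|exact: Or33].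
Qed.

Let h_ge1 w : 1 <= h w. Proof. by rewrite /h ler1n. Qed.

Let h_inj w w' : w \in F -> w' \in F -> h w = h w' -> w = w'.
Proof.
move=> wF wF' /eqP; rewrite /h eqr_nat eqSS => /eqP e.
by rewrite -(nth_index w wF) e nth_index.
Qed.

Let h_sep w w' : h w < h w' -> h w + 1 <= h w'.
Proof. by rewrite /h natr1 ltr_nat ler_nat. Qed.

Let same_ends (x y a b : G) : Prop := (x = a /\ y = b) \/ (x = b /\ y = a).

Let on_edge x y (P : R * R) : Prop :=
  [\/ same_ends x y u v /\ P.1 = 0,
      exists2 w, w \in F & [/\ same_ends x y u w, 0 <= P.2 & P.1 = h w * (1 - P.2)],
      exists2 w, w \in F & [/\ same_ends x y v w, P.2 <= 0 & P.1 = h w * (1 + P.2)]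
    | exists w w', [/\ w \in F, w' \in F & [/\ same_ends x y w w', h w' = h w + 1,
         P.2 = 0, h w <= P.1 & P.1 <= h w + 1]]].

Let on_edge_sym x y P : on_edge x y P -> on_edge y x P.
Proof.
have ss a b : same_ends x y a b -> same_ends y x a b.
  by case=> -[-> ->]; [right|left].
case=> [[/ss s0 p]|[w wF [/ss s0 p q]]|[w wF [/ss s0 p q]]|[w [w' [wF wF' [/ss s0 e p q r]]]]].
- exact: Or41.
- by apply: Or42; exists w.
- by apply: Or43; exists w.
- by apply: Or44; exists w, w'.
Qed.

Let on_edgeP x y P : adj x y -> segment (fan_position x) (fan_position y) P -> on_edge x y P.
Proof.
have half a b Q : same_ends a b u v \/ (a = u /\ b \in F) \/ (a = v /\ b \in F)
    \/ [/\ a \in F, b \in F & h b = h a + 1] ->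
    segment (fan_position a) (fan_position b) Q -> on_edge a b Q.
  move=> cases [s /=]; rewrite in_itv /= => /andP[s0 s1] <-.
  case: cases => [se|[[-> bF]|[[-> bF]|[aF bF e]]]].
  - apply: Or41; split=> //.
    by case: se => -[-> ->]; rewrite posu posv /line /=; ring.
  - apply: Or42; exists b => //; rewrite posu (posw bF) /line /=; split; [by left|lra|lra].
  - apply: Or43; exists b => //; rewrite posv (posw bF) /line /=; split; [by left|lra|lra].
  - apply: Or44; exists a, b; rewrite (posw aF) (posw bF) e /line /=; split=> //.
    split; [by left|by []|ring|lra|lra].
move=> xy; have xney : x != y by apply: contraTneq xy => ->; rewrite adj_irrefl.
have [_ _ eG] := fanG.
case: (vertexP x) (vertexP y) xney => [xu|xv|xF] [yu|yv|yF] xney.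
- by move: xney; rewrite xu yu eqxx.
- by apply: half; left; left.
- by apply: half; right; left.
- by apply: half; left; right.
- by move: xney; rewrite xv yv eqxx.
- by apply: half; right; right; left.
- by rewrite segment_sym => /half hh; apply: on_edge_sym; apply: hh; right; left.
- by rewrite segment_sym => /half hh; apply: on_edge_sym; apply: hh; right; right; left.
have lnk : linked ps x y.
  by move: xy; rewrite eG /fan_rel !inE; have [-> ->] := inner xF; have [-> ->] := inner yF;
    rewrite /= => /andP[].
have uF : uniq F by case: fanG => /= /and3P[].
have suc a b : index b F = (index a F).+1 -> h b = h a + 1 by rewrite /h => ->; rewrite natr1.
case: (linked_index uF lnk) => /suc e.
  by apply: half; right; right; right.
by rewrite segment_sym => /half hh; apply: on_edge_sym; apply: hh; right; right; right.
Qed.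

Let edges_meet x y x' y' P : on_edge x y P -> on_edge x' y' P ->
  [\/ (x, y) = (x', y'), (x, y) = (y', x') | exists z, fan_position z = P].
Proof.
have same a b : same_ends x y a b -> same_ends x' y' a b ->
    [\/ (x, y) = (x', y'), (x, y) = (y', x') | exists z, fan_position z = P].
  by case=> -[-> ->]; case=> -[-> ->]; [exact: Or31|exact: Or32|exact: Or32|exact: Or31].
have atu : P.1 = 0 -> P.2 = 1 -> exists z, fan_position z = P.
  by move=> p1 p2; exists u; rewrite posu; case: P p1 p2 {same} => a b /= -> ->.
have atv : P.1 = 0 -> P.2 = -1 -> exists z, fan_position z = P.
  by move=> p1 p2; exists v; rewrite posv; case: P p1 p2 {same atu} => a b /= -> ->.
have atw w : w \in F -> P.1 = h w -> P.2 = 0 -> exists z, fan_position z = P.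
  by move=> wF p1 p2; exists w; rewrite posw //; case: P p1 p2 {same atu atv} => a b /= -> ->.
have zero_prod w q : 0 = h w * q -> q = 0.
  move=> /esym/eqP; rewrite mulf_eq0 => /orP[/eqP h0|/eqP //].
  by have := h_ge1 w; rewrite h0; lra.
have same_prod w w' q : w \in F -> w' \in F -> h w * q = h w' * q -> q = 0 \/ w = w'.
  move=> wF wF' /eqP; rewrite -subr_eq0 -mulrBl mulf_eq0 => /orP[|/eqP]; last by left.
  by rewrite subr_eq0 => /eqP /h_inj ww; right; apply: ww.
case=> [[s1 p1]|[w wF [s1 p1 q1]]|[w wF [s1 p1 q1]]|[w [w1 [wF wF1 [s1 e1 p1 q1 r1]]]]];
case=> [[s2 p2]|[w' wF' [s2 p2 q2]]|[w' wF' [s2 p2 q2]]|[w' [w2 [wF' wF2 [s2 e2 p2 q2 r2]]]]].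
- exact: same s1 s2.
- apply: Or33; apply: atu => //; have := zero_prod w' (1 - P.2); rewrite -q2 p1 => /(_ erefl); lra.
- apply: Or33; apply: atv => //; have := zero_prod w' (1 + P.2); rewrite -q2 p1 => /(_ erefl); lra.
- by have := h_ge1 w'; lra.
- apply: Or33; apply: atu => //; have := zero_prod w (1 - P.2); rewrite -q1 p2 => /(_ erefl); lra.
- have [q0|ww] := same_prod w w' (1 - P.2) wF wF' (etrans (esym q1) q2).
    by apply: Or33; apply: atu; [rewrite q1 q0 mulr0|lra].
  by rewrite ww in s1; exact: same s1 s2.
- have p0 : P.2 = 0 by lra.
  by apply: Or33; apply: (atw w) => //; rewrite q1 p0; ring.
- by apply: Or33; apply: (atw w) => //; rewrite q1 p2; ring.
- apply: Or33; apply: atv => //; have := zero_prod w (1 + P.2); rewrite -q1 p2 => /(_ erefl); lra.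
- have p0 : P.2 = 0 by lra.
  by apply: Or33; apply: (atw w) => //; rewrite q1 p0; ring.
- have [q0|ww] := same_prod w w' (1 + P.2) wF wF' (etrans (esym q1) q2).
    by apply: Or33; apply: atv; [rewrite q1 q0 mulr0|lra].
  by rewrite ww in s1; exact: same s1 s2.
- by apply: Or33; apply: (atw w) => //; rewrite q1 p2; ring.
- by have := h_ge1 w; lra.
- by apply: Or33; apply: (atw w') => //; rewrite q2 p1; ring.
- by apply: Or33; apply: (atw w') => //; rewrite q2 p1; ring.
- case: (ltrgtP (h w) (h w')) => hh.
  + by apply: Or33; apply: (atw w') => //; have := h_sep hh; lra.
  + by apply: Or33; apply: (atw w) => //; have := h_sep hh; lra.
  + have ww := h_inj wF wF' hh; have ww1 : w1 = w2 by apply: h_inj => //; rewrite e1 e2 hh.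
    by rewrite ww ww1 in s1; exact: same s1 s2.
Qed.

Let vertex_on_edge x y z : on_edge x y (fan_position z) -> z = x \/ z = y.
Proof.
have pick a b : same_ends x y a b -> z = a \/ z = b -> z = x \/ z = y.
  by case=> -[-> ->] [] ->; auto.
case: (vertexP z) => [zu|zv|zF].
- have -> : fan_position z = (0, 1) by rewrite zu posu.
  case=> [[s1 /= p1]|[w wF [s1 /= p1 q1]]|[w wF [s1 /= p1 q1]]|[w [w1 [wF wF1 [s1 e1 /= p1 q1 r1]]]]].
  + by apply: pick s1 _; left.
  + by apply: pick s1 _; left.
  + by exfalso; clear zu; lra.
  + by exfalso; clear zu; lra.
- have -> : fan_position z = (0, -1) by rewrite zv posv.
  case=> [[s1 /= p1]|[w wF [s1 /= p1 q1]]|[w wF [s1 /= p1 q1]]|[w [w1 [wF wF1 [s1 e1 /= p1 q1 r1]]]]].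
  + by apply: pick s1 _; right.
  + by exfalso; clear zv; lra.
  + by apply: pick s1 _; left.
  + by exfalso; clear zv; lra.
rewrite posw //=.
case=> [[s1 /= p1]|[w wF [s1 /= p1 q1]]|[w wF [s1 /= p1 q1]]|[w [w1 [wF wF1 [s1 e1 /= p1 q1 r1]]]]].
- by exfalso; have := h_ge1 z; lra.
- by apply: pick s1 _; right; apply: h_inj => //; lra.
- by apply: pick s1 _; right; apply: h_inj => //; lra.
apply: pick s1 _; case: (ltrgtP (h w) (h z)) => hh.
- by right; apply: h_inj => //; have := h_sep hh; lra.
- by exfalso; lra.
- by left; apply: h_inj.
Qed.

(** The open segments to [u] lie in the upper half plane, those to [v] in the lower one,
    path edges on the axis to the right of the origin, and the edge [u v] on the second
    axis. *)
Theorem fan_planar : planar R G.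
Proof.
have pinj : injective fan_position.
  move=> x y; case: (vertexP x) => [->|->|xF]; case: (vertexP y) => [->|->|yF] //;
    rewrite ?posu ?posv ?(posw xF) ?(posw yF) => -[] //.
  - by move=> e; exfalso; lra.
  - by move=> e e'; exfalso; lra.
  - by move=> e; exfalso; lra.
  - by move=> e e'; exfalso; lra.
  - by move=> e e'; exfalso; lra.
  - by move=> e e'; exfalso; lra.
  - by move=> /h_inj; apply.
exists fan_position, (fun x y => segment (fan_position x) (fan_position y)); split=> //.
- by move=> x y _; exact: segment_sym.
- move=> x y xy; apply: segment_arc; rewrite (inj_eq pinj).
  by apply: contraTneq xy => ->; rewrite adj_irrefl.
- by move=> x y z xy /(on_edgeP xy) /vertex_on_edge.
- move=> x y x' y' xy xy' n1 n2 P [/(on_edgeP xy) o1 /(on_edgeP xy') o2].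
  by case: (edges_meet o1 o2) => // -[z <-]; exists z.
Qed.

End FanDrawing.

(** * Paths and cycles among common neighbours *)

Section CommonNeighbours.
Variables (G : sgraph) (u v : G).
Implicit Types (p q : seq G) (ps : seq (seq G)).

Definition joined (x : G) : bool := adj u x && adj v x.

(** The cycle runs through [u], the first path, [v] and the second path. *)
Lemma cycle_of_paths l p q : cycle_free l G -> u != v -> uniq (p ++ q) ->
  all joined (p ++ q) -> sorted (@adj G) p -> sorted (@adj G) q ->
  p != [::] -> q != [::] -> size p + size q + 2 != l.
Proof.
move=> free uv un; rewrite all_cat => /andP[/allP jp /allP jq] sp sq p0 q0.
apply/eqP => szl; apply: (free (u :: p ++ v :: q)).
  by rewrite /= size_cat /= addnS -szl addn2.
have notin w r : (forall x, x \in r -> adj w x) -> w \notin r.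
  by move=> h; apply/negP => /h; rewrite adj_irrefl.
have up x : x \in p -> adj u x by move=> /jp/andP[].
have vp x : x \in p -> adj v x by move=> /jp/andP[].
have uq x : x \in q -> adj u x by move=> /jq/andP[].
have vq x : x \in q -> adj v x by move=> /jq/andP[].
apply/andP; split; last first.
  rewrite /= mem_cat inE !negb_or uv !notin // cat_uniq /= notin // negb_or notin //=.
  by move: un; rewrite cat_uniq => /and3P[-> -> ->].
case: p p0 sp up vp {jp un szl} => // x p _ sp up vp.
case: q q0 sq uq vq {jq} => // y q _ sq uq vq.
rewrite /= in sp sq; rewrite /= rcons_cat cat_path /= up ?mem_head // sp /=.
rewrite adj_sym vp ?mem_last //= vq ?mem_head //= rcons_path sq /=.
by rewrite adj_sym uq // mem_last.
Qed.

(** If the total were at least [l - 2], the two paths could be truncated to total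
    exactly [l - 2]. *)
Lemma two_paths_bound l p q : cycle_free l G -> 5 <= l -> u != v -> uniq (p ++ q) ->
  all joined (p ++ q) -> sorted (@adj G) p -> sorted (@adj G) q ->
  p != [::] -> q != [::] -> size p + size q <= l - 3.
Proof.
move=> free l5 uv un jn sp sq; rewrite -!size_eq0 -!lt0n => p0 q0.
rewrite leqNgt; apply/negP => big.
(* Lengths of the truncations; the bound [l - 3] leaves at least one vertex for the
   second path. *)
pose i := minn (size p) (l - 3); pose j := l - 2 - i.
have [i0 ip il] : [/\ 0 < i, i <= size p & i <= l - 3].
  by rewrite /i leq_min p0 geq_minl geq_minr subn_gt0 (leq_trans _ l5).
have [j0 jq] : 0 < j /\ j <= size q.
  rewrite /j; split; first by lia.
  rewrite /i; case: (leqP (size p) (l - 3)) => h.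
    by rewrite leq_subLR (_ : l - 2 = (l - 3).+1) //; lia.
  by apply: leq_trans q0; lia.
have ij : i + j + 2 = l by rewrite /j; lia.
have szp : size (take i p) = i by rewrite size_takel.
have szq : size (take j q) = j by rewrite size_takel.
have sub : subseq (take i p ++ take j q) (p ++ q).
  by apply: cat_subseq; exact: take_subseq.
have := @cycle_of_paths l (take i p) (take j q) free uv (subseq_uniq sub un).
rewrite szp szq ij eqxx => h; suff: false by [].
apply: h; rewrite -?size_eq0 ?szp ?szq -?lt0n //; try exact: take_sorted.
by apply/allP => x /(mem_subseq sub); exact: (allP jn).
Qed.

Lemma one_path_bound l p : cycle_free l G -> 5 <= l -> u != v -> uniq p ->
  all joined p -> sorted (@adj G) p -> size p <= l - 3.
Proof.
move=> free l5 uv un jn sp; rewrite leqNgt; apply/negP => big.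
have := @two_paths_bound l (take 1 p) (drop 1 p) free l5 uv; rewrite cat_take_drop => h.
have : size (take 1 p) + size (drop 1 p) <= l - 3.
  apply: h => //; [exact: take_sorted|exact: drop_sorted|by case: (p) big|].
  by rewrite -size_eq0 size_drop -lt0n subn_gt0; apply: leq_trans big; rewrite ltnS subn_gt0 (leq_trans _ l5).
by rewrite -size_cat cat_take_drop leqNgt big.
Qed.

Lemma paths_packed l ps : cycle_free l G -> 5 <= l -> u != v -> uniq (flatten ps) ->
  all joined (flatten ps) -> all (sorted (@adj G)) ps -> [::] \notin ps ->
  packed (l - 3) (map size ps).
Proof.
move=> free l5 uv; elim: ps => // p ps IH; rewrite [flatten _]/= cat_uniq all_cat inE negb_or.
move=> /and3P[up /hasPn dis ups] /andP[jp jps] /andP[sp sps] /andP[p0 ps0].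
have /andP[pk1 pk2] := IH ups jps sps ps0.
rewrite /packed /= pk1 pk2 one_path_bound // !andbT.
apply/allP => m /mapP[q qps ->].
have qF x : x \in q -> x \in flatten ps by move=> xq; apply/flattenP; exists q.
have uq : uniq q.
  case/splitPr: qps ups {dis jps sps ps0 IH pk1 pk2 qF} => s1 s2.
  by rewrite flatten_cat /= !cat_uniq => /and3P[_ _ /andP[]].
apply: two_paths_bound => //.
- rewrite cat_uniq up uq andbT /=; apply/hasPn => x /qF; exact: dis.
- by rewrite all_cat jp; apply/allP => x /qF; exact: (allP jps).
- exact: (allP sps).
- by rewrite eq_sym.
- by apply: contraNneq ps0 => <-.
Qed.

End CommonNeighbours.

Section PathsAndCycles.
Variables (V : finType) (e : rel V).
Hypotheses (es : symmetric e) (ei : irreflexive e).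
Implicit Types (A : {set V}) (p c : seq V) (ps : seq (seq V)).

Definition path_cover A ps : Prop :=
  [/\ uniq (flatten ps), flatten ps =i A, {in A &, e =2 linked ps},
      all (sorted e) ps & [::] \notin ps].

Lemma longest_path A : A != set0 -> exists p, [/\ uniq p, sorted e p, p != [::], {subset p <= A}
  & forall q, uniq q -> sorted e q -> {subset q <= A} -> size q <= size p].
Proof.
move=> /set0Pn[x0 x0A].
pose P n := [exists t : n.-tuple V, [&& uniq t, sorted e t & all (mem A) t]].
have P1 : P 1 by apply/existsP; exists [tuple x0]; rewrite /= andbT.
have Pb n : P n -> n <= #|A|.
  move=> /existsP[t /and3P[ut _ /allP tA]]; rewrite -(size_tuple t) -(card_uniqP ut).
  by apply/subset_leq_card/subsetP.
case: (ex_maxnP (ex_intro P 1 P1) Pb) => m /existsP[t /and3P[ut st /allP tA]] max.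
exists t; split=> //.
  by rewrite -size_eq0 size_tuple -lt0n; exact: max.
move=> q uq sq qA; rewrite size_tuple; apply: max; apply/existsP; exists (in_tuple q).
by rewrite uq sq; apply/allP.
Qed.

Lemma third_neighbour A x y z w : deg e A x <= 2 -> y \in A -> z \in A -> w \in A ->
  e x y -> e x z -> e x w -> y != z -> w = y \/ w = z.
Proof.
move=> d yA zA wA xy xz xw yz; case: (eqVneq w y) => [->|wy]; first by left.
case: (eqVneq w z) => [->|wz]; first by right.
move: d; rewrite leqNgt => /negP[]; apply/card_gt2P; exists y, z, w.
by rewrite !mem_nbrs yA zA wA xy xz xw yz eq_sym wz wy.
Qed.

(** If all degrees are at most two, a longest path is an entire component unless its
    ends are adjacent. *)
Lemma longest_path_component A p : (forall x, x \in A -> deg e A x <= 2) ->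
  uniq p -> sorted e p -> {subset p <= A} ->
  (forall q, uniq q -> sorted e q -> {subset q <= A} -> size q <= size p) ->
  (ucycle e p /\ 2 < size p) \/
  [/\ forall x y, x \in p -> y \in A -> y \notin p -> ~~ e x y
    & {in p &, forall x y, e x y = consecutive p x y || consecutive p y x}].
Proof.
case: p => [|z p'] dA up sp pA max; first by right; split.
set p := z :: p' in up sp pA max *; set m := size p in max *.
have nthA i : i < m -> nth z p i \in A by move=> im; apply: pA; exact: mem_nth.
have step i : i.+1 < m -> e (nth z p i) (nth z p i.+1).
  by move=> im; apply: (pathP z sp i).
have interior i y : 0 < i -> i.+1 < m -> y \in A -> e (nth z p i) y ->
    y = nth z p i.-1 \/ y = nth z p i.+1.
  move=> i0 im yA iy; apply: (@third_neighbour A (nth z p i)) => //.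
  - by apply: dA; apply: nthA; exact: ltnW.
  - by apply: nthA; rewrite (leq_ltn_trans (leq_pred i)) // ltnW.
  - exact: nthA.
  - by rewrite es -{2}(prednK i0); apply: step; rewrite prednK // ltnW.
  - exact: step.
  - rewrite nth_uniq //; first by rewrite ltn_eqF // prednK.
    by rewrite (leq_ltn_trans (leq_pred i)) // ltnW.
have first_nbr y : y \in A -> e (nth z p 0) y -> y \in p.
  move=> yA zy; apply: contraT => yp; have := max (y :: p).
  rewrite /= -/p ltnn => h; suff: false by []; apply: h.
  - by apply/andP; split; [exact: yp|exact: up].
  - by rewrite es zy.
  - by move=> x; rewrite inE => /orP[/eqP->|/pA].
have last_nbr y : y \in A -> e (last z p') y -> y \in p.
  move=> yA zy; apply: contraT => yp; have := max (rcons p y).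
  rewrite size_rcons ltnn => h; suff: false by []; apply: h.
  - by rewrite rcons_uniq yp.
  - by rewrite /= rcons_path zy andbT.
  - by move=> x; rewrite mem_rcons inE => /orP[/eqP->|/pA].
have lastE : last z p' = nth z p m.-1 by rewrite (last_nth z).
have out x y : x \in p -> y \in A -> y \notin p -> ~~ e x y.
  move=> xp yA yp; apply: contra yp => xy.
  have im : index x p < m by rewrite index_mem.
  move: xy; rewrite -(nth_index z xp); move: (index x p) im => i im iy.
  case: (posnP i) => [i0|i0]; first by apply: first_nbr; rewrite -?i0.
  have [im'|im'] := ltnP i.+1 m; last first.
    by apply: last_nbr => //; rewrite lastE (_ : m.-1 = i) //; lia.
  by case: (interior i y) => // ->; apply: mem_nth; rewrite // (leq_ltn_trans (leq_pred i)).
have inside i j : i < j -> j < m -> e (nth z p i) (nth z p j) -> j = i.+1 \/ (i = 0 /\ j.+1 = m).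
  move=> ij jm eij; have im := ltn_trans ij jm.
  case: (posnP i) => [i0|i0].
    case: (ltnP j.+1 m) => jm'; last by right; split=> //; apply/eqP; rewrite eqn_leq jm jm'.
    subst i; have j1m : j.-1 < m by apply: leq_ltn_trans (leq_pred j) jm.
    have [|/eqP|/eqP] := interior j (nth z p 0) ij jm' (nthA 0 im); first by rewrite es.
      by rewrite nth_uniq // => /eqP h; left; rewrite -(prednK ij) -h.
    by rewrite nth_uniq.
  have i1m : i.+1 < m by exact: leq_ltn_trans ij jm.
  have i0m : i.-1 < m by exact: leq_ltn_trans (leq_pred i) im.
  have [/eqP|/eqP] := interior i (nth z p j) i0 i1m (nthA j jm) eij; rewrite nth_uniq // => /eqP h.
    by move: ij; rewrite h ltnNge leq_pred.
  by left.
case: (boolP ((2 < m) && e (nth z p 0) (nth z p m.-1))) => [/andP[m2 close]|open].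
  left; split=> //; rewrite /ucycle up andbT /= rcons_path lastE es close andbT.
  exact: sp.
right; split=> // x y xp yp.
have [ix iy] : index x p < m /\ index y p < m by rewrite !index_mem.
have key i j : i < m -> j < m -> i < j -> e (nth z p i) (nth z p j) = (j == i.+1).
  move=> im jm ij; apply/idP/eqP => [eij|->]; last by apply: step; rewrite (leq_ltn_trans ij).
  case: (inside i j ij jm eij) => // -[i0 jm1]; apply/eqP; apply: contraR open => ji.
  apply/andP; split; last by rewrite -jm1 -i0.
  by rewrite -jm1 i0 in ij ji *; case: (j) ij ji => [|[|]].
rewrite /consecutive xp yp !andTb.
have -> : e x y = e (nth z p (index x p)) (nth z p (index y p)) by rewrite !nth_index.
case: (ltngtP (index x p) (index y p)) => h.
- by rewrite key // [_ == (index y p).+1]ltn_eqF ?orbF // ltnW.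
- by rewrite es key // [index y p == _]ltn_eqF // ltnW.
- by rewrite h ei ltn_eqF.
Qed.

Lemma path_cover_or_cycle A : (forall x, x \in A -> deg e A x <= 2) ->
  (exists ps, path_cover A ps) \/ (exists c, [/\ ucycle e c, 2 < size c & {subset c <= A}]).
Proof.
have [m] := ubnP #|A|; elim: m A => // m IH A /ltnSE mA dA.
have [->|A0] := eqVneq A set0.
  by left; exists [::]; split=> // [x|x y]; rewrite inE.
have [p [up sp p0 pA max]] := longest_path A0.
case: (longest_path_component dA up sp pA max) => [[cyc p2]|[out inside]].
  by right; exists p.
pose A' := A :\: [set x in p].
have A'E x : (x \in A') = (x \notin p) && (x \in A) by rewrite !inE.
have A'A : A' \subset A by apply/subsetP => x; rewrite A'E => /andP[].
have dA' x : x \in A' -> deg e A' x <= 2.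
  move=> xA'; apply: leq_trans (dA x (subsetP A'A x xA')).
  by apply: subset_leq_card; apply/subsetP => y; rewrite !mem_nbrs => /andP[/(subsetP A'A)-> ->].
have cA' : #|A'| < m.
  apply: leq_trans mA; apply: proper_card; rewrite properE A'A /=.
  case: p p0 pA {up sp max out inside} @A' A'E A'A dA' => // x p _ pA A' A'E _ _.
  by apply/subsetPn; exists x; rewrite ?A'E ?mem_head // pA ?mem_head.
case: (IH A' cA' dA') => [[ps [ups psE linkE sps ps0]]|[c [cyc c2 cA]]]; last first.
  by right; exists c; split=> // x /cA /(subsetP A'A).
left; exists (p :: ps); split.
- rewrite /= cat_uniq up ups andbT /=; apply/hasPn => x; rewrite psE A'E => /andP[/negbTE->] //.
- move=> x; rewrite /= mem_cat psE A'E; case: (boolP (x \in p)) => //= xp; exact/esym/pA.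
- move=> x y xA yA; rewrite linked_cons.
  have notl z w : z \in p -> linked ps z w = false.
    by move=> zp; apply/negP => /linked_mem/andP[]; rewrite psE A'E zp.
  case xp: (x \in p); case yp: (y \in p).
  + by rewrite inside // notl // orbF.
  + by rewrite (negbTE (out x y xp yA _)) ?yp // notl // /consecutive yp !andbF.
  + by rewrite es (negbTE (out y x yp xA _)) ?xp // linked_sym notl // /consecutive xp !andbF.
  + rewrite /consecutive xp yp /= linkE // A'E ?xp ?yp //.
- by rewrite /= sp.
- by rewrite inE negb_or eq_sym p0.
Qed.

Lemma connected_path x p : path e x p -> connected_in e [set y in x :: p].
Proof.
have reach_head z q (B : {set V}) : path e z q -> {subset z :: q <= B} -> forall y, y \in z :: q ->
    reach e B z y /\ reach e B y z.
  elim: q z => [|w q IHq] z /=.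
    by move=> _ _ y; rewrite inE => /eqP->; split; exact: reach_refl.
  move=> /andP[zw wq] sub y.
  have zB : z \in B by apply: sub; rewrite mem_head.
  have wB : w \in B by apply: sub; rewrite !inE eqxx orbT.
  rewrite inE => /orP[/eqP->|yq]; first by split; exact: reach_refl.
  have [|r1 r2] := IHq w wq _ y yq; first by move=> a aq; apply: sub; rewrite inE aq orbT.
  split; first exact: reach_trans (reach_edge zw wB) r1.
  by apply: (reach_trans r2); apply: reach_edge; rewrite // es.
move=> xp a b; rewrite !in_set => ain bin.
have sub : {subset x :: p <= [set y in x :: p]} by move=> y; rewrite in_set.
have [_ ra] := reach_head x p _ xp sub a ain; have [rb _] := reach_head x p _ xp sub b bin.
exact: (reach_trans ra rb).
Qed.

(** The branch sets are two consecutive vertices of the cycle, the rest of the cycle,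
    [v], and [u] together with [a]: the vertex [a] connects the branch set of [u] to
    [v]. *)
Lemma cycle_K5_minor u v a c : ucycle e c -> 2 < size c -> e u a -> e v a ->
  (forall x, x \in c -> e u x && e v x) -> u \notin c -> v \notin c -> a \notin c ->
  u != v -> complete_minor 5 e [set: V].
Proof.
case: c => [|x [|y [|z c]]] // /andP[cyc un] _ ua va joinc uc vc ac uv.
have jx w : w \in [:: x, y, z & c] -> e w u /\ e w v.
  by move=> /joinc; rewrite ![e _ w]es => /andP.
have au : a != u by apply: contraTneq ua => ->; rewrite ei.
have av : a != v by apply: contraTneq va => ->; rewrite ei.
pose B i : {set V} := nth set0 [:: [set x]; [set y]; [set w in z :: c]; [set u; a]; [set v]] i.
have sub0 : x \in [:: x, y, z & c] by rewrite mem_head.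
have sub1 : y \in [:: x, y, z & c] by rewrite !inE eqxx orbT.
have sub2 w : w \in z :: c -> w \in [:: x, y, z & c] by rewrite !(in_cons x) !(in_cons y) => ->; rewrite !orbT.
have /and5P[xy yz zc _ _] : [&& e x y, e y z, path e z c, true & true].
  by move: cyc; rewrite /= rcons_path => /and4P[-> -> -> _].
have closing : e (last z c) x by move: cyc; rewrite /= rcons_path => /and4P[].
have ne b w : w \in [:: x, y, z & c] -> b \notin [:: x, y, z & c] -> w != b.
  by move=> wc; apply: contraNneq => <-.
have cyc5 i : i < 5 -> [\/ i = 0, i = 1 | [\/ i = 2, i = 3 | i = 4]].
  by case: i => [|[|[|[|[|]]]]] // _; [exact: Or31|exact: Or32|apply: Or33; exact: Or31
   |apply: Or33; exact: Or32|apply: Or33; exact: Or33].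
exists B; split.
- move=> i i5; rewrite subsetT; split=> //.
    apply/set0Pn; case: (cyc5 i i5) => [->|->|[->|->|->]]; rewrite /B /=;
    [exists x|exists y|exists z|exists u|exists v]; rewrite !inE eqxx //.
  case: (cyc5 i i5) => [->|->|[->|->|->]]; rewrite /B /=; try exact: connected_in1.
    exact: connected_path.
  move=> b d; rewrite !inE => /orP[]/eqP-> /orP[]/eqP->; try exact: reach_refl.
    by apply: reach_edge; rewrite // !inE eqxx orbT.
  by apply: reach_edge; rewrite ?inE ?eqxx // es.
- have sub i w : w \in B i -> w \in nth [::] [:: [:: x]; [:: y]; z :: c; [:: u; a]; [:: v]] i.
    by case: i => [|[|[|[|[|i]]]]]; rewrite /B /= ?nth_nil !inE.
  move=> i j ij j5; apply/pred0P => w; apply/negP => /andP[/sub wi /sub wj].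
  have perm : uniq (flatten [:: [:: x]; [:: y]; z :: c; [:: u; a]; [:: v]]).
    rewrite (_ : flatten _ = [:: x, y, z & c] ++ [:: u; a; v]) // uniq_catC cat_uniq un andbT.
    apply/andP; split; first by rewrite /= !inE !negb_or uv (eq_sym u a) au av.
    by apply/hasPn => b bc; rewrite !inE !negb_or !ne.
  have dis (ss : seq (seq V)) : uniq (flatten ss) -> forall i j, i < j -> j < size ss ->
      w \in nth [::] ss i -> w \notin nth [::] ss j.
    elim: ss => // s ss IHs; rewrite /= cat_uniq => /and3P[_ /hasPn dss uss] [|k] [|k'] //= kk ks wk.
      by apply: contraTN wk => wk'; apply: dss; apply/flattenP; exists (nth [::] ss k') => //; exact: mem_nth.
    exact: (IHs uss k k').
  by have := dis _ perm i j ij j5 wi; rewrite wj.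
- move=> [i j]; rewrite mem_complete_edges => /andP[ij j5] /=.
  have [xu xv] := jx x sub0; have [yu yv] := jx y sub1.
  have [zu zv] := jx z (sub2 z (mem_head _ _)).
  have zB : z \in B 2 by rewrite /B /= inE mem_head.
  have lB : last z c \in B 2 by rewrite /B /= inE mem_last.
  have xB : x \in B 0 by rewrite /B /= inE.
  have yB : y \in B 1 by rewrite /B /= inE.
  have uB : u \in B 3 by rewrite /B /= !inE eqxx.
  have aB : a \in B 3 by rewrite /B /= !inE eqxx orbT.
  have vB : v \in B 4 by rewrite /B /= inE.
  have lx : e x (last z c) by rewrite es.
  have av' : e a v by rewrite es.
  case: i ij => [|[|[|[|i]]]]; case: j j5 => [|[|[|[|[|j]]]]] // _ _.
  + by exists x, y.
  + by exists x, (last z c).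
  + by exists x, u.
  + by exists x, v.
  + by exists y, z.
  + by exists y, u.
  + by exists y, v.
  + by exists z, u.
  + by exists z, v.
  + by exists a, v.
Qed.

End PathsAndCycles.

(** * Two vertices of almost full degree *)

Section Skeleton.
Local Open Scope ring_scope.
Variables (R : realType) (G : sgraph).
Notation e := (@adj G).
Let N : R := #|G|%:R.
Let es := @adj_sym G.
Let ei := @adj_irrefl G.
Hypothesis sparse : sparse_class e [set: G].

Lemma sparse_sub (S : {set G}) : sparse_class e S.
Proof.
by case: sparse => h1 h2; split=> h; [apply: h1|apply: h2]; apply: has_minor_mono h; rewrite ?subsetT.
Qed.

Lemma arcs_le (S : {set G}) : (arcs e S <= 8 * #|S|)%N.
Proof.
have [->|S0] := eqVneq S set0; first by rewrite /arcs big_set0.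
by apply: ltnW; apply: sparse_arcs => //; have [] := sparse_sub S.
Qed.

Lemma low_degree_sub (S : {set G}) : S != set0 -> exists2 p, p \in S & (deg e S p <= 7)%N.
Proof.
move=> S0; apply: low_degree => //.
by apply: sparse_arcs => //; have [] := sparse_sub S.
Qed.

(** [sparse_bipartite] requires [S] to be independent; deleting the edges inside [S]
    changes neither the links to the other set nor the excluded minors. *)
Lemma links_le (S L : {set G}) : [disjoint S & L] ->
  (\sum_(s in S) deg e L s <= 2 * #|S| + 118 * #|L|)%N.
Proof.
move=> dis; pose e' : rel G := fun a b => e a b && ~~ ((a \in S) && (b \in S)).
have es' : symmetric e' by move=> a b; rewrite /e' es andbC [(b \in S) && _]andbC andbC.
have ei' : irreflexive e' by move=> a; rewrite /e' ei.
have degE s : s \in S -> deg e' L s = deg e L s.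
  move=> sS; apply: eq_card => z; rewrite !inE /e' sS /=.
  by case zL: (z \in L) => //=; rewrite (disjointFl dis zL) andbT.
have sp' : sparse_class e' (L :|: S).
  have [h1 h2] := sparse_sub (L :|: S).
  by split=> h; [apply: h1|apply: h2]; apply: has_minor_mono h => // a b /andP[].
have ind s t : s \in S -> t \in S -> ~~ e' s t by move=> sS tS; rewrite /e' sS tS andbF.
have := sparse_bipartite es' ei' sp' dis ind.
rewrite (eq_bigr (deg e L)) // => h.
have : (2 * \sum_(s in S) deg e L s <= 2 * (2 * #|S| + 118 * #|L|))%N.
  by apply: leq_trans (leq_trans (leq_addr _ _) h) _; rewrite mulnDr !mulnA.
by rewrite leq_mul2l.
Qed.

Let d (w : G) : R := (deg e [set: G] w)%:R.

Lemma sum_nbrs1 (S : {set G}) w : \sum_(z in S | e w z) 1 = (deg e S w)%:R :> R.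
Proof.
rewrite sumr_const; congr (_%:R); apply: eq_card => z.
by rewrite !inE.
Qed.

Lemma degE w : d w = \sum_(z | e w z) 1.
Proof. by rewrite /d -sum_nbrs1; apply: eq_bigl => z; rewrite inE. Qed.

Lemma sum_deg_le : \sum_w d w <= 8 * N.
Proof.
rewrite /d -natr_sum /N -natrM ler_nat; have := arcs_le [set: G].
by rewrite cardsT /arcs; under eq_bigl do rewrite inE.
Qed.

Definition common_nbrs (u v : G) : {set G} := [set z | e u z && e v z].

(** The vertices that prevent [u] and [v] from dominating the graph. *)
Definition exceptional (u v : G) : {set G} := [set z | [&& z != u, z != v & ~~ (e u z && e v z)]].

Let two_complements (a b c k n m : nat) : (a + b = n -> c + k = n -> m <= b + k -> m + a + c <= n + n)%N.
Proof. lia. Qed.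

Lemma exceptional_card u v : #|exceptional u v|%:R <= 2 * N - d u - d v.
Proof.
have h : (#|exceptional u v| + deg e [set: G] u + deg e [set: G] v <= #|G| + #|G|)%N.
  apply: (two_complements (cardsC (nbrs e [set: G] u)) (cardsC (nbrs e [set: G] v))).
  apply: leq_trans (leq_card_setU _ _); apply: subset_leq_card; apply/subsetP => z.
  by rewrite !inE negb_and => /and3P[_ _].
have : (#|exceptional u v| + deg e [set: G] u + deg e [set: G] v)%:R <= (#|G| + #|G|)%:R :> R by rewrite ler_nat.
rewrite !natrD /N /d; lra.
Qed.

Lemma common_nbrs_le (u v z : G) : z != u -> z != v -> u != v ->
  (#|common_nbrs u v :&: nbrs e [set: G] z| <= 2)%N.
Proof.
move=> zu zv uv; have [_ noK] := sparse.
have := K33_common es ei noK (in_setT u) (in_setT v) (in_setT z) uv.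
rewrite ![_ == z]eq_sym => /(_ zu zv); apply: leq_trans; apply: subset_leq_card.
by apply/subsetP => y; rewrite !inE.
Qed.

(** A vertex other than [u] and [v] has at most two common neighbours of [u] and [v] in
    its neighbourhood, as [K_{3,3}] is excluded. *)
Lemma other_degree u v z : z != u -> z != v -> u != v -> d z <= #|exceptional u v|%:R + 4.
Proof.
move=> zu zv uv; rewrite /d -natrD ler_nat.
have sub : nbrs e [set: G] z \subset
    exceptional u v :|: ([set u; v] :|: (common_nbrs u v :&: nbrs e [set: G] z)).
  apply/subsetP => y; rewrite !inE /= => ->; rewrite andbT.
  by case: (y == u) => //=; case: (y == v) => //=; case: (_ && _); rewrite ?orbT.
apply: leq_trans (subset_leq_card sub) _; apply: leq_trans (leq_card_setU _ _) _.
rewrite leq_add2l; apply: leq_trans (leq_card_setU _ _) _; rewrite cards2 uv.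
by apply: (@leq_add _ _ 2 2) => //; exact: common_nbrs_le.
Qed.

Variables (r : R) (x : G -> R).
Hypotheses (x_ge0 : forall v, 0 <= x v) (x_le1 : forall v, x v <= 1).
Hypothesis eigen : forall v, r * x v = \sum_(w | e v w) x w.
Hypothesis r_gt0 : 0 < r.

(** Each entry [x z] is counted once for every neighbour of [z]. *)
Lemma weighted_deg (P : pred G) : \sum_w \sum_(z | e w z && P z) x z = \sum_(z | P z) d z * x z.
Proof.
rewrite (exchange_big_dep P) /=; last by move=> w z _ /andP[].
apply: eq_bigr => z Pz; rewrite degE mulr_suml; apply: eq_big => w; first by rewrite Pz andbT es.
by rewrite mul1r.
Qed.

Lemma sum_x_le : r * \sum_w x w <= 8 * N.
Proof.
rewrite mulr_sumr (eq_bigr _ (fun w _ => eigen w)).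
have -> : \sum_w \sum_(z | e w z) x z = \sum_z d z * x z.
  by rewrite -(weighted_deg predT); apply: eq_bigr => w _; apply: eq_bigl => z; rewrite andbT.
apply: le_trans sum_deg_le; apply: ler_sum => z _.
by rewrite ler_piMr // ler0n.
Qed.

Variable eps : R.
Hypothesis eps_gt0 : 0 < eps.

Let L : {set G} := [set w | eps <= x w].

(** The sum of all entries is at most [8 * N / r], so few entries reach [eps]. *)
Lemma card_large : r * (eps * #|L|%:R) <= 8 * N.
Proof.
apply: le_trans sum_x_le; rewrite ler_pM2l //.
rewrite (bigID (mem L)) /= -[leLHS]addr0; apply: lerD; last by apply: sumr_ge0.
rewrite mulr_natr -sumr_const; apply: ler_sum => w; by rewrite inE.
Qed.

Let large_sum (y : G) : R := \sum_(z in L | e y z) x z.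

Lemma large_sum_le y : large_sum y <= (deg e L y)%:R.
Proof. by rewrite -sum_nbrs1; apply: ler_sum. Qed.

Let noise : R := 126 * #|L|%:R + 8 * eps * N.

(** Walks of length two from [w] are split by their last and middle vertices: those
    ending at a small entry contribute at most [eps] times the number of arcs, and those
    whose middle and last entries are both large at most the number of arcs inside
    [L]. *)
Lemma second_order w : r ^+ 2 * x w <=
  \sum_(y in nbrs e [set: G] w :\: L) large_sum y + 8 * #|L|%:R + 8 * eps * N.
Proof.
have -> : r ^+ 2 * x w = \sum_(y | e w y) \sum_(z | e y z) x z.
  rewrite expr2 -mulrA eigen mulr_sumr; apply: eq_bigr => y _; exact: eigen.
have split_sum y : \sum_(z | e y z) x z = large_sum y + \sum_(z | e y z && (z \notin L)) x z.
  rewrite (bigID (mem L)) /=; congr (_ + _); apply: eq_bigl => z; by rewrite andbC.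
under eq_bigr do rewrite split_sum.
rewrite big_split /=; apply: lerD; last first.
  apply: le_trans (_ : \sum_y \sum_(z | e y z && (z \notin L)) x z <= _).
    rewrite [leRHS](bigID (e w)) /= lerDl; apply: sumr_ge0 => y _; exact: sumr_ge0.
  rewrite (weighted_deg (fun z => z \notin L)) [8 * eps]mulrC -mulrA.
  apply: le_trans (_ : eps * \sum_z d z <= _); last by rewrite ler_pM2l // sum_deg_le.
  rewrite mulr_sumr [leRHS](bigID (fun z => z \notin L)) /= -[leLHS]addr0; apply: lerD.
    apply: ler_sum => z; rewrite inE -ltNge mulrC => /ltW h.
    by rewrite ler_wpM2r // ler0n.
  by apply: sumr_ge0 => z _; rewrite mulr_ge0 ?ler0n // ltW.
rewrite (bigID (mem L)) /= addrC; apply: lerD.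
  rewrite le_eqVlt; apply/orP; left; apply/eqP; apply: eq_bigl => y.
  by rewrite !inE andbC.
apply: le_trans (_ : \sum_(y in L) (deg e L y)%:R <= _).
  apply: le_trans (_ : \sum_(y in L) large_sum y <= _); last first.
    by apply: ler_sum => y _; exact: large_sum_le.
  rewrite [leRHS](bigID (e w)) /= -[leLHS]addr0; apply: lerD.
    by rewrite le_eqVlt; apply/orP; left; apply/eqP; apply: eq_bigl => y; rewrite andbC.
  by apply: sumr_ge0 => y _; apply: sumr_ge0.
by rewrite -natr_sum -natrM ler_nat; exact: arcs_le.
Qed.

Let outer w := nbrs e [set: G] w :\: L.

Let outer_links w : \sum_(y in outer w) (deg e L y)%:R <= 2 * #|outer w|%:R + 118 * #|L|%:R :> R.
Proof.
rewrite -natr_sum -!natrM -natrD ler_nat; apply: links_le.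
by apply/pred0P => z; rewrite /= !inE; case: (_ <= _); rewrite /= ?andbF.
Qed.

Let outer_le w : #|outer w|%:R <= d w.
Proof. by rewrite ler_nat; apply: subset_leq_card; exact: subsetDl. Qed.

(** The walks from [w] to large entries through the neighbours outside [L] are counted
    by [links_le], two for each neighbour up to the noise. *)
Lemma degree_bound w : r ^+ 2 * x w <= 2 * d w + noise.
Proof.
have h1 := second_order w; have h2 := outer_links w; have h3 := outer_le w.
have h4 : \sum_(y in outer w) large_sum y <= \sum_(y in outer w) (deg e L y)%:R.
  by apply: ler_sum => y _; exact: large_sum_le.
rewrite /noise -/(outer w) in h1 *; lra.
Qed.

Let second_arith (X S0 S1 o du m : R) :
  X <= S0 + 8 * #|L|%:R + 8 * eps * N -> S0 <= (1 - m) * o + m * S1 ->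
  m * S1 <= m * (2 * o + 118 * #|L|%:R) -> (1 + m) * o <= (1 + m) * du -> m * #|L|%:R <= #|L|%:R ->
  X <= du * (1 + m) + noise.
Proof. by rewrite /noise; move: #|L|%:R => l; lra. Qed.

(** The same count at the maximum [u] itself: each middle vertex has one step back to
    [u], of weight [1], and the other steps to large entries have weight at most [m]. *)
Lemma second_largest u m : x u = 1 -> eps <= 1 -> (forall z, z != u -> x z <= m) -> 0 <= m -> m <= 1 ->
  r ^+ 2 <= d u * (1 + m) + noise.
Proof.
move=> xu e1 xm m0 m1; have h1 := second_order u; rewrite xu mulr1 in h1.
have h2 := outer_links u; have h3 := outer_le u.
have uL : u \in L by rewrite inE xu.
have h4 : \sum_(y in outer u) large_sum y <= \sum_(y in outer u) (1 - m + m * (deg e L y)%:R).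
  apply: ler_sum => y; rewrite !inE => /andP[_ uy].
  rewrite -sum_nbrs1 /large_sum (bigD1 u) /= ?uL ?[e y u]es // [X in _ <= _ + _ * X](bigD1 u) /= ?uL ?[e y u]es //.
  rewrite xu mulrDr mulr1 addrA subrK lerD2l mulr_sumr; apply: ler_sum => z /andP[_ zu].
  by rewrite mulr1; exact: xm.
rewrite big_split /= sumr_const -mulr_sumr -mulr_natr in h4.
have h5 : m * \sum_(y in outer u) (deg e L y)%:R <= m * (2 * #|outer u|%:R + 118 * #|L|%:R) by exact: ler_wpM2l.
have h6 : (1 + m) * #|outer u|%:R <= (1 + m) * d u by rewrite ler_wpM2l //; lra.
have h7 : m * #|L|%:R <= #|L|%:R by rewrite ler_piMl // ler0n.
exact: second_arith h1 h4 h5 h6 h7.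
Qed.

End Skeleton.

Section SkeletonArithmetic.
Local Open Scope ring_scope.
Variables (R : realFieldType) (N no rr : R).
Hypotheses (N_gt0 : 0 < N) (no_small : no <= 3 / 400 * N) (N_small : 4 <= 1 / 400 * N)
  (rr_big : 2 * N - 4 <= rr).

Lemma rr_lower : 799 / 400 * N <= rr.
Proof. by have := N_small; have := rr_big; lra. Qed.

Lemma second_value_arith du m : rr <= du * (1 + m) + no -> du <= N -> 0 <= m -> 99 / 100 <= m.
Proof.
move=> h duN m0; rewrite leNgt; apply/negP => mlt.
have m1 : 0 <= 1 + m by lra.
have m2 : 1 + m < 199 / 100 by lra.
have h1 : du * (1 + m) <= N * (1 + m) := ler_wpM2r m1 duN.
have h2 : N * (1 + m) < N * (199 / 100) by rewrite (ltr_pM2l N_gt0); exact: m2.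
have := rr_lower; have := no_small; lra.
Qed.

Lemma degrees_arith du dv m b : rr <= 2 * du + no -> rr * m <= 2 * dv + no -> 99 / 100 <= m ->
  b <= 2 * N - du - dv -> b <= 1 / 50 * N.
Proof.
move=> h1 h2 m99 hb; have rl := rr_lower.
have p1 : 0 <= 799 / 400 * N by have := N_gt0; lra.
have p2 : 0 <= 99 / 100 :> R by lra.
have h3 : 799 / 400 * N * (99 / 100) <= rr * m := ler_pM p1 p2 rl m99.
have := no_small; have := N_gt0; lra.
Qed.

Lemma small_value_arith b dz xz : b <= 1 / 50 * N -> dz <= b + 4 ->
  rr * xz <= 2 * dz + no -> xz <= 1 / 36.
Proof.
move=> h1 h2 h3; rewrite leNgt; apply/negP => xzlt; have rl := rr_lower.
have p1 : 0 <= 799 / 400 * N by have := N_gt0; lra.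
have p2 : 0 <= 1 / 36 :> R by lra.
have h4 : 799 / 400 * N * (1 / 36) <= rr * xz := ler_pM p1 p2 rl (ltW xzlt).
have := no_small; have := N_gt0; have := N_small; lra.
Qed.

(** [eps = 1 / 2000]; the lower bound on [r] makes the number of large entries
    negligible. *)
Lemma noise_arith r l : 0 <= l -> 59 * 10 ^+ 7 <= r -> r * (1 / 2000 * l) <= 8 * N ->
  126 * l + 8 * (1 / 2000) * N <= 3 / 400 * N.
Proof.
move=> l0 hr h.
have p : 0 <= 1 / 2000 * l by lra.
have h' : 59 * 10 ^+ 7 * (1 / 2000 * l) <= r * (1 / 2000 * l) := ler_wpM2r p hr.
lra.
Qed.

End SkeletonArithmetic.

Section SkeletonNumbers.
Local Open Scope ring_scope.
Variables (R : realType) (G : sgraph) (r : R) (x : G -> R).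
Notation e := (@adj G).
Let N : R := #|G|%:R.
Hypothesis sparse : sparse_class e [set: G].
Hypotheses (x_ge0 : forall v, 0 <= x v) (x_le1 : forall v, x v <= 1).
Hypothesis eigen : forall v, r * x v = \sum_(w | e v w) x w.
Hypotheses (N_big : 10 ^+ 6 <= N) (r_big : 59 * 10 ^+ 7 <= r)
  (r_sq : 2 * N - 4 <= r ^+ 2).

Let deg_le_N (w : G) : (deg e [set: G] w)%:R <= N.
Proof. by rewrite ler_nat /deg max_card. Qed.

(** As [2 * N - 4 <= r ^+ 2] while [degree_bound] gives about [2 * deg u], the vertex
    [u] has almost full degree; by [second_largest] the second largest entry is close to
    [1], so that the same holds at [v]. All other vertices then have small degree, hence
    small entries. *)
Lemma skeleton u : x u = 1 -> exists v, [/\ u != v, 99 / 100 <= x v,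
  #|exceptional u v|%:R <= 1 / 50 * N & forall z, z != u -> z != v -> x z <= 1 / 36].
Proof.
move=> xu; have r0 : 0 < r by have := r_big; lra.
have [v0 v0u] : exists z, z != u.
  apply/existsP; apply: contraT; rewrite negb_exists => /forallP h.
  have : (#|G| <= 1)%N.
    by apply/card_le1P => a _ b; rewrite inE; have /negPn/eqP-> := h a; have /negPn/eqP-> := h b; rewrite inE eqxx.
  by rewrite -(ler_nat R) -/N => h1; have := N_big; lra.
have [v vu vmax] := @arg_maxP _ _ G v0 (fun z => z != u) x v0u.
exists v; have uv : u != v by rewrite eq_sym.
have eps0 : 0 < 1 / 2000 :> R by lra.
have eps1 : 1 / 2000 <= 1 :> R by lra.
have N0 : 0 < N by have := N_big; lra.
have N4 : 4 <= 1 / 400 * N by have := N_big; lra.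
have hl := card_large sparse x_ge0 x_le1 eigen r0 (1 / 2000).
have b1 := degree_bound sparse x_ge0 x_le1 eigen eps0.
have b3 := second_largest sparse x_ge0 x_le1 eigen eps0 xu eps1 (fun z zu => vmax z zu)
   (x_ge0 v) (x_le1 v).
have nos := noise_arith (ler0n _ _) r_big hl.
have bu := b1 u; rewrite xu mulr1 in bu.
have m99 := second_value_arith N0 nos N4 r_sq b3 (deg_le_N u) (x_ge0 v).
have hb := degrees_arith N0 nos N4 r_sq bu (b1 v) m99 (exceptional_card R u v).
split=> //.
move=> z zu zv; apply: (small_value_arith N0 nos N4 r_sq hb _ (b1 z)).
exact: other_degree.
Qed.

End SkeletonNumbers.

(** * Rewiring exceptional vertices *)

Section FanGraph.
Variables (V : finType) (u v : V) (ps : seq (seq V)).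

Fact fan_rel_sym : symmetric (fan_rel u v ps).
Proof. by move=> x y; rewrite /fan_rel eq_sym orbCA linked_sym. Qed.

Fact fan_rel_irrefl : irreflexive (fan_rel u v ps).
Proof. by move=> x; rewrite /fan_rel eqxx. Qed.

Definition fan_graph : sgraph := SGraph fan_rel_sym fan_rel_irrefl.

End FanGraph.

Section RewiringArithmetic.
Local Open Scope ring_scope.
Variables (R : realFieldType) (N : R).
Hypothesis N_big : 10 ^+ 6 <= N.

(** The least entry over almost all vertices is at most the average, which is about [8 /
    r]. *)
Lemma least_common_arith (r w nA nB S : R) : N <= nA + nB + 2 -> nB <= 1 / 50 * N ->
  0 <= r * w -> w * nA <= S -> r * S <= 8 * N -> 0 <= r -> r * w <= 33 / 4.
Proof.
move=> hN hB rw0 hw hS r0.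
have h1 : r * (w * nA) <= r * S := ler_wpM2l r0 hw.
have big := N_big.
have h2 : 97 / 100 * N <= nA by lra.
have h3 : r * w * (97 / 100 * N) <= r * w * nA := ler_wpM2l rw0 h2.
have h4 : r * w * (97 / 100 * N) <= 8 * N by lra.
have N0 : 0 < N by lra.
have h5 : r * w * (97 / 100) * N <= 8 * N by lra.
have : r * w * (97 / 100) <= 8 by move: h5; rewrite (ler_pM2r N0).
lra.
Qed.

(** [sigma] is the total weight [x u + x v] that a rewired vertex sees, and [a] its
    entry. Optimising the increment [(sigma - r * a) / r] of one coordinate reduces the
    claim to [37 / 25 * b - 11 / 12 + (sigma - b) ^+ 2 > 0] for [b = r * a >= 0] and
    [sigma >= 199 / 100]. *)
Lemma no_gain_arith (r gain SB w a sigma q n : R) : 0 < r -> r * w <= 33 / 4 ->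
  37 / 25 * SB - 1 / 9 * w <= gain -> 0 <= a -> a <= SB -> 199 / 100 <= sigma ->
  q = r * n ->
  q + gain + 2 * ((sigma - r * a) / r) * sigma
    <= r * (n + 2 * ((sigma - r * a) / r) * a + ((sigma - r * a) / r) ^+ 2) -> False.
Proof.
move=> r0 rw hg a0 aS hs -> h.
set b := r * a in h; pose D := sigma - b.
have rN : r != 0 by rewrite gt_eqF.
have e2 : (r * n + gain + 2 * (D / r) * sigma) * r = r * (r * n) + r * gain + 2 * D * sigma.
  by field.
have e3 : r * (n + 2 * (D / r) * a + (D / r) ^+ 2) * r = r * (r * n) + 2 * D * b + D ^+ 2.
  by rewrite /b; field.
have h1 : (r * n + gain + 2 * (D / r) * sigma) * r <= r * (n + 2 * (D / r) * a + (D / r) ^+ 2) * r.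
  by rewrite (ler_pM2r r0); exact: h.
rewrite e2 e3 in h1.
have b0 : 0 <= b by rewrite mulr_ge0 // ltW.
have bS : b <= r * SB by rewrite ler_wpM2l // ltW.
have h2 : r * (37 / 25 * SB - 1 / 9 * w) <= r * gain by rewrite ler_wpM2l // ltW.
have dd : 2 * D * sigma - 2 * D * b = 2 * D ^+ 2 by rewrite /D; ring.
have h4 : 0 <= (D - 37 / 50) ^+ 2 := sqr_ge0 _.
have h5 : (D - 37 / 50) ^+ 2 = D ^+ 2 - 37 / 25 * D + (37 / 50) ^+ 2 by field.
have h6 : D = sigma - b by [].
move: h1 h2 dd h4 h5 h6 rw bS hs; clear.
rewrite (_ : r * (37 / 25 * SB - 1 / 9 * w) = 37 / 25 * (r * SB) - 1 / 9 * (r * w)); last by ring.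
clearbody D b.
move: (2 * D * sigma) (2 * D * b) (r * (r * n)) (r * SB) (r * w) (r * gain) => ?????? h1 h2 dd h4 h5 h6 rw bS hs.
lra.
Qed.

End RewiringArithmetic.

Section Rewiring.
Local Open Scope ring_scope.
Variables (R : realType) (G : sgraph) (r : R) (x : G -> R) (u v w0 : G) (ps : seq (seq G)).
Notation e := (@adj G).
Let N : R := #|G|%:R.
Let es := @adj_sym G.
Let ei := @adj_irrefl G.
Let A := common_nbrs u v.
Let B := exceptional u v.
Hypothesis sparse : sparse_class e [set: G].
Hypotheses (x_ge0 : forall z, 0 <= x z) (x_le1 : forall z, x z <= 1).
Hypothesis eigen : forall z, r * x z = \sum_(w | e z w) x w.
Hypotheses (uv : u != v) (xu : x u = 1) (xv : 99 / 100 <= x v).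
Hypothesis x_small : forall z, z != u -> z != v -> x z <= 1 / 36.
Hypotheses (w0A : w0 \in A) (w0_min : forall a, a \in A -> x w0 <= x a).
Hypothesis cover : path_cover e (A :\ w0) ps.

(** Common neighbours other than [w0] keep their paths, while [w0] and the exceptional
    vertices become isolated path vertices. Detaching [w0] makes a path cover available
    even when the common neighbours form a cycle, and provides a path of size one, so
    that adding more of them keeps the sizes packed. *)
Definition rewired : seq (seq G) := ps ++ [:: w0] :: [seq [:: z] | z <- enum B].

Let e' := fan_rel u v rewired.

(** The three kinds of vertices, with the membership tests rewritten simultaneously. *)
Inductive part_spec (z : G) : bool -> bool -> bool -> bool -> Prop :=
| PartEnd of z \in [:: u; v] : part_spec z true false false false
| PartCommon of z \notin [:: u; v] & z \in A : part_spec z false true false (z == w0)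
| PartExceptional of z \notin [:: u; v] & z \in B : part_spec z false false true false.

Lemma partP z : part_spec z (z \in [:: u; v]) (z \in A) (z \in B) (z == w0).
Proof.
have uA : u \in A = false by rewrite inE ei.
have vA : v \in A = false by rewrite inE ei andbF.
have uB : u \in B = false by rewrite inE eqxx.
have vB : v \in B = false by rewrite inE eqxx andbF.
have neA y : (y \in A) = false -> (y == w0) = false.
  by move=> yA; apply/negP => /eqP yw; move: w0A; rewrite -yw yA.
case: (boolP (z \in [:: u; v])) => ze.
  have zA : z \in A = false by move: (ze); rewrite mem_seq2 => /orP[] /eqP ->.
  have zB : z \in B = false by move: (ze); rewrite mem_seq2 => /orP[] /eqP ->.
  by rewrite zA zB neA //; exact: PartEnd.
have [zu zv] : z != u /\ z != v by move: ze; rewrite !inE negb_or => /andP[].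
case zA: (z \in A).
  have -> : z \in B = false by move: zA; rewrite !inE => ->; rewrite !andbF.
  exact: PartCommon.
have zB : z \in B by move: zA; rewrite !inE zu zv => ->.
by rewrite zB neA //; exact: PartExceptional.
Qed.

Let linkedE a b : linked rewired a b = linked ps a b.
Proof.
have single z y y' : consecutive [:: z] y y' = false.
  rewrite /consecutive !mem_seq1; case: eqP => //= ->; case: eqP => //= ->.
  by rewrite eqxx.
rewrite /rewired /linked has_cat -!/(linked _ _ _) linked_cons !single /=.
have -> : linked [seq [:: z] | z <- enum B] a b = false; last by rewrite orbF.
by elim: (enum B) => //= z s IH; rewrite linked_cons !single IH.
Qed.

Let linked_in a b : linked ps a b -> [/\ a \in A, b \in A, a != w0 & b != w0].
Proof.
by move=> /linked_mem; case: cover => _ psE _ _ _; rewrite !psE => /andP[/setD1P[? ?] /setD1P[? ?]].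
Qed.

Lemma rewired_fan : fan e' u v rewired.
Proof.
have [un psE _ _ _] := cover.
have flE : flatten rewired = flatten ps ++ w0 :: enum B.
  by rewrite /rewired flatten_cat /=; congr (_ ++ _ :: _); elim: (enum B) => //= z s ->.
have memF z : (z \in flatten rewired) = (z \notin [:: u; v]).
  rewrite flE mem_cat inE mem_enum psE in_setD1.
  by case: partP => // _ _; case: (z == w0).
split=> //; last by move=> z; rewrite !in_cons memF !inE; case: (z == u); case: (z == v).
rewrite /= in_cons !memF !inE !eqxx orbT /= orbF uv /= flE cat_uniq un /= mem_enum enum_uniq andbT.
have w0e : w0 \in B = false by move: w0A; case: partP.
rewrite psE in_setD1 eqxx w0e /= andbT; apply/hasPn => z; rewrite mem_enum psE in_setD1.
by case: partP; rewrite ?andbF.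
Qed.

(** A lower bound for the change of adjacency at [(a, b)]: exceptional vertices gain
    their missing edges to [u] and [v], and lose their edges to common neighbours and
    among themselves; [w0] loses its edges to common neighbours. *)
Let pair_gain (a b : G) : R :=
  ((b \in B) && (a \in [:: u; v]) && ~~ e a b)%:R + ((a \in B) && (b \in [:: u; v]) && ~~ e a b)%:R
  - ((a \in B) && (b \in A) && e a b)%:R - ((b \in B) && (a \in A) && e a b)%:R
  - ((a \in B) && (b \in B) && e a b)%:R
  - ((a == w0) && (b \in A) && e a b)%:R - ((b == w0) && (a \in A) && e a b)%:R.

Let pair_gain_le a b : pair_gain a b <= (e' a b)%:R - (e a b)%:R.
Proof.
rewrite /pair_gain /e' /fan_rel linkedE.
have linkN : (a \notin A) || (b \notin A) || (a == w0) || (b == w0) -> linked ps a b = false.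
  by move=> h; apply/negP => /linked_in[h1 h2 /negbTE h3 /negbTE h4]; move: h; rewrite h1 h2 h3 h4.
have linkE : a \in A -> b \in A -> a != w0 -> b != w0 -> linked ps a b = e a b.
  move=> aA bA aw bw; case: cover => _ _ linkE _ _; rewrite -linkE // in_setD1 ?aw ?bw //.
have eAB a' b' : a' \in [:: u; v] -> b' \in A -> e a' b' /\ e b' a'.
  by move=> h; rewrite /A /common_nbrs in_set [e b' a']es => /andP[ub vb]; move: h; rewrite mem_seq2 => /orP[] /eqP ->.
have ab_ne : e a b -> a != b by apply: contraTneq => ->; rewrite ei.
move: linkN linkE.
case: (partP a) => [ae|ae aA|ae aB]; case: (partP b) => [be|be bA|be bB] linkN linkE /=;
  rewrite ?subr0 ?addr0 ?add0r ?andbT.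
- case eab: (e a b); rewrite ?subr0 ?ler0n //.
  by rewrite (ab_ne eab) subrr.
- have [eab _] := eAB _ _ ae bA; rewrite eab (ab_ne eab) subrr //.
- case: (eqVneq a b) => [abE|_]; first by move: be; rewrite -abE ae.
  by case: (e a b) => /=; lra.
- have [_ eab] := eAB _ _ be aA; rewrite eab (ab_ne eab) subrr //.
- case: (boolP (a == w0)) linkN linkE => aw linkN linkE.
    rewrite linkN ?orbT // andbF sub0r; case: (b == w0); case: (e a b) => /=; lra.
  case: (boolP (b == w0)) linkN linkE => bw linkN linkE.
    rewrite linkN ?orbT // andbF sub0r; case: (e a b) => /=; lra.
  rewrite linkE //; case eab: (e a b); first by rewrite (ab_ne eab) /= !subr0 subrr.
  by rewrite ?andbF /= ?subr0 ?oppr0 ?lexx.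
- rewrite (linkN isT) ?andbF /=.
  by case: (a == w0); case: (e a b) => /=; lra.
- case: (eqVneq a b) => [abE|_]; first by move: ae; rewrite abE be.
  by case: (e a b) => /=; lra.
- rewrite (linkN isT) ?andbF /=.
  by case: (b == w0); case: (e a b) => /=; lra.
- rewrite (linkN isT) ?andbF /=.
  by case: (e a b) => /=; lra.
Qed.

(** The quadratic form of an arbitrary relation, for which the contributions of
    [pair_gain] are estimated one by one. *)
Let wsum (P : rel G) : R := \sum_a \sum_b (P a b)%:R * (x a * x b).

Let wsumE P : wsum P = \sum_a x a * \sum_(b | P a b) x b.
Proof.
apply: eq_bigr => a _; rewrite mulr_sumr [RHS]big_mkcond; apply: eq_bigr => b _.
by case: (P a b); rewrite ?mul1r ?mul0r.
Qed.

Let wsum_swap P : wsum (fun a b => P b a) = wsum P.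
Proof.
rewrite /wsum exchange_big; apply: eq_bigr => a _; apply: eq_bigr => b _.
by rewrite [x b * _]mulrC.
Qed.

Let wsum_quad P : wsum P = quad P x.
Proof. by rewrite wsumE; apply: eq_bigr => a _; rewrite mulr_sumr. Qed.

Let restrict (P : rel G) (S : {set G}) : (forall a b, P a b -> a \in S) ->
  wsum P = \sum_(a in S) x a * \sum_(b | P a b) x b.
Proof.
move=> PS; rewrite wsumE [LHS](bigID (mem S)) /= [X in _ + X]big1 ?addr0 // => a aS.
by rewrite big_pred0 ?mulr0 // => b; apply: contraNF aS; exact: PS.
Qed.

Let SB : R := \sum_(b in B) x b.

(** An exceptional vertex misses [u] or [v], and both have entry at least [99 / 100]. *)
Let missing_end : 99 / 100 * SB <= wsum (fun a b => (a \in B) && (b \in [:: u; v]) && ~~ e a b).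
Proof.
rewrite (@restrict _ B); last by move=> a b /andP[/andP[]].
rewrite /SB mulr_sumr; apply: ler_sum => a aB; rewrite mulrC ler_wpM2l //.
have heavy w : 99 / 100 <= x w -> w \in [:: u; v] -> ~~ e a w ->
    99 / 100 <= \sum_(b | (a \in B) && (b \in [:: u; v]) && ~~ e a b) x b.
  move=> xw we aw; rewrite (bigD1 w) /= ?aB ?we //; apply: (le_trans xw); rewrite lerDl.
  exact: sumr_ge0.
have /and3P[_ _] : [&& a != u, a != v & ~~ (e u a && e v a)] by move: aB; rewrite /B inE.
rewrite negb_and ![e _ a]es => /orP[]; apply: heavy; rewrite ?xu ?mem_seq2 ?eqxx ?orbT //.
lra.
Qed.

(** At most two common neighbours of [u] and [v] are adjacent to [a], each with entry at
    most [1 / 36]. *)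
Let small_nbrs a : a \notin [:: u; v] -> \sum_(b | (b \in A) && e a b) x b <= 1 / 18.
Proof.
rewrite mem_seq2 negb_or => /andP[au av].
apply: le_trans (_ : \sum_(b in A :&: nbrs e [set: G] a) 1 / 36 <= _).
  apply: le_trans (_ : \sum_(b in A :&: nbrs e [set: G] a) x b <= _).
    rewrite le_eqVlt; apply/orP; left; apply/eqP; apply: eq_bigl => b.
    by rewrite !in_setI mem_nbrs in_setT.
  apply: ler_sum => b; rewrite in_setI => /andP[bA _].
  have : b \notin [:: u; v] by move: bA; case: partP.
  by rewrite mem_seq2 negb_or => /andP[]; exact: x_small.
rewrite sumr_const -mulr_natr.
have : (#|A :&: nbrs e [set: G] a|%:R : R) <= 2 by rewrite ler_nat; exact: common_nbrs_le.
lra.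
Qed.

Let to_common : wsum (fun a b => (a \in B) && (b \in A) && e a b) <= 1 / 18 * SB.
Proof.
rewrite (@restrict _ B); last by move=> a b /andP[/andP[]].
rewrite /SB mulr_sumr; apply: ler_sum => a aB; rewrite [leRHS]mulrC ler_wpM2l //.
under eq_bigl do rewrite aB.
by apply: small_nbrs; move: aB; case: partP.
Qed.

Let to_w0 : wsum (fun a b => (a == w0) && (b \in A) && e a b) <= 1 / 18 * x w0.
Proof.
rewrite (@restrict _ [set w0]); last by move=> a b /andP[/andP[]]; rewrite inE.
rewrite big_set1 [leRHS]mulrC ler_wpM2l //.
under eq_bigl do rewrite eqxx.
by apply: small_nbrs; move: w0A; case: partP.
Qed.

(** Vertices of degree at most [7] are deleted one at a time; the edges of the deleted
    vertex lead to entries of at most [1 / 36] and are counted in both directions,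
    whence [7 / 18 = 2 * 7 / 36]. *)
Let inside (S : {set G}) : S \subset B ->
  wsum (fun a b => (a \in S) && (b \in S) && e a b) <= 7 / 18 * \sum_(b in S) x b.
Proof.
have [m] := ubnP #|S|; elim: m S => // m IH S /ltnSE mS SB'.
have [->|S0] := eqVneq S set0.
  rewrite big_set0 mulr0 wsumE big1 // => a _; rewrite big_pred0 ?mulr0 // => b.
  by rewrite inE.
have [p pS dp] := low_degree_sub sparse S0.
have {}IH := IH (S :\ p).
have -> : wsum (fun a b => (a \in S) && (b \in S) && e a b) =
    wsum (fun a b => (a \in S :\ p) && (b \in S :\ p) && e a b)
    + (wsum (fun a b => (a == p) && (b \in S) && e a b) + wsum (fun a b => (b == p) && (a \in S) && e b a)).
  rewrite /wsum -!big_split /=; apply: eq_bigr => a _; rewrite -!big_split /=; apply: eq_bigr => b _.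
  rewrite !in_setD1 [e b a]es -!mulrDl; congr (_ * _).
  have [->|ap] := eqVneq a p; have [->|bp] := eqVneq b p; rewrite ?pS ?ei ?andbF ?addr0 ?add0r ?andbT //.
rewrite (wsum_swap (fun a b => (a == p) && (b \in S) && e a b)).
rewrite (big_setD1 p) //= mulrDr addrC; apply: lerD; last first.
  apply: IH; last by apply: subset_trans (subsetDl _ _) SB'.
  by move: mS; rewrite (cardsD1 p S) pS.
suff : wsum (fun a b => (a == p) && (b \in S) && e a b) <= 7 / 36 * x p by lra.
rewrite (@restrict _ [set p]); last by move=> a b /andP[/andP[]]; rewrite inE.
rewrite big_set1 [leRHS]mulrC ler_wpM2l //.
apply: le_trans (_ : \sum_(b in nbrs e S p) 1 / 36 <= _).
  apply: le_trans (_ : \sum_(b in nbrs e S p) x b <= _).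
    rewrite le_eqVlt; apply/orP; left; apply/eqP; apply: eq_bigl => b.
    by rewrite mem_nbrs eqxx.
  apply: ler_sum => b; rewrite mem_nbrs => /andP[bS _].
  have : b \notin [:: u; v] by move/subsetP: SB' => /(_ _ bS); case: partP.
  by rewrite mem_seq2 negb_or => /andP[]; exact: x_small.
rewrite sumr_const -mulr_natr.
have : (#|nbrs e S p|%:R : R) <= 7 by rewrite ler_nat.
lra.
Qed.

(** [37 / 25 = 2 * 99 / 100 - 2 / 18 - 7 / 18]. *)
Lemma rewiring_gain : 37 / 25 * SB - 1 / 9 * x w0 <= quad e' x - quad e x.
Proof.
have h : \sum_a \sum_b pair_gain a b * (x a * x b) <= quad e' x - quad e x.
  rewrite -!wsum_quad /wsum -sumrB; apply: ler_sum => a _; rewrite -sumrB; apply: ler_sum => b _.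
  by rewrite -mulrBl; apply: ler_wpM2r (pair_gain_le a b); rewrite mulr_ge0.
apply: le_trans h.
pose P1 a b := (a \in B) && (b \in [:: u; v]) && ~~ e a b.
pose P2 a b := (a \in B) && (b \in A) && e a b.
pose P3 a b := (a \in B) && (b \in B) && e a b.
pose P4 a b := (a == w0) && (b \in A) && e a b.
have -> : \sum_a \sum_b pair_gain a b * (x a * x b) = 2 * wsum P1 - 2 * wsum P2 - wsum P3 - 2 * wsum P4.
  have -> : 2 * wsum P1 - 2 * wsum P2 - wsum P3 - 2 * wsum P4 =
     wsum (fun a b => P1 b a) + wsum P1 - wsum P2 - wsum (fun a b => P2 b a) - wsum P3 - wsum P4
     - wsum (fun a b => P4 b a).
    by rewrite (wsum_swap P1) (wsum_swap P2) (wsum_swap P4); ring.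
  rewrite /wsum -!sumrN -!big_split /=; apply: eq_bigr => a _; rewrite -!sumrN -!big_split /=.
  by apply: eq_bigr => b _; rewrite /pair_gain /P1 /P2 /P3 /P4 ![e b a]es; ring.
have h1 : 99 / 100 * SB <= wsum P1 := missing_end.
have h2 : wsum P2 <= 1 / 18 * SB := to_common.
have h3 : wsum P3 <= 7 / 18 * SB := inside (subxx _).
have h4 : wsum P4 <= 1 / 18 * x w0 := to_w0.
lra.
Qed.

Hypotheses (N_big : 10 ^+ 6 <= N) (r_gt0 : 0 < r) (few : #|B|%:R <= 1 / 50 * N).

Let least_common : r * x w0 <= 33 / 4.
Proof.
apply: (@least_common_arith _ _ N_big r (x w0) #|A|%:R #|B|%:R (\sum_z x z)) => //.
- rewrite /N -!natrD ler_nat -cardsT.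
  have sub : [set: G] \subset A :|: B :|: [set u; v].
    apply/subsetP => z _; rewrite !in_setU !in_set1 -mem_seq2.
    by case: partP; rewrite ?orbT.
  apply: leq_trans (subset_leq_card sub) _; apply: leq_trans (leq_card_setU _ _) _.
  by apply: leq_add; [exact: leq_card_setU|rewrite cards2 uv].
- by rewrite mulr_ge0 // ltW.
- rewrite mulr_natr -sumr_const; apply: (@le_trans _ _ (\sum_(a in A) x a)).
    by apply: ler_sum => a; exact: w0_min.
  by rewrite [leRHS](bigID (mem A)) /= lerDl; exact: sumr_ge0.
- exact: sum_x_le.
- exact: ltW.
Qed.

(** The test vector is [x] with the entry at one exceptional vertex [z0] raised. The
    gain of the form on [x] itself may be negative by the contribution of [w0], of order
    [1 / r]; raising the entry at [z0], which now sees both ends, compensates for it. *)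
Lemma rewired_radius z0 : z0 \in B -> r < spectral_radius R (fan_graph u v rewired).
Proof.
move=> z0B; rewrite ltNge; apply/negP => rho.
pose H := fan_graph u v rewired.
have H0 : (0 < #|H|)%N by apply/card_gt0P; exists u.
have z0e : z0 \notin [:: u; v] by move: z0B; case: partP.
pose sigma := \sum_(w | e' z0 w) x w.
have sigma_big : 199 / 100 <= sigma.
  move: z0e; rewrite mem_seq2 negb_or => /andP[z0u z0v].
  rewrite /sigma (bigD1 u) /=; last by rewrite /e' /fan_rel mem_seq2 z0u mem_seq2 eqxx !orbT.
  rewrite (bigD1 v) /=; last by rewrite /e' /fan_rel !mem_seq2 z0v eqxx !orbT eq_sym.
  have : 0 <= \sum_(i | e' z0 i && (i != u) && (i != v)) x i by exact: sumr_ge0.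
  by have := xv; rewrite xu; lra.
pose t := (sigma - r * x z0) / r.
have := rayleigh H0 (fun z => x z + t * (z == z0)%:R).
rewrite (quad_add_delta (@adj_sym H) (@adj_irrefl H)) sqnorm_add_delta => ray.
have SBz : x z0 <= SB.
  by rewrite /SB (bigD1 z0) //= lerDl; exact: sumr_ge0.
apply: (no_gain_arith r_gt0 least_common rewiring_gain (x_ge0 z0) SBz sigma_big (quad_eigen eigen)).
rewrite -addrA [quad e' x - _ + _]addrAC addrA [quad e x + _]addrC.
apply: (le_trans _ (le_trans ray _)).
  by rewrite -/t -/sigma; lra.
rewrite ler_wpM2r //.
have := sqnorm_ge0 (fun z => x z + t * (z == z0)%:R); rewrite sqnorm_add_delta //.
Qed.

End Rewiring.

(** * Extremal graphs *)

Section FanRadius.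
Local Open Scope ring_scope.
Variable R : realType.

Lemma fan_card (V : finType) (e : rel V) u v ps : fan e u v ps -> #|V| = (sumn (map size ps)).+2.
Proof.
move=> [un all_in _]; rewrite -size_flatten -cardsT -[RHS]/(size [:: u, v & flatten ps]) -(card_uniqP un).
by apply: eq_card => z; rewrite in_setT all_in.
Qed.

(** Test vector: [2] on the paths and the square root of [2 * m] at the ends, for [m]
    path vertices; only the edges between ends and paths are used. *)
Lemma fan_radius_ge (G : sgraph) u v ps : fan (@adj G) u v ps -> (0 < sumn (map size ps))%N ->
  Num.sqrt (2 * (sumn (map size ps))%:R) <= spectral_radius R G.
Proof.
move=> fG; set m := sumn _ => m0; set s := Num.sqrt _.
have s0 : 0 <= s := sqrtr_ge0 _.
have s2 : s ^+ 2 = 2 * m%:R by rewrite sqr_sqrtr // mulr_ge0 ?ler0n.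
have G0 : (0 < #|G|)%N by apply/card_gt0P; exists u.
have [un all_in eG] := fG.
have uv : u != v by move: un; rewrite /= inE negb_or => /andP[/andP[]].
have ends z : z \in flatten ps -> (z \in [:: u; v]) = false.
  move=> zF; apply/negP; rewrite mem_seq2 => /orP[] /eqP zE; move: un; rewrite -zE /=.
    by rewrite in_cons zF orbT.
  by rewrite zF andbF.
pose y z := if z \in [:: u; v] then s else 2.
have y0 z : 0 <= y z by rewrite /y; case: ifP => _ //.
have yE z : z \in flatten ps -> y z = 2 by move=> /ends; rewrite /y => ->.
have yu : y u = s by rewrite /y mem_seq2 eqxx.
have yv : y v = s by rewrite /y mem_seq2 eqxx orbT.
have mE : size (flatten ps) = m by rewrite size_flatten.
have norm_y : sqnorm y = 8 * m%:R.
  rewrite /sqnorm (fan_big _ _ fG) /= yu yv s2 big_seq.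
  under eq_bigr do rewrite yE //.
  by rewrite -big_seq big_const_seq count_predT iter_addr addr0 mE -(mulr_natr (2 ^+ 2) m); ring.
have quad_y : 8 * m%:R * s <= quad (@adj G) y.
  have row w : w \in [:: u; v] -> 2 * m%:R * s <= \sum_(z | adj w z) y w * y z.
    move=> we; rewrite -mulr_sumr.
    have -> : y w = s by rewrite /y we.
    rewrite mulrC ler_wpM2l // (fan_big _ _ fG) -[leLHS]add0r; apply: lerD.
      by rewrite addr_ge0 // mulr_ge0.
    rewrite big_seq_cond (eq_bigl (fun z => z \in flatten ps)); last first.
      move=> z; case zF: (z \in flatten ps) => //=; rewrite eG /fan_rel we andbT.
      by apply: contraTneq we => ->; rewrite ends.
    under eq_bigr do rewrite yE //.
    by rewrite -big_seq big_const_seq count_predT iter_addr addr0 mE [leLHS]mulr_natr.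
  have inner w : w \in flatten ps -> 4 * s <= \sum_(z | adj w z) y w * y z.
    move=> wF; rewrite -mulr_sumr yE // (fan_big _ _ fG) yu yv.
    have [wu wv] : w != u /\ w != v by have := ends w wF; rewrite mem_seq2 => /negbT; rewrite negb_or => /andP[].
    rewrite !eG /fan_rel !mem_seq2 wu wv !eqxx !orbT /= !mul1r.
    have : 0 <= \sum_(z <- flatten ps | adj w z) y z by apply: sumr_ge0.
    lra.
  rewrite /quad (fan_big _ _ fG) /= !mul1r.
  have h1 := row u; rewrite mem_seq2 eqxx in h1; have {}h1 := h1 isT.
  have h2 := row v; rewrite mem_seq2 eqxx orbT in h2; have {}h2 := h2 isT.
  have h3 : 4 * s * m%:R <= \sum_(w <- flatten ps) \sum_(z | adj w z) y w * y z.
    have -> : 4 * s * m%:R = \sum_(w <- flatten ps) 4 * s.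
      by rewrite big_const_seq count_predT iter_addr addr0 mE mulr_natr.
    by rewrite big_seq [leRHS]big_seq; apply: ler_sum => w; exact: inner.
  lra.
have := le_trans quad_y (rayleigh G0 y); rewrite norm_y mulrC ler_pM2r //.
by rewrite mulr_gt0 // ltr0n.
Qed.

Lemma quad_more_edges (V : finType) (e f : rel V) (x : V -> R) a b :
  (forall c d, e c d -> f c d) -> (forall c, 0 <= x c) -> f a b -> ~~ e a b ->
  quad e x + x a * x b <= quad f x.
Proof.
move=> ef x0 fab eab.
have row c : \sum_(d | e c d) x c * x d <= \sum_(d | f c d) x c * x d.
  rewrite [leRHS](bigID (e c)) /= -[leLHS]addr0; apply: lerD.
    rewrite le_eqVlt; apply/orP; left; apply/eqP; apply: eq_bigl => d.
    by case ecd: (e c d); rewrite ?andbF // ef.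
  by apply: sumr_ge0 => d _; rewrite mulr_ge0.
rewrite /quad (bigD1 a) //= [leRHS](bigD1 a) //= addrAC; apply: lerD; last by apply: ler_sum.
rewrite [leRHS](bigD1 b) //= addrC lerD2l.
rewrite [leRHS](bigID (e a)) /= -[leLHS]addr0; apply: lerD.
  rewrite le_eqVlt; apply/orP; left; apply/eqP; apply: eq_bigl => d.
  by case ead: (e a d); rewrite ?andbF // (ef _ _ ead) /=; move: eab; case: eqP => // <-; rewrite ead.
by apply: sumr_ge0 => d _; rewrite mulr_ge0.
Qed.

Lemma fan_transport (G H : sgraph) (f : G -> H) u v ps :
  bijective f -> (forall x y, adj (f x) (f y) = adj x y) ->
  fan (@adj G) u v ps -> fan (@adj H) (f u) (f v) (map (map f) ps).
Proof.
move=> fb fadj [un all_in eG]; have fi := bij_inj fb; have [g fK gK] := fb.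
have flE : [:: f u, f v & flatten (map (map f) ps)] = map f [:: u, v & flatten ps].
  by rewrite -map_flatten.
split; rewrite ?flE; first by rewrite map_inj_uniq.
  by move=> z; rewrite -[z]gK mem_map.
move=> a b; rewrite -[a]gK -[b]gK fadj eG /fan_rel (inj_eq fi) linked_map //.
by rewrite !mem_seq2 !(inj_eq fi).
Qed.

End FanRadius.

Lemma planar_sparse (R : realType) (G : sgraph) : planar R G -> sparse_class (@adj G) [set: G].
Proof.
move=> [pos [curve dr]]; split.
  apply: (drawing_no_minor dr van_kampen_K5) => // -[a b].
  by rewrite mem_complete_edges /= => /andP[ab b5]; split=> //; apply: ltn_trans ab b5.
apply: (drawing_no_minor dr van_kampen_K33) => // a.
by rewrite !inE; repeat (case/orP => [/eqP->//|]); move=> /eqP->.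
Qed.

Lemma packed_singletons L s k : 2 <= L -> packed L (s ++ [:: 1]) -> packed L (s ++ 1 :: nseq k 1).
Proof.
move=> L2 /andP[]; rewrite /packed !pairwise_cat !all_cat allrel_consr allrel0r andbT /= !andbT.
move=> /andP[s1 ps] /andP[sL L1].
have sk : allrel (fun a b => a + b <= L) s (nseq k 1) by elim: (k) => [|m IH]; rewrite ?allrel0r //= allrel_consr s1.
have kk : pairwise (fun a b => a + b <= L) (nseq k 1).
  by elim: (k) => //= m ->; rewrite all_nseq L2 orbT.
by rewrite allrel_consr s1 sk ps kk sL L1 !all_nseq L1 L2 !orbT.
Qed.

Lemma path_cover_fan (V : finType) (u v : V) (A : {set V}) (ps : seq (seq V)) : uniq (flatten ps) ->
  (flatten ps =i [predC [:: u; v]]) -> u != v -> fan (fan_rel u v ps) u v ps.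
Proof.
move=> un psE uv; split=> //; last by move=> z; rewrite !in_cons psE !inE; case: (z == u); case: (z == v).
by rewrite /= in_cons !psE !inE !eqxx (negbTE uv) orbT un.
Qed.

Section Extremal.
Local Open Scope ring_scope.
Variables (R : realType) (n l : nat) (X : sgraph) (u' v' : X) (qs : seq (seq X)) (t : seq nat).
Hypotheses (n_big : (18 * 10 ^ 16 <= n)%N) (l5 : (5 <= l)%N) (ln : (l <= n)%N).
Hypotheses (fanX : fan (@adj X) u' v' qs) (sizes : perm_eq (map size qs) t)
  (packed_t : packed (l - 3) t) (sum_t : sumn t = (n - 2)%N)
  (optimal : optimal_sizes R (l - 3) (n - 2) t).

Let nR : 18 * 10 ^+ 16 <= n%:R :> R.
Proof. by rewrite -natrX -natrM ler_nat. Qed.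

Let n_gt2 : (2 < n)%N.
Proof. by rewrite ltnNge -(ler_nat R); apply/negP => n2; have := nR; lra. Qed.

Let cardX : #|X| = n.
Proof. by rewrite (fan_card fanX) (perm_sumn sizes) sum_t; move: n_gt2; case: (n) => [|[|k]] // _; rewrite subn2. Qed.

(** A fan with packed sizes that is at least as good as [X] costs at most as much, so by
    optimality it has the same path sizes. *)
Lemma fan_optimal (H : sgraph) u v ps : fan (@adj H) u v ps -> packed (l - 3) (map size ps) ->
  [::] \notin ps -> #|H| = n -> 12 <= spectral_radius R H -> spectral_radius R X <= spectral_radius R H ->
  isomorphic H X /\ spectral_radius R H <= spectral_radius R X.
Proof.
move=> fH pk ps0 cH r12 XH.
have [d [d0 d6 le]] := fan_cost_le fH fanX (etrans cH (esym cardX)) r12 XH.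
have pos : all (ltn 0) (map size ps).
  rewrite all_map; apply/allP => p pps /=; rewrite lt0n size_eq0.
  by apply: contraNneq ps0 => <-.
have sum_ps : sumn (map size ps) = (n - 2)%N by rewrite -cH (fan_card fH) subn2.
have [_ uniq_opt] := optimal (fan_step_gt0 d0 d6) (fan_step_decay d0 d6) pos pk sum_ps.
have pe : perm_eq (map size ps) (map size [seq q <- qs | q != [::]]).
  apply: (perm_trans (uniq_opt _)); first by rewrite -(cost_perm _ sizes).
  rewrite perm_sym; have -> : map size [seq q <- qs | q != [::]] = [seq m <- map size qs | (0 < m)%N].
    by rewrite filter_map; congr map; apply: eq_filter => q /=; rewrite lt0n size_eq0.
  exact: perm_filter.
split; first exact: fan_iso fH (fan_nonempty fanX) pe.
exact: fan_radius_eq fH (fan_nonempty fanX) pe r12.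
Qed.

(** With the lower bound on [n], this makes the spectral radius exceed [59 * 10 ^+
    7]. *)
Let square_arith (m : R) : 18 * 10 ^+ 16 <= m -> (59 * 10 ^+ 7) ^+ 2 <= 2 * (m - 2).
Proof. by rewrite exprMn -exprM; lra. Qed.

Let big_arith (m : R) : 18 * 10 ^+ 16 <= m -> 10 ^+ 6 <= m.
Proof. lra. Qed.

Let radius_X : [/\ 2 * (n%:R - 2) <= spectral_radius R X ^+ 2, 59 * 10 ^+ 7 <= spectral_radius R X
  & 0 <= spectral_radius R X].
Proof.
have := fan_radius_ge R fanX; rewrite (perm_sumn sizes) sum_t subn_gt0 natrB ?(ltnW n_gt2) // => /(_ n_gt2) h.
have r0 : 0 <= spectral_radius R X := le_trans (sqrtr_ge0 _) h.
have sq := square_arith nR.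
have s0 : 0 <= 2 * (n%:R - 2) :> R := le_trans (sqr_ge0 _) sq.
have rsq : 2 * (n%:R - 2) <= spectral_radius R X ^+ 2.
  by rewrite -[leLHS]sqr_sqrtr // ler_pXn2r // nnegrE ?sqrtr_ge0.
have p0 : 0 <= 59 * 10 ^+ 7 :> R by rewrite mulr_ge0 ?exprn_ge0.
split=> //; rewrite -(@ler_pXn2r _ 2) //; exact: le_trans sq rsq.
Qed.

Section Core.
Variable G : sgraph.
Notation e := (@adj G).
Hypotheses (cardG : #|G| = n) (planarG : planar R G) (freeG : cycle_free l G).
Hypothesis XG : spectral_radius R X <= spectral_radius R G.
Let r := spectral_radius R G.
Let es := @adj_sym G.
Let ei := @adj_irrefl G.

Let sparseG : sparse_class e [set: G] := planar_sparse planarG.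

Let r_big : 59 * 10 ^+ 7 <= r.
Proof. by have [_ h _] := radius_X; exact: le_trans h XG. Qed.

Let r_ge12 : 12 <= r.
Proof. by have := r_big; lra. Qed.

Let r_gt0 : 0 < r.
Proof. by have := r_big; lra. Qed.

Let r_sq : 2 * #|G|%:R - 4 <= r ^+ 2.
Proof.
have [h _ h0] := radius_X; rewrite cardG; apply: (@le_trans _ _ (2 * (n%:R - 2))); first by rewrite mulrBr; lra.
by apply: le_trans h _; rewrite ler_pXn2r // nnegrE // ltW.
Qed.

Section Ends.
Variables (u v : G).
Hypothesis uv : u != v.
Let A := common_nbrs u v.

Let deg_le (S : {set G}) x : S \subset A -> x \in A -> (deg e S x <= 2)%N.
Proof.
move=> SA; rewrite inE => /andP[ux vx].
have xu : x != u by apply: contraTneq ux => ->; rewrite ei.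
have xv : x != v by apply: contraTneq vx => ->; rewrite ei.
apply: leq_trans (common_nbrs_le sparseG xu xv uv); apply: subset_leq_card; apply/subsetP => z.
rewrite mem_nbrs in_setI mem_nbrs in_setT => /andP[zS ->].
by rewrite !andbT; exact: (subsetP SA z zS).
Qed.

Let u_out : u \notin A. Proof. by rewrite inE ei. Qed.
Let v_out : v \notin A. Proof. by rewrite inE ei andbF. Qed.

(** A cycle missing some common neighbour would give a [K_5] minor. *)
Let cycle_covers c a : ucycle e c -> (2 < size c)%N -> {subset c <= A} -> a \in A -> a \in c.
Proof.
move=> cyc c2 cA aA; apply: contraT => ac; have [noK _] := sparseG; exfalso; apply: noK.
have jn x : x \in A -> e u x && e v x by rewrite inE.
have /andP[ua va] := jn a aA.
apply: (cycle_K5_minor es ei cyc c2 ua va _ _ _ ac uv) => [x /cA /jn //||].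
  by apply: contra u_out => /cA.
by apply: contra v_out => /cA.
Qed.

Let joinedA s : {subset s <= A} -> all (joined u v) s.
Proof. by move=> sA; apply/allP => x /sA; rewrite inE. Qed.

Variables (x : G -> R).
Hypotheses (x_ge0 : forall z, 0 <= x z) (x_le1 : forall z, x z <= 1).
Hypothesis eigen : forall z, r * x z = \sum_(w | e z w) x w.
Hypotheses (xu : x u = 1) (xv : 99 / 100 <= x v).
Hypothesis x_small : forall z, z != u -> z != v -> x z <= 1 / 36.
Hypothesis few : #|exceptional u v|%:R <= 1 / 50 * (#|G|%:R : R).

(** Fans with packed sizes do not beat [X], hence do not beat [G]. *)
Let beaten ps : fan (fan_rel u v ps) u v ps -> packed (l - 3) (map size ps) -> [::] \notin ps ->
  spectral_radius R (fan_graph u v ps) <= r.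
Proof.
move=> fH pk ps0; rewrite leNgt; apply/negP => lt.
have [_] := fan_optimal (H := fan_graph u v ps) fH pk ps0 cardG (le_trans r_ge12 (ltW lt)) (le_trans XG (ltW lt)).
by move=> h; have := lt_le_trans lt (le_trans h XG); rewrite ltxx.
Qed.

(** Otherwise the rewired fan would beat [G]. *)
Lemma no_exceptional : exceptional u v = finset.set0.
Proof.
apply/eqP; apply: contraT => /set0Pn[z0 z0B]; exfalso.
have [a0 a0A] : exists a, a \in A.
  apply/set0Pn; apply/eqP => A0.
  have sub : [set: G] \subset exceptional u v :|: [set u; v].
    apply/subsetP => z _; have : z \notin A by rewrite A0 inE.
    by rewrite !inE => ->; rewrite andbT; case: (z == u); case: (z == v).
  have : (#|G| <= #|exceptional u v| + 2)%N.
    rewrite -cardsT; apply: leq_trans (subset_leq_card sub) _; apply: leq_trans (leq_card_setU _ _) _.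
    by rewrite cards2 uv.
  rewrite -(ler_nat R) natrD; have := few; have := big_arith nR; rewrite cardG; lra.
have [w0 w0A w0min] := @arg_minP _ _ G a0 (fun a => a \in A) x a0A.
have sub1 : A :\ w0 \subset A := subsetDl _ _.
have [|[ps cov]|[c [cyc c2 cA]]] := @path_cover_or_cycle _ _ es ei (A :\ w0).
- by move=> a /(subsetP sub1); exact: deg_le.
- pose B := exceptional u v.
  have fH := rewired_fan uv w0A cov.
  have [un psE linkE srt ne] := cov.
  have psA a : a \in flatten ps -> a \in A by rewrite psE => /(subsetP sub1).
  have pk1 : packed (l - 3) (map size (ps ++ [:: [:: w0]])).
    apply: (paths_packed freeG l5 uv).
    + by rewrite flatten_cat cat_uniq un /= orbF andbT psE !inE eqxx.
    + by apply: joinedA => a; rewrite flatten_cat mem_cat /= inE => /orP[/psA|/eqP->].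
    + by rewrite all_cat srt.
    + by rewrite mem_cat negb_or ne.
  have pk : packed (l - 3) (map size (rewired u v w0 ps)).
    rewrite map_cat /= in pk1; rewrite /rewired map_cat /= -map_comp.
    rewrite (_ : map (size \o _) _ = nseq (size (enum B)) 1); last by rewrite /B; elim: (enum _) => //= z s ->.
    by apply: packed_singletons pk1; move: l5; clear; lia.
  have ne' : [::] \notin rewired u v w0 ps.
    by rewrite /rewired mem_cat negb_or ne /= inE /=; apply/mapP => -[].
  have big : 10 ^+ 6 <= (#|G|%:R : R) by rewrite cardG; exact: big_arith nR.
  have := rewired_radius sparseG x_ge0 x_le1 eigen uv xu xv x_small w0A w0min cov big r_gt0 few z0B.
  by rewrite ltNge (beaten fH pk ne').
- have := cycle_covers cyc c2 _ w0A => /(_ (fun a ac => subsetP sub1 a (cA a ac))) /cA.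
  by rewrite !inE eqxx.
Qed.

Lemma extremal_iso : isomorphic G X.
Proof.
have inA a : (a \in A) = (a \in [predC [:: u; v]]).
  have : a \notin exceptional u v by rewrite no_exceptional inE.
  rewrite !inE negb_or; case: (eqVneq a u) => [->|au]; first by rewrite ei.
  case: (eqVneq a v) => [->|av]; first by rewrite ei andbF.
  by rewrite /= negbK.
have [|[ps cov]|[c [cyc c2 cA]]] := @path_cover_or_cycle _ _ es ei A; first by move=> a; exact: deg_le.
- have [un psE linkE srt ne] := cov.
  have psE' : flatten ps =i [predC [:: u; v]] by move=> a; rewrite psE inA.
  have fH := path_cover_fan A un psE' uv.
  have pk : packed (l - 3) (map size ps).
    by apply: (paths_packed freeG l5 uv) => //; apply: joinedA => a; rewrite psE.
  have ends_adj a b : a \in [:: u; v] -> b \in A -> e a b by rewrite [b \in A]inE mem_seq2 => /orP[] /eqP-> /andP[].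
  have out a : a \notin [:: u; v] -> a \in A by rewrite inA.
  have outN a : a \in [:: u; v] -> (a \in A) = false by move=> ae; rewrite inA !inE -mem_seq2 ae.
  have eE a b : (a \in A) || (b \in A) -> e a b = fan_rel u v ps a b.
    rewrite /fan_rel; case: (boolP (a \in [:: u; v])) => [ae|/out aA].
      by rewrite outN //= andbT => bA; rewrite ends_adj //; apply/esym; apply: contraTneq bA => <-; rewrite outN.
    case: (boolP (b \in [:: u; v])) => [be|/out bA] _.
      rewrite es ends_adj //= andbT; apply/esym; apply: contraTneq aA => ->; by rewrite outN.
    by rewrite linkE //=; case: (eqVneq a b) => [->|//]; rewrite -linkE // ei.
  have euv : e u v.
    apply: contraT => nuv; pose H := fan_graph u v ps.
    have H0 : (0 < #|H|)%N by apply/card_gt0P; exists u.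
    have sub a b : e a b -> fan_rel u v ps a b.
      move=> ab; case: (boolP ((a \in A) || (b \in A))) => [/eE <- //|].
      rewrite negb_or !inA !inE !negbK /fan_rel => /andP[ae be].
      by rewrite !mem_seq2 ae andbT; apply: contraTneq ab => ->; rewrite ei.
    have fuv : fan_rel u v ps u v by rewrite /fan_rel uv mem_seq2 eqxx.
    have gain := quad_more_edges sub x_ge0 fuv nuv.
    have := le_trans gain (rayleigh H0 x); rewrite (quad_eigen eigen) => h.
    have h2 : spectral_radius R H * sqnorm x <= r * sqnorm x.
      by rewrite ler_wpM2r ?sqnorm_ge0 //; exact: beaten fH pk ne.
    by have := le_trans h h2; have := xv; rewrite xu; lra.
  have fG : fan e u v ps.
    have [h1 h2 _] := fH; split=> // a b.
    case: (boolP ((a \in A) || (b \in A))) => [/eE //|].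
    rewrite negb_or !inA !inE !negbK /fan_rel !mem_seq2 => /andP[/orP[]/eqP-> /orP[]/eqP->].
    + by rewrite ei eqxx.
    + by rewrite euv uv eqxx.
    + by rewrite es euv eq_sym uv eqxx orbT.
    + by rewrite ei eqxx.
  by have [] := fan_optimal fG pk ne cardG r_ge12 XG.
(* A cycle through all common neighbours contains a path with [n - 2 > l - 3] vertices,
   which gives a cycle of length [l]. *)
exfalso; have /andP[cy uc] := cyc.
have srt : sorted e c by case: (c) cy => //= a s; rewrite rcons_path => /andP[].
have cl := one_path_bound freeG l5 uv uc (joinedA cA) srt.
have cE : size c = (n - 2)%N.
  rewrite -(card_uniqP uc) -cardG -(cardC (mem [:: u; v])).
  rewrite (_ : #|mem [:: u; v]| = 2); last by rewrite (card_uniqP _) //= inE uv.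
  rewrite addKn; apply: eq_card => a; rewrite !inE.
  apply/idP/idP => [/cA|]; first by rewrite inA !inE.
  by move=> h; apply: (cycle_covers cyc c2 cA); rewrite inA !inE.
move: cl l5 ln; rewrite cE; clear; lia.
Qed.

End Ends.

Lemma extremal_unique : isomorphic G X.
Proof.
have G0 : (0 < #|G|)%N by rewrite cardG; apply: leq_trans n_gt2.
have [x [x_ge0 x_le1 [u xu] eigen]] := @perron_vector R G G0.
have big : 10 ^+ 6 <= (#|G|%:R : R) by rewrite cardG; exact: big_arith nR.
have [v [uv xv few x_small]] := skeleton sparseG x_ge0 x_le1 eigen big r_big r_sq xu.
exact: (extremal_iso uv x_ge0 x_le1 eigen xu xv x_small few).
Qed.

End Core.

(** If [G] is isomorphic to [X] then its fan structure is transported from [X]; a better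
    [H] would itself be isomorphic to [X]. *)
Theorem spex_fan : (l - 3 + 2 < l)%N -> unique_up_to_iso (SPEX R (planar_cycle_free R n l)) X.
Proof.
move=> Ll.
have member (G : sgraph) u v ps : fan (@adj G) u v ps -> perm_eq (map size ps) t -> planar_cycle_free R n l G.
  move=> fG st; split; last by apply: fan_cycle_free fG _ Ll; apply: packed_perm packed_t; rewrite perm_sym.
    rewrite (fan_card fG) (perm_sumn st) sum_t; move: n_gt2; clear; lia.
  exact: fan_planar fG.
have r12 : 12 <= spectral_radius R X by have [_ h _] := radius_X; lra.
move=> G; split=> [[[cG pG fG] maxG]|[f fb fadj]].
  by apply: extremal_unique => //; apply: maxG; exact: member fanX sizes.
have [g fK gK] := fb; have gb : bijective g by exists f.
have gadj a b : adj (g a) (g b) = adj a b by rewrite -fadj !gK.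
have fanG := fan_transport gb gadj fanX.
have szE : map size (map (map g) qs) = map size qs.
  by rewrite -map_comp; apply: eq_map => q; rewrite /= size_map.
split; first by apply: member fanG _; rewrite szE.
have XG : spectral_radius R X <= spectral_radius R G.
  by apply: (fan_radius_eq fanX fanG) => //; rewrite szE.
move=> H [cH pH fH]; rewrite leNgt; apply/negP => GH.
have [h hb hadj] := extremal_unique cH pH fH (le_trans XG (ltW GH)).
have [k hK kH] := hb; have kb : bijective k by exists h.
have kadj a b : adj (k a) (k b) = adj a b by rewrite -hadj !kH.
have fanH := fan_transport kb kadj fanX.
have : spectral_radius R H <= spectral_radius R X.
  apply: (fan_radius_eq fanH fanX); last exact: le_trans r12 (le_trans XG (ltW GH)).
  have -> : map size (map (map k) qs) = map size qs by rewrite -map_comp; apply: eq_map => q; rewrite /= size_map.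
  exact: perm_refl.
by rewrite leNgt (le_lt_trans XG GH).
Qed.

End Extremal.

(** * The two families of part sizes *)

Lemma size_map_map (V W : Type) (f : V -> W) (ps : seq (seq V)) :
  map size (map (map f) ps) = map size ps.
Proof. by rewrite -map_comp; apply: eq_map => p; rewrite /= size_map. Qed.

Lemma copies_sizes t k :
  map size [seq map (pair i) p | i <- enum 'I_t, p <- [:: enum 'I_k]] = nseq t k.
Proof.
have -> : nseq t k = nseq (size (enum 'I_t)) k by rewrite size_enum_ord.
by elim: (enum 'I_t) => //= i s ->; rewrite size_map size_enum_ord.
Qed.

Lemma packed_nseq L c k m : 2 * k <= L -> k <= L -> c + k <= L ->
  all (fun x => c + x <= L) (nseq m k) /\ packed L (nseq m k).
Proof.
move=> kk kL ck; rewrite all_nseq ck orbT; split=> //; rewrite /packed all_nseq kL orbT andbT.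
by elim: m => //= m ->; rewrite all_nseq addnn -mul2n kk orbT.
Qed.
Theorem theorem1p4 (R : realType) (n l : nat)
    (hn : 18 * 10 ^ 16 <= n) (hl5 : 5 <= l) (hln : l <= n) :
  (3 * l < 2 * n + 5 ->
   forall a b : nat,
     n - l + 1 = a * (l - 3)./2 + b -> b < (l - 3)./2 ->
     unique_up_to_iso (SPEX R (planar_cycle_free R n l))
       (graph_join (complete_graph 2)
          (disjoint_union (path_graph (uphalf (l - 3)))
             (disjoint_union (copies (a + 1) (path_graph (l - 3)./2))
                (path_graph b)))))
  /\
  (2 * n + 5 <= 3 * l ->
   unique_up_to_iso (SPEX R (planar_cycle_free R n l))
     (graph_join (complete_graph 2)
        (disjoint_union (path_graph (2 * l - n - 4))
           (copies 2 (path_graph (n - l + 1)))))).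
Proof.
have n_l_3 : (l - 3 + 2 < l)%N by lia.
split=> [lt a b ab bk|ge].
- set k := (l - 3)./2 in ab bk *.
  have half : uphalf (l - 3) + k = l - 3 by rewrite uphalf_half -addnA addnn odd_double_half.
  have k_le : k <= uphalf (l - 3) by rewrite uphalf_half leq_addl.
  have fX := join_fan (union_linear (path_linear (uphalf (l - 3)))
    (union_linear (copies_linear (a + 1) (path_linear k)) (path_linear b))).
  apply: (spex_fan hn hl5 hln fX (t := [:: uphalf (l - 3), b & nseq a.+1 k])) => //.
  + rewrite size_map_map !map_cat !size_map_map copies_sizes /= !size_enum_ord addn1.
    by rewrite perm_cons perm_catC.
  + have [[h1 h2] [h3 _]] : (all (fun x => uphalf (l - 3) + x <= l - 3) (nseq a.+1 k) /\
        packed (l - 3) (nseq a.+1 k)) /\ (all (fun x => b + x <= l - 3) (nseq a.+1 k) /\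
        packed (l - 3) (nseq a.+1 k)).
      by split; apply: packed_nseq; lia.
    have [e1 [e2 e3]] : uphalf (l - 3) + b <= l - 3 /\ uphalf (l - 3) <= l - 3 /\ b <= l - 3 by lia.
    move: (nseq a.+1 k) h1 h2 h3 => q h1 /andP[h2 h4] h3.
    by rewrite /packed /= e1 e2 e3 h1 h2 h3 h4.
  + rewrite /= sumn_nseq; move: half ab hln hl5; rewrite mulnC; clear; nia.
  + exact: optimal_short.
- have fX := join_fan (union_linear (path_linear (2 * l - n - 4))
    (copies_linear 2 (path_linear (n - l + 1)))).
  apply: (spex_fan hn hl5 hln fX (t := [:: 2 * l - n - 4; n - l + 1; n - l + 1])) => //.
  + rewrite size_map_map !map_cat !size_map_map copies_sizes /= !size_enum_ord.
    exact: perm_refl.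
  + by rewrite /packed /=; lia.
  + by rewrite /=; lia.
  + exact: optimal_long.
Qed.
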